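(* Let $K(\alpha)$, $\alpha\in I$, be a $\mathcal{C}^{r,r'}$ billiard deformation with $r\ge2$, $r'\ge1$, let $\xi\in\Sigma_n$, and let $p_j=\varphi_j(u_j(\alpha),\alpha)$, $j=0,\dots,n-1$, be the periodic points corresponding to $\xi$. Then each $p_j$ is differentiable with respect to $\alpha$ and $$\frac{dp_j}{d\alpha}=\frac{\partial\varphi_j}{\partial u_j}\frac{\partial u_j}{\partial\alpha}+\frac{\partial\varphi_j}{\partial\alpha},$$ $$\left|\frac{dp_j}{d\alpha}\right|\le\frac{1}{\cos\phi_j}\,\frac{C^{(0,1)}_\varphi+C^{(1,1)}_\varphi d_{\min}}{\kappa_{\min}d_{\min}}+\delta_{\xi_j}C^{(0,1)}_\varphi\le\frac{1}{\cos\phi_{\max}}\,\frac{C^{(0,1)}_\varphi+C^{(1,1)}_\varphi d_{\min}}{\kappa_{\min}d_{\min}}+C^{(0,1)}_\varphi,$$ where $\delta_i=1$ if $K_i$ is affected by the deformation and $\delta_i=0$ otherwise.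
   Context: Deformations. A function $f(x,y)$ is $\mathcal{C}^{A,B}$ if $\partial^{a+b}f/\partial x^a\partial y^b$ is continuous for all $a\le A$, $b\le B$. Let $m\ge3$ and let $I\subseteq[-\infty,\infty]$ be a closed interval. $K(\alpha)=\bigcup_{i=1}^m K_i(\alpha)\subset\mathbb{R}^2$, $\alpha\in I$, is a $\mathcal{C}^{r,r'}$ billiard deformation if for each $\alpha$: the $K_i(\alpha)$ are pairwise disjoint, compact, strictly convex (boundary curvature everywhere positive) with $\mathcal{C}^r$ boundary of length $L_i(\alpha)$; the no-eclipse condition holds (for distinct $i,j,k$ the convex hull of $K_i(\alpha)\cup K_j(\alpha)$ is disjoint from $K_k(\alpha)$); $\partial K_i(\alpha)$ is parametrized counterclockwise by arclength by a $\mathcal{C}^{r,r'}$ function $\tilde\varphi_i(\tilde u,\alpha)$, $\tilde u\in[0,L_i(\alpha)]$; and for all $0\le q\le r$, $0\le q'\le r'$, $(q,q')\ne(0,0)$, there are constants $C^{(q,q')}_\varphi$ (depending on $\alpha$) with $\left\|\partial^{q+q'}\tilde\varphi_i/\partial\tilde u^q\partial\alpha^{q'}\right\|\le C^{(q,q')}_\varphi$ for all $i$. Only one of the obstacles depends on $\alpha$ (an obstacle not depending on $\alpha$ has parametrization independent of $\alpha$). The parametrizations are extended $L_i(\alpha)$-periodically in $\tilde u$; the derivative of a parameter $u_j$ at $\alpha_0$ is that of the continuous local branch whose value at $\alpha_0$ lies in $[0,L_{\xi_j}(\alpha_0)]$. Periodic points. $\Sigma_n$ is the set of $\xi=(\xi_0,\dots,\xi_{n-1})$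 with $\xi_i\in\{1,\dots,m\}$, $\xi_i\ne\xi_{i+1}$, $\xi_{n-1}\ne\xi_0$; indices are mod $n$ and $\varphi_j=\tilde\varphi_{\xi_j}$. For $\xi\in\Sigma_n$ and $\alpha\in I$, the length function $G_\xi(u,\alpha)=\sum_{j=1}^n\|\varphi_j(u_j,\alpha)-\varphi_{j-1}(u_{j-1},\alpha)\|$ has exactly one minimizer $u(\alpha)=(u_0(\alpha),\dots,u_{n-1}(\alpha))$; the points $p_j=\varphi_j(u_j(\alpha),\alpha)$ are the successive reflection points of the periodic billiard trajectory with itinerary $\xi$ (the periodic points corresponding to $\xi$). $\phi_j\in[0,\pi/2)$ is the angle at $p_j$ between the outgoing velocity (direction of $p_{j+1}-p_j$) and the outward unit normal of $K_{\xi_j}(\alpha)$. Constants. Let $M_0(\alpha)$ be the set of $(q,v)$, $q\in\partial K(\alpha)$, $v$ a unit (post-reflection) velocity, whose billiard trajectory in the exterior of $K(\alpha)$ (with elastic reflections) has infinitely many reflections forward and backward in time. $d_{\min}$ is the minimum over $M_0(\alpha)$ of the distance from $q$ to the next reflection point; $\kappa_{\min}>0$ the minimum over $M_0(\alpha)$ of the curvature of $\partial K(\alpha)$ at $q$; $\phi_{\max}<\pi/2$ the maximum over $M_0(\alpha)$ of the angle between $v$ and the outward normal at $q$. *)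

(* Defs.v *)
From mathcomp Require Export all_boot all_order all_algebra.
From mathcomp Require Export all_classical all_reals all_analysis.

Set Implicit Arguments.
Unset Strict Implicit.
Unset Printing Implicit Defensive.

Export Order.TTheory GRing.Theory Num.Theory.
Export numFieldNormedType.Exports.

Local Open Scope classical_set_scope.
Local Open Scope ring_scope.

Section Plane.
Variable R : realType.
Implicit Types v w : 'rV[R]_2.

Definition dot v w : R := v 0 0 * w 0 0 + v 0 1 * w 0 1.

(* The library norm `|v| on row vectors is the sup norm, hence enorm. *)
Definition enorm v : R := Num.sqrt (dot v v).

Definition cross v w : R := v 0 0 * w 0 1 - v 0 1 * w 0 0.

(* (x, y) |-> (y, - x): sends the counterclockwise unit tangent of a convex
   curve to its outward unit normal. *)
Definition clockwise_turn v : 'rV[R]_2 :=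
  \row_j (if j == 0 then v 0 1 else - v 0 0).

Definition convex_hull (A : set 'rV[R]_2) : set 'rV[R]_2 :=
  [set p | forall C : set 'rV[R]_2,
     @convex_set R 'rV[R]_2 C -> A `<=` C -> C p].

Definition strictly_convex (A : set 'rV[R]_2) : Prop :=
  forall p q (t : R), A p -> A q -> p <> q -> 0 < t -> t < 1 ->
    A° (t *: p + (1 - t) *: q).

Definition boundary (A : set 'rV[R]_2) : set 'rV[R]_2 := closure A `\` A°.

End Plane.

Section Calculus.
Variables (R : realType) (V : normedModType R).

(* d^(a+b) F / dx^a dy^b at (x, y). *)
Definition pderiv (a b : nat) (F : R -> R -> V) (x y : R) : V :=
  derive1n a (fun x' => derive1n b (F x') y) x.

(* F is C^{A,B} on the open set U.  The derive operators are total, so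
   the existence of each derivative is required explicitly. *)
Definition CAB_on (A B : nat) (F : R -> R -> V) (U : set (R * R)) : Prop :=
  forall a b, (a <= A)%N -> (b <= B)%N -> forall z : R * R, U z ->
  [/\ (b < B)%N -> derivable (fun y => pderiv 0 b F z.1 y) z.2 1,
      (a < A)%N -> derivable (fun x => pderiv a b F x z.2) z.1 1 &
      {for z, continuous (fun z' : R * R => pderiv a b F z'.1 z'.2)}].

(* C^{A,B} on a set D that need not be open: on some open set containing D. *)
Definition CAB (A B : nat) (F : R -> R -> V) (D : set (R * R)) : Prop :=
  exists U : set (R * R), [/\ open U, D `<=` U & CAB_on A B F U].

Definition Cn (n : nat) (f : R -> V) : Prop :=
  (forall k, (k < n)%N -> forall x, derivable (derive1n k f) x 1) /\
  (forall k, (k <= n)%N -> continuous (derive1n k f)).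

(* f has derivative df at x relative to I (one-sided at an endpoint of I). *)
Definition is_deriv_within (I : set R) (f : R -> V) (x : R) (df : V) : Prop :=
  (fun y => (y - x)^-1 *: (f y - f x)) @ within I x^' --> df.

End Calculus.

Definition is_minimum (R : realType) (S : set R) (x : R) : Prop :=
  S x /\ lbound S x.
Definition is_maximum (R : realType) (S : set R) (x : R) : Prop :=
  S x /\ ubound S x.

(* The real points of the closed interval of the extended line with
   endpoints a and b. *)
Definition param_interval (R : realType) (a b : \bar R) : set R :=
  [set x : R | (a <= x%:E)%E && (x%:E <= b)%E].

Section Deformation.
Variables (R : realType) (m : nat).

(* Only the values of param i u alpha with 0 <= u <= len i alpha describe the
   boundary of obstacle i; the other values are a smooth extension, and the
   periodic extension is eparam below.  The two are kept apart because when
   len i varies with alpha the periodic extension need not be as smooth in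
   (u, alpha) as param, and its alpha-derivative is not periodic. *)
Record obstacles := Obstacles {
  body : 'I_m -> R -> set 'rV[R]_2;
  len : 'I_m -> R -> R;
  param : 'I_m -> R -> R -> 'rV[R]_2
}.

Variable K : obstacles.
Implicit Types (i j k : 'I_m) (u alpha : R) (I : set R).

Definition eparam i u alpha : 'rV[R]_2 :=
  param K i (u - (Num.floor (u / len K i alpha))%:~R * len K i alpha) alpha.

Definition param_domain i I : set (R * R) :=
  [set z | I z.2 /\ 0 <= z.1 <= len K i z.2].

Definition tangent i u alpha := pderiv 1 0 (param K i) u alpha.

Definition outward_normal i u alpha := clockwise_turn (tangent i u alpha).

(* Signed curvature of a curve parametrized by arclength. *)
Definition curvature i u alpha : R :=
  cross (tangent i u alpha) (pderiv 2 0 (param K i) u alpha).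

Definition affected I i : Prop :=
  exists alpha beta, [/\ I alpha, I beta & body K i alpha <> body K i beta].

Definition delta I i : R := if `[< affected I i >] then 1 else 0.

(* For a fixed alpha. Unit speed together with injectivity over one period
   makes len the length of the boundary. In bd_ccw, the obstacle lies to the
   left of each oriented tangent line. *)
Record is_billiard_table (r : nat) (alpha : R) : Prop := {
  bd_disjoint : forall i j, i <> j ->
    body K i alpha `&` body K j alpha = set0;
  bd_compact : forall i, compact (body K i alpha);
  bd_convex : forall i, strictly_convex (body K i alpha);
  bd_no_eclipse : forall i j k, i <> j -> j <> k -> i <> k ->
    convex_hull (body K i alpha `|` body K j alpha) `&` body K k alpha = set0;
  bd_len : forall i, 0 < len K i alpha;
  bd_image : forall i,
    boundary (body K i alpha) =
    [set param K i u alpha | u in [set u | 0 <= u <= len K i alpha]];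
  bd_inj : forall i u v, 0 <= u < len K i alpha -> 0 <= v < len K i alpha ->
    param K i u alpha = param K i v alpha -> u = v;
  bd_Cr : forall i, Cn r (fun u => eparam i u alpha);
  bd_arclength : forall i u, 0 <= u <= len K i alpha ->
    enorm (tangent i u alpha) = 1;
  bd_ccw : forall i u p, 0 <= u <= len K i alpha -> body K i alpha p ->
    0 <= cross (tangent i u alpha) (p - param K i u alpha);
  bd_curvature : forall i u, 0 <= u <= len K i alpha ->
    0 < curvature i u alpha
}.

(* C q q' alpha is the constant C_phi^{(q,q')} at alpha. *)
Record is_billiard_deformation (r r' : nat) (I : set R)
    (C : nat -> nat -> R -> R) : Prop := {
  def_table : forall alpha, I alpha -> is_billiard_table r alpha;
  def_smooth : forall i, CAB r r' (param K i) (param_domain i I);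
  def_bounds : forall q q' i u alpha, (q <= r)%N -> (q' <= r')%N ->
    (q, q') <> (0%N, 0%N) -> I alpha -> 0 <= u <= len K i alpha ->
    enorm (pderiv q q' (param K i) u alpha) <= C q q' alpha;
  def_one : forall i j, affected I i -> affected I j -> i = j;
  def_unaffected : forall i, ~ affected I i ->
    forall alpha beta, I alpha -> I beta ->
      len K i alpha = len K i beta /\
      forall u, 0 <= u <= len K i alpha ->
        param K i u alpha = param K i u beta
}.

(* A boundary point param (obs) (prm), together with an outgoing velocity. *)
Record state := State { obs : 'I_m; prm : R; vel : 'rV[R]_2 }.

Section FixedAlpha.
Variable alpha : R.
Implicit Types x y : state.

Definition pos x := param K (obs x) (prm x) alpha.
Definition nrm x := outward_normal (obs x) (prm x) alpha.

Definition is_state x : Prop :=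
  [/\ 0 <= prm x < len K (obs x) alpha, enorm (vel x) = 1 &
      0 <= dot (vel x) (nrm x)].

(* Free flight from x until K(alpha) is first met, then elastic reflection. *)
Definition next_reflection x y : Prop :=
  exists t : R,
  [/\ 0 < t,
      pos y = pos x + t *: vel x,
      (forall s : R, 0 < s < t ->
         ~ (\bigcup_i body K i alpha) (pos x + s *: vel x)) &
      vel y = vel x - (2 * dot (vel x) (nrm y)) *: nrm y].

Definition M0 : set state :=
  [set x | exists z : int -> state, z 0 = x /\
     forall k : int, is_state (z k) /\ next_reflection (z k) (z (k + 1))].

Definition flight_distances : set R :=
  [set d | exists x y, [/\ M0 x, is_state y, next_reflection x y &
                           d = enorm (pos y - pos x)]].
Definition reflection_curvatures : set R :=
  [set curvature (obs x) (prm x) alpha | x in M0].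
Definition reflection_angles : set R :=
  [set acos (dot (vel x) (nrm x)) | x in M0].

End FixedAlpha.

Section Periodic.
Variables (n : nat) (xi : 'I_n -> 'I_m).
Implicit Type w : 'rV[R]_n.

(* ordS and ord_pred are the cyclic successor and predecessor. *)
Definition is_itinerary : Prop := forall j : 'I_n, xi j <> xi (ordS j).

Definition refl_point (w : 'rV[R]_n) alpha (j : 'I_n) : 'rV[R]_2 :=
  eparam (xi j) (w 0 j) alpha.

Definition length_fun (w : 'rV[R]_n) alpha : R :=
  \sum_(j < n) enorm (refl_point w alpha j - refl_point w alpha (ord_pred j)).

Definition is_length_minimizer (w : 'rV[R]_n) alpha : Prop :=
  forall w' : 'rV[R]_n, length_fun w alpha <= length_fun w' alpha.

(* The minimizer is unique modulo periods; this selects representatives. *)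
Definition is_periodic_param (w : 'rV[R]_n) alpha : Prop :=
  is_length_minimizer w alpha /\
  forall j : 'I_n, 0 <= w 0 j <= len K (xi j) alpha.

(* v is the continuous branch of minimizers near alpha through w. *)
Definition is_local_branch I alpha (w : 'rV[R]_n) (v : R -> 'rV[R]_n) : Prop :=
  v alpha = w /\
  \forall beta \near within I (nbhs alpha),
    is_length_minimizer (v beta) beta /\
    v @ within I (nbhs beta) --> v beta.

Definition refl_angle (w : 'rV[R]_n) alpha (j : 'I_n) : R :=
  let e := refl_point w alpha (ordS j) - refl_point w alpha j in
  acos (dot ((enorm e)^-1 *: e) (outward_normal (xi j) (w 0 j) alpha)).

End Periodic.
End Deformation.

(* Main.v *)
(* The length minimizer over the boundaries is also a minimizer over the convex
   bodies, since a polygon with vertices in the bodies can be pushed onto the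
   boundaries without getting longer. Convexity of the length and the no-eclipse
   condition then make it unique, and force the reflection law with the outgoing
   direction strictly outward. Uniqueness and compactness give continuity of the
   minimizer in alpha.

   The reflection law is differentiated at the single point alpha: with
   c_j = cos phi_j, d_j the flight lengths and kappa_j the curvatures, the
   increments x_j of the parameters satisfy, up to o(|x| + |beta - alpha|),
     2 kappa_j x_j + (c_j x_j + c_(j-1) x_(j-1)) / d_(j-1)
       + (c_(j+1) x_(j+1) + c_j x_j) / d_j = - b_j (beta - alpha).
   At an index where c_j |x_j| is maximal the coupling terms cannot cancel, so this
   cyclic system is invertible and c_j |x_j| <= max |b| / (2 min kappa). This yields
   both differentiability, without an implicit function theorem, and the bound.

   Parameters at the junction 0 ~ len need care, because the period varies with
   alpha. The period is continuous, since otherwise a tangent direction would recur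
   inside one period, and the closing condition then makes it differentiable; so the
   periodic extension is differentiable across the junction. *)
Require Import Defs.
From mathcomp Require Import ring lra.

Set Implicit Arguments.
Unset Strict Implicit.
Unset Printing Implicit Defensive.
Local Open Scope classical_set_scope.
Local Open Scope ring_scope.

(** * Derivatives of scalar functions *)

(** The shape of the proof is dictated by the junction of the boundary parametrizations: across it
    only differentiability of the periodic extension is established, not continuity of its
    derivatives, and $\alpha$ may be an endpoint of the interval. Smoothness is therefore stated as
    first-order estimates relative to the interval, with errors measured against a scale $\rho$ that
    contains the unknown increments. One absorption argument then trades $\rho$ for
    $|\beta-\alpha|$, both for the period and for the orbit.

    The constants come from $b_j$: each of the two flights at $p_j$ contributes at most
    $C^{(0,1)}_\varphi/d_{\min}$, since at most one end of a flight lies on the moving obstacle, and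
    the rotation of the tangent contributes $2C^{(1,1)}_\varphi$. Division by $2\kappa_{\min}$ gives
    the stated fraction.

    As $d_{\min}$, $\kappa_{\min}$ and $\phi_{\max}$ are extrema over $M_0(\alpha)$, the minimizer
    must also be shown to be an actual trajectory: no obstacle may meet its open flights. *)

Section ScalarCalculus.
Variable R : realType.
Implicit Types (g dg : R -> R) (f fs fb fsb : R -> R -> R) (s b x y e d : R).

Definition linear_approx g x l := forall e, 0 < e -> exists2 d, 0 < d &
  forall y, `|y - x| < d -> `|g y - g x - l * (y - x)| <= e * `|y - x|.

(** Only [b] is restricted to [D]: with [D] the parameter interval this covers one-sided
    differentiation at an endpoint, while the boundary parameter [s] stays free. *)
Definition linear_approx2 (D : set R) f s0 b0 A B := forall e, 0 < e ->
  exists2 d, 0 < d & forall s b, `|s - s0| < d -> `|b - b0| < d -> D b ->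
  `|f s b - f s0 b0 - A * (s - s0) - B * (b - b0)|
     <= e * (`|s - s0| + `|b - b0|).

Definition continuous2 (D : set R) f s0 b0 := forall e, 0 < e ->
  exists2 d, 0 < d & forall s b, `|s - s0| < d -> `|b - b0| < d -> D b ->
  `|f s b - f s0 b0| <= e.

Lemma is_derive_approx g x l : is_derive x 1 g l -> linear_approx g x l.
Proof.
move=> [gE gl] e e0.
have : (fun h => h^-1 *: ((g \o shift x) (h *: (1 : R)) - g x)) @ 0^' --> l.
  by rewrite -gl; exact: gE.
move=> /cvgrPdist_le /(_ e e0) [d /= d0 Hd].
exists d => // y yd; have [->|yx] := eqVneq y x.
  by rewrite !subrr mulr0 subrr normr0 mulr0.
have yx0 : y - x != 0 by rewrite subr_eq0.
have := Hd (y - x); rewrite /ball_ /= sub0r normrN => /(_ yd yx0).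
rewrite /shift /= [(y - x) *: 1]mulr1 subrK -[_ *: _]/(_ * _) => H.
have -> : g y - g x - l * (y - x) = - ((l - (y - x)^-1 * (g y - g x)) * (y - x)).
  by rewrite mulrBl mulrAC mulVf // mul1r opprB.
by rewrite normrN normrM ler_wpM2r.
Qed.

Lemma approx_is_derive g x l : linear_approx g x l -> is_derive x 1 g l.
Proof.
move=> gl.
have H : (fun h => h^-1 *: ((g \o shift x) (h *: (1 : R)) - g x)) @ 0^' --> l.
  apply/cvgrPdist_le => e e0; have [d d0 Hd] := gl e e0.
  exists d => //= h; rewrite /= sub0r normrN => hd h0.
  have := Hd (h + x); rewrite addrK => /(_ hd) H.
  rewrite /shift /= [h *: 1]mulr1 -[h^-1 *: _]/(h^-1 * _) -normrN opprB.
  have -> : h^-1 * (g (h + x) - g x) - l = h^-1 * (g (h + x) - g x - l * h).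
    by rewrite [RHS]mulrBr; congr (_ - _); rewrite mulrCA mulVf // mulr1.
  have : `|h^-1 * (g (h + x) - g x - l * h)| <= (e : R).
    by rewrite normrM normfV ler_pdivrMl ?normr_gt0 // [_ * e]mulrC.
  exact.
by split; [apply/cvg_ex; exists l | exact/cvg_lim].
Qed.

Lemma approx_uniq g x l l' : linear_approx g x l -> linear_approx g x l' -> l = l'.
Proof.
by move=> /approx_is_derive [_ <-] /approx_is_derive [_ <-].
Qed.


Lemma approx_combination (g1 g2 : R -> R) x l1 l2 (a1 a2 : R) :
  linear_approx g1 x l1 -> linear_approx g2 x l2 ->
  linear_approx (fun y => a1 * g1 y + a2 * g2 y) x (a1 * l1 + a2 * l2).
Proof.
move=> H1 H2 e e0.
have [n1 n2] := (normr_ge0 a1, normr_ge0 a2).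
pose k := e / (`|a1| + `|a2| + 1).
have k0 : 0 < k by apply: divr_gt0 => //; lra.
have kE : k * (`|a1| + `|a2| + 1) = e by rewrite mulfVK // gt_eqF //; lra.
have [d1 d10 Hd1] := H1 k k0; have [d2 d20 Hd2] := H2 k k0.
exists (Num.min d1 d2); first by rewrite lt_min d10.
move=> y; rewrite lt_min => /andP[/Hd1 h1 /Hd2 h2].
have -> : a1 * g1 y + a2 * g2 y - (a1 * g1 x + a2 * g2 x) - (a1 * l1 + a2 * l2) * (y - x)
  = a1 * (g1 y - g1 x - l1 * (y - x)) + a2 * (g2 y - g2 x - l2 * (y - x)) by ring.
apply: le_trans (ler_normD _ _) _; rewrite !normrM.
set Y := `|y - x| in h1 h2 *.
have b1 := ler_wpM2l n1 h1; have b2 := ler_wpM2l n2 h2.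
have Y0 : 0 <= k * Y by rewrite mulr_ge0 ?(ltW k0) // normr_ge0.
by rewrite -kE; lra.
Qed.

Lemma approx_increasing g x l : linear_approx g x l -> 0 < l ->
  exists2 d, 0 < d & forall h, 0 < h -> h < d -> g (x - h) < g x < g (x + h).
Proof.
move=> gl l0; have [d d0 Hd] := gl (l / 2) (divr_gt0 l0 (ltr0Sn _ _)).
exists d => // h h0 hd; have lh := mulr_gt0 l0 h0.
have := Hd (x + h); rewrite (addrC x) addrK gtr0_norm // => /(_ hd).
rewrite ler_norml => /andP[H1 _].
have := Hd (x - h); rewrite (addrC x) addrK normrN gtr0_norm // => /(_ hd).
by rewrite ler_norml => /andP[_ H2]; apply/andP; split; lra.
Qed.

Lemma pos_lower_bound (t : seq R) : all (fun x => 0 < x) t ->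
  exists2 h, 0 < h & all (fun x => h < x) t.
Proof.
elim: t => [_|x t IH /= /andP[x0 /IH [h h0 Ht]]]; first by exists 1.
exists (Num.min h (x / 2)); first by rewrite lt_min h0 divr_gt0.
apply/andP; split; first by rewrite gt_min; apply/orP; right; lra.
by apply: sub_all Ht => y; rewrite gt_min => ->.
Qed.

Lemma mean_value_bound g dg A e x0 d :
  (forall x, `|x - x0| < d -> is_derive x 1 g (dg x)) ->
  (forall x, `|x - x0| < d -> `|dg x - A| <= e) ->
  forall x y, `|x - x0| < d -> `|y - x0| < d ->
  `|g y - g x - A * (y - x)| <= e * `|y - x|.
Proof.
move=> Hg Hdg.
have main x y : x <= y -> `|x - x0| < d -> `|y - x0| < d ->
    `|g y - g x - A * (y - x)| <= e * `|y - x|.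
  move=> xy xd yd.
  have btw z : x <= z <= y -> `|z - x0| < d.
    by move=> /andP[xz zy]; move: xd yd; rewrite !ltr_norml; lra.
  have gd z : z \in `]x, y[%R -> is_derive z 1 g (dg z).
    by rewrite in_itv /= => /andP[xz zy]; apply: Hg; apply: btw; rewrite !ltW.
  have gc : {within `[x, y], continuous g}.
    apply: derivable_within_continuous => z; rewrite in_itv /= => /btw zd.
    by case: (Hg z zd).
  have [c cxy ->] := MVT_segment xy gd gc.
  rewrite -mulrBl normrM ler_wpM2r //; apply: Hdg; apply: btw.
  by move: cxy; rewrite in_itv.
move=> x y xd yd; have [xy|/ltW yx] := leP x y; first exact: main.
have := main y x yx yd xd; rewrite (distrC x y) => H.
rewrite -normrN; apply: le_trans H; rewrite le_eqVlt; apply/orP; left; apply/eqP.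
by congr (`|_|); ring.
Qed.

(** The increment is taken first in [s] at fixed [b], where continuity of [fs] and the mean value
    theorem control it, then in [b] along [s0], where only the derivative at [b0] enters. *)
Lemma partials_linear_approx2 f fs s0 b0 B d : 0 < d ->
  (forall s b, `|s - s0| < d -> `|b - b0| < d -> is_derive s 1 (f ^~ b) (fs s b)) ->
  continuous2 setT fs s0 b0 -> linear_approx (f s0) b0 B ->
  linear_approx2 setT f s0 b0 (fs s0 b0) B.
Proof.
move=> d0 Hf cfs HB e e0.
have [d1 d10 Hd1] := cfs e e0; have [d2 d20 Hd2] := HB e e0.
pose d3 := Num.min d (Num.min d1 d2).
have d30 : 0 < d3 by rewrite !lt_min d0 d10 d20.
exists d3 => // s b; rewrite !lt_min => /andP[sd /andP[sd1 sd2]]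
  /andP[bd /andP[bd1 bd2]] _.
have bdm : `|b - b0| < Num.min d d1 by rewrite lt_min bd bd1.
have H1 : `|f s b - f s0 b - fs s0 b0 * (s - s0)| <= e * `|s - s0|.
  apply: (@mean_value_bound (f ^~ b) (fs ^~ b) _ e s0 (Num.min d d1)) => //.
  - by move=> x; rewrite lt_min => /andP[xd _]; exact: Hf.
  - by move=> x; rewrite lt_min => /andP[_ xd]; exact: Hd1.
  - by rewrite subrr normr0 lt_min d0.
  - by rewrite lt_min sd.
have H2 := Hd2 b bd2.
have -> : f s b - f s0 b0 - fs s0 b0 * (s - s0) - B * (b - b0) =
  (f s b - f s0 b - fs s0 b0 * (s - s0)) + (f s0 b - f s0 b0 - B * (b - b0)) by ring.
by rewrite [leRHS]mulrDr; apply: le_trans (ler_normD _ _) _; exact: lerD.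
Qed.

(** The second difference over the rectangle with sides [h] and [b - b0] is compared with
    [c * h * (b - b0)] by the mean value theorem in [b] and then in [s]. The order matters:
    [pderiv 1 1] differentiates in the deformation parameter first, while the linearized reflection
    law needs the variation of the tangent. *)
Lemma mixed_partials_commute f fs fb fsb s0 b0 d : 0 < d ->
  (forall s b, `|s - s0| < d -> `|b - b0| < d -> is_derive b 1 (f s) (fb s b)) ->
  (forall s b, `|s - s0| < d -> `|b - b0| < d -> is_derive s 1 (f ^~ b) (fs s b)) ->
  (forall s b, `|s - s0| < d -> `|b - b0| < d -> is_derive s 1 (fb ^~ b) (fsb s b)) ->
  continuous2 setT fsb s0 b0 ->
  linear_approx (fs s0) b0 (fsb s0 b0).
Proof.
move=> d0 Hfb Hfs Hfsb cfsb e e0.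
have [d1 d10 Hd1] := cfsb e e0.
pose d2 := Num.min d d1.
have d20 : 0 < d2 by rewrite lt_min d0.
have ld2 x : `|x| < d2 -> `|x| < d /\ `|x| < d1 by rewrite lt_min => /andP.
have z2 (x : R) : `|x - x| < d2 by rewrite subrr normr0.
exists d2 => // b bd2; set c := fsb s0 b0.
have key h : `|h| < d2 -> `|f (s0 + h) b - f s0 b - (f (s0 + h) b0 - f s0 b0)
     - (c * h) * (b - b0)| <= e * `|h| * `|b - b0|.
  move=> hd2; have hs : `|s0 + h - s0| < d2 by rewrite addrC addKr.
  apply: (@mean_value_bound (fun y => f (s0 + h) y - f s0 y)
    (fun y => fb (s0 + h) y - fb s0 y) (c * h) (e * `|h|) b0 d2) => //.
  - move=> y /ld2[yd _]; apply: is_deriveB; apply: Hfb => //.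
      by case/ld2: hs.
    by case/ld2: (z2 s0).
  - move=> y yd2.
    have -> : e * `|h| = e * `|s0 + h - s0| by congr (_ * `|_|); ring.
    have -> : c * h = c * (s0 + h - s0) by ring.
    apply: (@mean_value_bound (fb ^~ y) (fsb ^~ y) c e s0 d2) => //.
    + by move=> x /ld2[xd _]; apply: Hfsb => //; case/ld2: yd2.
    + by move=> x /ld2[_ xd]; apply: Hd1 => //; case/ld2: yd2.
have bdd : `|b - b0| < d by case/ld2: bd2.
have zd (x : R) : `|x - x| < d by case/ld2: (z2 x).
have /is_derive_approx A1 := Hfs s0 b (zd s0) bdd.
have /is_derive_approx A0 := Hfs s0 b0 (zd s0) (zd b0).
(* With [b] fixed, [eta] pays for replacing the difference quotients of step [h] by [fs]; the
   estimate [key] is uniform in [h], so [h] may be chosen after [b]. *)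
apply/ler_addgt0Pr => eta eta0.
have eta20 : 0 < eta / 2 by lra.
have [r1 r10 Hr1] := A1 (eta / 2) eta20; have [r0 r00 Hr0] := A0 (eta / 2) eta20.
pose h := Num.min (d2 / 2) (Num.min (r1 / 2) (r0 / 2)).
have h0 : 0 < h by rewrite !lt_min; apply/and3P; split; lra.
have hle : [/\ h <= d2 / 2, h <= r1 / 2 & h <= r0 / 2].
  by rewrite /h; split; rewrite !ge_min lexx ?orbT.
have [hd hr1 hr0] := hle.
have nh : `|h| = h by rewrite gtr0_norm.
have {key} := key h; rewrite nh => /(_ ltac:(lra)) K.
have hE : s0 + h - s0 = h by ring.
have := Hr1 (s0 + h); rewrite hE nh => /(_ ltac:(lra)) K1.
have := Hr0 (s0 + h); rewrite hE nh => /(_ ltac:(lra)) K0.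
rewrite -(ler_pM2l h0).
have -> : h * `|fs s0 b - fs s0 b0 - c * (b - b0)| =
   `|h * (fs s0 b - fs s0 b0 - c * (b - b0))| by rewrite normrM nh.
set k := `|b - b0| in K *.
have -> : h * (fs s0 b - fs s0 b0 - c * (b - b0)) =
  (f (s0 + h) b - f s0 b - (f (s0 + h) b0 - f s0 b0) - c * h * (b - b0))
  - (f (s0 + h) b - f s0 b - fs s0 b * h)
  + (f (s0 + h) b0 - f s0 b0 - fs s0 b0 * h) by ring.
apply: le_trans (ler_normD _ _) _; rewrite [leRHS]mulrDr.
have := ler_normB (f (s0 + h) b - f s0 b - (f (s0 + h) b0 - f s0 b0) - c * h * (b - b0))
   (f (s0 + h) b - f s0 b - fs s0 b * h).
lra.
Qed.

End ScalarCalculus.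

(** * First-order expansions along a filter *)

Section FirstOrderExpansions.
Variables (R : realType) (T : Type) (F : set_system T).
Context {FF : Filter F}.
Implicit Types (df dg rho : T -> R).

Definition negligible rho (f : T -> R) := forall e, 0 < e -> \forall z \near F, `|f z| <= e * rho z.

(** Summing the hypotheses with a small constant gives $S\le M|t|+\frac12(|t|+S)$ for $S=\sum|x_i|$
    and $M=\sum|a_i|$, so $S\le(2M+1)|t|$: an error measured against the unknowns becomes one
    measured against [t] alone. *)
Lemma negligible_absorb n (x : 'I_n -> T -> R) (a : 'I_n -> R) (t : T -> R) :
  (forall j, negligible (fun z => `|t z| + \sum_(i < n) `|x i z|)
     (fun z => x j z - a j * t z)) ->
  forall j, negligible (fun z => `|t z|) (fun z => x j z - a j * t z).
Proof.
move=> H j e e0; pose M := \sum_(i < n) `|a i|.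
have M0 : 0 <= M by apply: sumr_ge0 => i _; exact: normr_ge0.
have n0 : 0 <= n%:R :> R by [].
pose k := Num.min (1 / (2 * (n%:R + 1))) (e / (2 * M + 2)).
have k0 : 0 < k by rewrite lt_min !divr_gt0 //; lra.
have kn : k * (n%:R + 1) <= 1 / 2.
  have : k <= 1 / (2 * (n%:R + 1)) by rewrite ge_min lexx.
  by rewrite ler_pdivlMr; lra.
have ke : k * (2 * M + 2) <= e.
  by rewrite -ler_pdivlMr; [rewrite ge_min lexx orbT | lra].
have all_near : \forall z \near F, forall i : 'I_n,
    `|x i z - a i * t z| <= k * (`|t z| + \sum_(l < n) `|x l z|).
  by apply: filter_forall => i; exact: H.
apply: filterS all_near => z Hz.
set S := \sum_(l < n) `|x l z| in Hz; set t' := `|t z| in Hz *.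
have t0 : 0 <= t' by exact: normr_ge0.
have S0 : 0 <= S by apply: sumr_ge0 => i _; exact: normr_ge0.
have SM : S <= M * t' + n%:R * (k * (t' + S)).
  have -> : M * t' + n%:R * (k * (t' + S)) = \sum_(i < n) (`|a i| * t' + k * (t' + S)).
    by rewrite big_split /= -mulr_suml sumr_const card_ord [X in _ + X]mulr_natl.
  apply: ler_sum => i _; rewrite -normrM.
  rewrite -[X in `|X| <= _](subrK (a i * t z)) addrC.
  by apply: le_trans (ler_normD _ _) _; rewrite lerD2l.
have h1 : n%:R * (k * (t' + S)) <= (1 / 2) * (t' + S).
  have -> : n%:R * (k * (t' + S)) = (k * n%:R) * (t' + S) by ring.
  by apply: ler_wpM2r; lra.
apply: le_trans (Hz j) _.
have h2 : k * (t' + S) <= k * ((2 * M + 2) * t') by rewrite ler_wpM2l ?(ltW k0) //; lra.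
by apply: le_trans h2 _; rewrite mulrA ler_wpM2r.
Qed.

Section Scale.
Variable rho : T -> R.
Hypothesis rho0 : forall z, 0 <= rho z.
Hypothesis rho_cvg : rho @ F --> (0 : R).

(** [df] is an arbitrary function of size $O(\rho)$ rather than a linear map, so the increments of
    several unknowns are carried along unevaluated; the size bound makes products of increments
    negligible. *)
Definition expands (f : T -> R) (f0 : R) df :=
  (exists2 C, 0 < C & \forall z \near F, `|df z| <= C * rho z) /\
  negligible rho (fun z => f z - f0 - df z).

Lemma negligibleD (f g : T -> R) : negligible rho f -> negligible rho g ->
  negligible rho (fun z => f z + g z).
Proof.
move=> Hf Hg e e0; have e20 : 0 < e / 2 by lra.
near=> z; apply: le_trans (ler_normD _ _) _.
rewrite [leRHS](_ : _ = e / 2 * rho z + e / 2 * rho z); last by field.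
by apply: lerD; near: z; [exact: Hf | exact: Hg].
Unshelve. all: by end_near. Qed.

Lemma negligibleZ (a : R) (f : T -> R) : negligible rho f -> negligible rho (fun z => a * f z).
Proof.
move=> Hf e e0; have a0 : 0 < `|a| + 1 by have := normr_ge0 a; lra.
apply: filterS (Hf _ (divr_gt0 e0 a0)) => z Hz.
rewrite normrM; apply: (@le_trans _ _ ((`|a| + 1) * `|f z|)).
  by rewrite ler_wpM2r // lerDl.
rewrite -ler_pdivlMl //; apply: le_trans Hz _.
by rewrite [leRHS]mulrA (mulrC _ e).
Qed.

Lemma negligible_ext (f g : T -> R) : (forall z, f z = g z) -> negligible rho f -> negligible rho g.
Proof. by move=> E H e e0; under eq_near do rewrite -E; exact: H. Qed.

Lemma expands_ext (f : T -> R) (f0 : R) df (g : T -> R) (g0 : R) dg : (forall z, f z = g z) -> f0 = g0 ->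
  (forall z, df z = dg z) -> expands f f0 df -> expands g g0 dg.
Proof. by move=> /funext -> -> /funext ->. Qed.

Lemma expands_cst (a : R) : expands (fun=> a) a (fun=> 0).
Proof.
split; first by exists 1 => //; near=> z; rewrite normr0 mul1r.
by move=> e e0; near=> z; rewrite !subrr normr0 mulr_ge0 // ltW.
Unshelve. all: by end_near. Qed.

Lemma expandsD (f : T -> R) (f0 : R) df (g : T -> R) (g0 : R) dg : expands f f0 df -> expands g g0 dg ->
  expands (fun z => f z + g z) (f0 + g0) (fun z => df z + dg z).
Proof.
move=> [[C C0 HC] Hf] [[D D0 HD] Hg]; split.
  exists (C + D); first exact: addr_gt0.
  near=> z; rewrite mulrDl; apply: le_trans (ler_normD _ _) _.
  by apply: lerD; near: z.
by apply: negligible_ext (negligibleD Hf Hg) => z; ring.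
Unshelve. all: by end_near. Qed.

Lemma expandsZ (a : R) (f : T -> R) (f0 : R) df : expands f f0 df ->
  expands (fun z => a * f z) (a * f0) (fun z => a * df z).
Proof.
move=> [[C C0 HC] Hf]; split.
  exists ((`|a| + 1) * C); first by rewrite mulr_gt0 //; have := normr_ge0 a; lra.
  apply: filterS HC => z Hz; rewrite normrM -mulrA.
  by apply: ler_pM => //; rewrite lerDl.
by apply: negligible_ext (negligibleZ a Hf) => z; ring.
Qed.

Lemma expandsB (f : T -> R) (f0 : R) df (g : T -> R) (g0 : R) dg : expands f f0 df -> expands g g0 dg ->
  expands (fun z => f z - g z) (f0 - g0) (fun z => df z - dg z).
Proof.
move=> Hf Hg; have := expandsD Hf (expandsZ (-1) Hg).
by apply: expands_ext => [z||z]; ring.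
Qed.

Lemma expands_increment (f : T -> R) (f0 : R) df : expands f f0 df ->
  exists2 C, 0 < C & \forall z \near F, `|f z - f0| <= C * rho z.
Proof.
move=> [[C C0 HC] Hf]; exists (C + 1); first by rewrite addr_gt0.
have Hf1 := Hf 1 ltr01; near=> z.
rewrite -[f z - f0](subrK (df z)) mulrDl addrC; apply: le_trans (ler_normD _ _) _.
by apply: lerD; near: z.
Unshelve. all: by end_near. Qed.

Lemma negligible_square C (f : T -> R) : 0 < C ->
  (\forall z \near F, `|f z| <= C * (rho z * rho z)) -> negligible rho f.
Proof.
move=> C0 Hf e e0.
have : \forall z \near F, `|0 - rho z| <= e / C.
  by apply: cvgr_dist_le => //; exact: divr_gt0.
apply: filterS2 Hf => z Hz; rewrite sub0r normrN ger0_norm // => Hr.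
apply: le_trans Hz _; rewrite mulrA ler_wpM2r //.
by rewrite -ler_pdivlMl // mulrC.
Qed.

Lemma expandsM (f : T -> R) (f0 : R) df (g : T -> R) (g0 : R) dg : expands f f0 df -> expands g g0 dg ->
  expands (fun z => f z * g z) (f0 * g0) (fun z => f0 * dg z + g0 * df z).
Proof.
move=> Hf Hg; have [C C0 HC] := expands_increment Hf.
have [D D0 HD] := expands_increment Hg.
have [B1 _] := expandsD (expandsZ f0 Hg) (expandsZ g0 Hf).
split; first exact: B1.
have sq : negligible rho (fun z => (f z - f0) * (g z - g0)).
  apply: (negligible_square (mulr_gt0 C0 D0)); near=> z.
  rewrite normrM [leRHS](_ : _ = (C * rho z) * (D * rho z)); last by ring.
  by apply: ler_pM => //; near: z.
have := negligibleD (negligibleD (negligibleZ g0 Hf.2) (negligibleZ f0 Hg.2)) sq.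
by apply: negligible_ext => z; ring.
Unshelve. all: by end_near. Qed.

Lemma expands_comp (phi : R -> R) (l : R) (f : T -> R) (f0 : R) df : linear_approx phi f0 l ->
  expands f f0 df -> expands (fun z => phi (f z)) (phi f0) (fun z => l * df z).
Proof.
move=> Hphi Hf; have [C C0 HC] := expands_increment Hf.
have [B1 N1] := expandsZ l Hf; split; first exact: B1.
have N2 : negligible rho (fun z => phi (f z) - phi f0 - l * (f z - f0)).
  move=> e e0; have [d d0 Hd] := Hphi _ (divr_gt0 e0 C0).
  have : \forall z \near F, `|0 - rho z| < d / C.
    by apply: cvgr_dist_lt => //; exact: divr_gt0.
  apply: filterS2 HC => z Hz; rewrite sub0r normrN ger0_norm // => Hr.
  apply: le_trans (Hd (f z) _) _.
    by apply: le_lt_trans Hz _; rewrite -ltr_pdivlMl // mulrC.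
  by rewrite -mulrA ler_wpM2l ?(ltW e0) // ler_pdivrMl.
by apply: negligible_ext (negligibleD N1 N2) => z; ring.
Qed.

Lemma expands_approx2 (D : set R) (h : R -> R -> R) s0 b0 A B (s b : T -> R) :
  linear_approx2 D h s0 b0 A B -> (\forall z \near F, D (b z)) ->
  (forall z, `|s z - s0| + `|b z - b0| <= rho z) ->
  expands (fun z => h (s z) (b z)) (h s0 b0)
    (fun z => A * (s z - s0) + B * (b z - b0)).
Proof.
move=> Hh HD sb; have sr z : `|s z - s0| <= rho z.
  by apply: le_trans (sb z); rewrite lerDl.
have br z : `|b z - b0| <= rho z by apply: le_trans (sb z); rewrite lerDr.
split.
  exists (`|A| + `|B| + 1); first by have := normr_ge0 A; have := normr_ge0 B; lra.
  near=> z; apply: le_trans (ler_normD _ _) _; rewrite !normrM.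
  have h1 := ler_wpM2l (normr_ge0 A) (sr z).
  have h2 := ler_wpM2l (normr_ge0 B) (br z).
  by have := rho0 z; lra.
move=> e e0; have [d d0 Hd] := Hh e e0.
have : \forall z \near F, `|0 - rho z| < d by apply: cvgr_dist_lt.
apply: filterS2 HD => z Dz; rewrite sub0r normrN ger0_norm // => Hr.
have := Hd (s z) (b z) (le_lt_trans (sr z) Hr) (le_lt_trans (br z) Hr) Dz.
rewrite [X in `|X| <= _ -> _](_ : _ = h (s z) (b z) - h s0 b0
   - (A * (s z - s0) + B * (b z - b0))); last by ring.
by move=> H; apply: le_trans H _; rewrite ler_wpM2l // ltW.
Unshelve. all: by end_near. Qed.

(** An identity valid along the filter is linearized by comparing the expansions of its two sides.
    The closing condition of a boundary curve and the reflection law are both differentiated this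
    way. *)
Lemma expands_eq_near (f g : T -> R) (f0 : R) df dg : expands f f0 df -> expands g f0 dg ->
  (\forall z \near F, f z = g z) -> negligible rho (fun z => df z - dg z).
Proof.
move=> [_ Hf] [_ Hg] E e e0; have e20 : 0 < e / 2 by lra.
have H1 := Hf _ e20; have H2 := Hg _ e20.
near=> z.
have -> : df z - dg z = (g z - f0 - dg z) - (f z - f0 - df z).
  by rewrite (_ : f z = g z); [ring | near: z].
rewrite [leRHS](_ : _ = e / 2 * rho z + e / 2 * rho z); last by field.
by apply: le_trans (ler_normB _ _) _; apply: lerD; near: z.
Unshelve. all: by end_near. Qed.

End Scale.
End FirstOrderExpansions.

(** * Plane vectors *)

Section PlaneVectors.
Variable R : realType.
Implicit Types (v w z : 'rV[R]_2) (a : R).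

Lemma plane_eq v w : v 0 0 = w 0 0 -> v 0 1 = w 0 1 -> v = w.
Proof.
move=> h0 h1; apply/rowP => -[[|[|//]] i].
  by have -> : Ordinal i = 0 by exact: val_inj.
by have -> : Ordinal i = 1 by exact: val_inj.
Qed.

Lemma dotC v w : dot v w = dot w v.
Proof. by rewrite /dot; ring. Qed.
Lemma dotDr v w z : dot v (w + z) = dot v w + dot v z.
Proof. by rewrite /dot !mxE; ring. Qed.
Lemma dotNr v w : dot v (- w) = - dot v w.
Proof. by rewrite /dot !mxE; ring. Qed.
Lemma dotBr v w z : dot v (w - z) = dot v w - dot v z.
Proof. by rewrite dotDr dotNr. Qed.
Lemma dotZr a v w : dot v (a *: w) = a * dot v w.
Proof. by rewrite /dot !mxE; ring. Qed.
Lemma dotDl v w z : dot (w + z) v = dot w v + dot z v.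
Proof. by rewrite !(dotC _ v) dotDr. Qed.
Lemma dotNl v w : dot (- w) v = - dot w v.
Proof. by rewrite !(dotC _ v) dotNr. Qed.
Lemma dotBl v w z : dot (w - z) v = dot w v - dot z v.
Proof. by rewrite !(dotC _ v) dotBr. Qed.
Lemma dotZl a v w : dot (a *: w) v = a * dot w v.
Proof. by rewrite !(dotC _ v) dotZr. Qed.
Lemma dot0r v : dot v 0 = 0.
Proof. by rewrite /dot !mxE; ring. Qed.
Lemma dot0l v : dot 0 v = 0.
Proof. by rewrite dotC dot0r. Qed.

Lemma dot_clockwise_turn v w : dot (clockwise_turn v) w = - cross v w.
Proof. by rewrite /dot /cross !mxE /=; ring. Qed.

Lemma dotvv_ge0 v : 0 <= dot v v.
Proof. by rewrite /dot -!expr2 addr_ge0 ?sqr_ge0. Qed.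

Lemma enorm_ge0 v : 0 <= enorm v.
Proof. exact: sqrtr_ge0. Qed.

Lemma sqr_enorm v : enorm v ^+ 2 = dot v v.
Proof. by rewrite sqr_sqrtr // dotvv_ge0. Qed.

Lemma enorm0 : enorm (0 : 'rV[R]_2) = 0.
Proof. by rewrite /enorm dot0l sqrtr0. Qed.

Lemma enormN v : enorm (- v) = enorm v.
Proof. by rewrite /enorm dotNl dotNr opprK. Qed.

Lemma enormZ a v : enorm (a *: v) = `|a| * enorm v.
Proof.
by rewrite /enorm dotZl dotZr mulrA -expr2 sqrtrM ?sqr_ge0 // sqrtr_sqr.
Qed.

Lemma enorm_eq0 v : enorm v = 0 -> v = 0.
Proof.
move=> v0; have := sqr_enorm v; rewrite v0 expr0n /= /dot => H.
have := sqr_ge0 (v 0 0); have := sqr_ge0 (v 0 1); rewrite !expr2 => h0 h1.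
have /eqP z0 : v 0 0 * v 0 0 = 0 by lra.
have /eqP z1 : v 0 1 * v 0 1 = 0 by lra.
move: z0 z1; rewrite !mulf_eq0 !orbb => /eqP z0 /eqP z1.
by apply: plane_eq; rewrite ?z0 ?z1 mxE.
Qed.

Lemma enorm_gt0 v : v <> 0 -> 0 < enorm v.
Proof. by move=> v0; rewrite lt_def enorm_ge0 andbT; apply/eqP => /enorm_eq0. Qed.

Lemma enorm_unit v : v <> 0 -> enorm ((enorm v)^-1 *: v) = 1.
Proof.
move=> /enorm_gt0 v0; rewrite enormZ ger0_norm ?invr_ge0 ?enorm_ge0 //.
by rewrite mulVf // gt_eqF.
Qed.

Lemma dot_le_enorm v w : `|dot v w| <= enorm v * enorm w.
Proof.
rewrite -ler_sqr ?nnegrE ?mulr_ge0 ?enorm_ge0 // real_normK ?num_real //.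
rewrite exprMn !sqr_enorm -subr_ge0.
have -> : dot v v * dot w w - dot v w ^+ 2 = cross v w ^+ 2.
  by rewrite /dot /cross; ring.
exact: sqr_ge0.
Qed.

Lemma dot_unit_le e v : enorm e = 1 -> `|dot e v| <= enorm v.
Proof. by move=> e1; rewrite -[leRHS]mul1r -e1 dot_le_enorm. Qed.

Lemma ler_enormD v w : enorm (v + w) <= enorm v + enorm w.
Proof.
rewrite -ler_sqr ?nnegrE ?addr_ge0 ?enorm_ge0 // sqr_enorm sqrrD !sqr_enorm.
rewrite dotDl !dotDr (dotC w v).
have := le_trans (ler_norm _) (dot_le_enorm v w); lra.
Qed.

(* AM-GM on [enorm (v + z) * enorm v]. *)
Lemma enormD_quadratic v z : v <> 0 ->
  enorm (v + z) <= enorm v + dot ((enorm v)^-1 *: v) z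
                   + dot z z * ((enorm v)^-1 / 2).
Proof.
move=> /enorm_gt0 v0; rewrite dotZl.
have : 2 * enorm v * enorm (v + z) <= enorm v ^+ 2 + enorm (v + z) ^+ 2.
  by have := sqr_ge0 (enorm v - enorm (v + z)); rewrite !expr2; lra.
rewrite (sqr_enorm (v + z)) dotDl !dotDr (dotC z v) -(sqr_enorm v) => H.
have E : enorm v * (enorm v)^-1 = 1 by rewrite mulfV // gt_eqF.
rewrite -(ler_pM2l (_ : 0 < 2 * enorm v)); last by lra.
apply: le_trans H _; rewrite le_eqVlt; apply/orP; left; apply/eqP.
rewrite expr2; set i := (enorm v)^-1 in E *; set d := enorm v in E *.
transitivity (2 * d * d + 2 * (d * i) * dot v z + (d * i) * dot z z); last by field.
by rewrite E; ring.
Qed.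

Lemma clockwise_turn_unit v : enorm v = 1 -> enorm (clockwise_turn v) = 1.
Proof.
have E : dot (clockwise_turn v) (clockwise_turn v) = dot v v.
  by rewrite /dot !mxE /=; ring.
by rewrite /enorm E.
Qed.

Lemma dotvv_unit v : enorm v = 1 -> dot v v = 1.
Proof. by rewrite -sqr_enorm => ->; rewrite expr1n. Qed.

Lemma dot_frame (T v w : 'rV[R]_2) : enorm T = 1 ->
  dot v w = dot v T * dot w T +
            dot v (clockwise_turn T) * dot w (clockwise_turn T).
Proof.
move=> /dotvv_unit; rewrite /dot !mxE /= => H.
transitivity ((v 0 0 * w 0 0 + v 0 1 * w 0 1) * (T 0 0 * T 0 0 + T 0 1 * T 0 1)).
  by rewrite H mulr1.
by ring.
Qed.

Lemma frame_eq (T v w : 'rV[R]_2) : enorm T = 1 -> dot v T = dot w T ->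
  dot v (clockwise_turn T) = dot w (clockwise_turn T) -> v = w.
Proof.
move=> T1 h1 h2; apply/eqP; rewrite -subr_eq0; apply/eqP; apply: enorm_eq0.
rewrite /enorm (dot_frame _ _ T1) !dotBl h1 h2 !subrr !mulr0 addr0.
exact: sqrtr0.
Qed.

Lemma cross0_parallel (v w : 'rV[R]_2) : cross v w = 0 -> 0 < dot v w ->
  exists2 a, 0 < a & w = a *: v.
Proof.
move=> c0 d0.
have v0 : 0 < dot v v.
  rewrite lt_def dotvv_ge0 andbT; apply/eqP => H.
  have v0 : v = 0 by apply: enorm_eq0; rewrite /enorm H sqrtr0.
  by move: d0; rewrite v0 dot0l ltxx.
exists (dot v w / dot v v); first exact: divr_gt0.
have E : dot v v * (dot v v)^-1 = 1 by rewrite mulfV // gt_eqF.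
have c1 : v 0 0 * w 0 1 = v 0 1 * w 0 0 by move: c0; rewrite /cross => /subr0_eq.
have main x y : y * dot v v = dot v w * x -> y = dot v w / dot v v * x.
  by move=> H; rewrite mulrAC -H -mulrA E mulr1.
apply: plane_eq; rewrite !mxE; apply: main; rewrite /dot.
  transitivity ((v 0 0 * w 0 0 + v 0 1 * w 0 1) * v 0 0
    + v 0 1 * (v 0 1 * w 0 0 - v 0 0 * w 0 1)); first by ring.
  by rewrite c1 subrr mulr0 addr0.
transitivity ((v 0 0 * w 0 0 + v 0 1 * w 0 1) * v 0 1
  + v 0 0 * (v 0 0 * w 0 1 - v 0 1 * w 0 0)); first by ring.
by rewrite c1 subrr mulr0 addr0.
Qed.

End PlaneVectors.

(** * Smooth parametrizations and periodic junctions *)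

Section Coordinates.
Variable R : realType.
Implicit Types (s b x y e d : R).

Lemma coord_is_derive (f : R -> 'rV[R]_2) x (c : 'I_2) : derivable f x 1 ->
  is_derive x 1 (fun t => f t 0 c) (derive1 f x 0 c).
Proof.
move=> fx; split; first by move/derivable_mxP: fx; apply.
by rewrite derive1E derive_mx // mxE.
Qed.

Lemma coord_le_norm (v : 'rV[R]_2) (c : 'I_2) : `|v 0 c| <= `|v|.
Proof.
rewrite [leRHS]/Num.Def.normr/= mx_normrE.
exact: (le_bigmax _ (fun i : 'I_1 * 'I_2 => `|v i.1 i.2|) (0, c)).
Qed.

Lemma continuous2_coord (F : R -> R -> 'rV[R]_2) s b (c : 'I_2) :
  {for (s, b), continuous (fun z : R * R => F z.1 z.2)} ->
  continuous2 setT (fun s b => F s b 0 c) s b.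
Proof.
move=> cF e e0; have /cvgrPdist_le /(_ e e0) := cF.
move=> /nbhs_ballP [d /= d0 Hd]; exists d => // s' b' sd bd _.
have := Hd (s', b') => /=; rewrite /ball /= => /(_ _) H.
apply: le_trans (H _); last by split => /=; rewrite /ball /= distrC.
by rewrite distrC; have := coord_le_norm (F s b - F s' b') c; rewrite !mxE.
Qed.

Record smooth_at (F : R -> R -> 'rV[R]_2) s b : Prop := {
  smooth_ds : forall c, is_derive s 1 (fun x => F x b 0 c) (pderiv 1 0 F s b 0 c);
  smooth_dss : forall c,
    is_derive s 1 (fun x => pderiv 1 0 F x b 0 c) (pderiv 2 0 F s b 0 c);
  smooth_db : forall c, is_derive b 1 (fun y => F s y 0 c) (pderiv 0 1 F s b 0 c);
  smooth_dsb : forall c,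
    is_derive s 1 (fun x => pderiv 0 1 F x b 0 c) (pderiv 1 1 F s b 0 c);
  smooth_cds : forall c, continuous2 setT (fun s b => pderiv 1 0 F s b 0 c) s b;
  smooth_cdss : forall c, continuous2 setT (fun s b => pderiv 2 0 F s b 0 c) s b;
  smooth_cdsb : forall c, continuous2 setT (fun s b => pderiv 1 1 F s b 0 c) s b }.

Lemma CAB_smooth (r r' : nat) F (D : set (R * R)) s0 b0 :
  (2 <= r)%N -> (1 <= r')%N -> CAB r r' F D -> D (s0, b0) ->
  exists2 d, 0 < d &
    forall s b, `|s - s0| < d -> `|b - b0| < d -> smooth_at F s b.
Proof.
move=> r2 r1 [U [oU DU FU]] /DU Uz.
have /nbhs_ballP [d /= d0 Hd] : nbhs (s0, b0) U by apply: open_nbhs_nbhs.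
exists d => // s b sd bd.
have Uzb : U (s, b) by apply: Hd; split; rewrite /ball /= distrC.
have r0 : (0 < r)%N by apply: leq_trans r2.
have r1' : (1 <= r)%N by apply: leq_trans r2.
have [A1 A2 _] := FU 0%N 0%N (leq0n _) (leq0n _) _ Uzb.
have [_ A3 A4] := FU 1%N 0%N r1' (leq0n _) _ Uzb.
have [_ _ A5] := FU 2%N 0%N r2 (leq0n _) _ Uzb.
have [_ A6 _] := FU 0%N 1%N (leq0n _) r1 _ Uzb.
have [_ _ A7] := FU 1%N 1%N r1' r1 _ Uzb.
split => c.
- exact: (coord_is_derive c (A2 r0)).
- exact: (coord_is_derive c (A3 r2)).
- exact: (coord_is_derive c (A1 r1)).
- exact: (coord_is_derive c (A6 r0)).
- exact: continuous2_coord A4.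
- exact: continuous2_coord A5.
- exact: continuous2_coord A7.
Qed.

Lemma linear_approx2_continuous D (f : R -> R -> R) s0 b0 A B :
  linear_approx2 D f s0 b0 A B -> continuous2 D f s0 b0.
Proof.
move=> fl e e0; have [d d0 Hd] := fl 1 ltr01.
have M0 : 0 < 2 + `|A| + `|B|.
  by have := normr_ge0 A; have := normr_ge0 B; lra.
pose q := e / (2 + `|A| + `|B|).
have q0 : 0 < q by exact: divr_gt0.
exists (Num.min d q); first by rewrite lt_min d0.
move=> s b; rewrite !lt_min => /andP[sd sq] /andP[bd bq] Db.
have := Hd s b sd bd Db; set X := f s b - f s0 b0 => H.
have -> : X = (X - A * (s - s0) - B * (b - b0)) + (A * (s - s0) + B * (b - b0)) by ring.
apply: le_trans (ler_normD _ _) _.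
have := ler_normD (A * (s - s0)) (B * (b - b0)); rewrite !normrM => H2.
have a1 : `|A| * `|s - s0| <= `|A| * q by rewrite ler_wpM2l // ltW.
have a2 : `|B| * `|b - b0| <= `|B| * q by rewrite ler_wpM2l // ltW.
have : q * (2 + `|A| + `|B|) = e by rewrite mulfVK // gt_eqF.
lra.
Qed.

Lemma linear_approx2_sub D D' (f : R -> R -> R) s0 b0 A B : D' `<=` D ->
  linear_approx2 D f s0 b0 A B -> linear_approx2 D' f s0 b0 A B.
Proof.
move=> DD H e e0; have [d d0 Hd] := H e e0.
by exists d => // s b sd bd /DD; exact: Hd.
Qed.

Section SmoothNear.
Variables (F : R -> R -> 'rV[R]_2) (s0 b0 d : R).
Hypothesis d0 : 0 < d.
Hypothesis Fd : forall s b, `|s - s0| < d -> `|b - b0| < d -> smooth_at F s b.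

Let z0 (x : R) : `|x - x| < d.
Proof. by rewrite subrr normr0. Qed.

Lemma smooth_approx2 c : linear_approx2 setT (fun s b => F s b 0 c) s0 b0
  (pderiv 1 0 F s0 b0 0 c) (pderiv 0 1 F s0 b0 0 c).
Proof.
apply: (@partials_linear_approx2 _ _ (fun s b => pderiv 1 0 F s b 0 c) _ _ _ d) => //.
- by move=> s b sd bd; exact: (smooth_ds (Fd sd bd) c).
- exact: (smooth_cds (Fd (z0 _) (z0 _)) c).
- exact: (is_derive_approx (smooth_db (Fd (z0 _) (z0 _)) c)).
Qed.

Lemma smooth_tangent_approx2 c :
  linear_approx2 setT (fun s b => pderiv 1 0 F s b 0 c) s0 b0
    (pderiv 2 0 F s0 b0 0 c) (pderiv 1 1 F s0 b0 0 c).
Proof.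
apply: (@partials_linear_approx2 _ _ (fun s b => pderiv 2 0 F s b 0 c) _ _ _ d) => //.
- by move=> s b sd bd; exact: (smooth_dss (Fd sd bd) c).
- exact: (smooth_cdss (Fd (z0 _) (z0 _)) c).
apply: (@mixed_partials_commute _ (fun s b => F s b 0 c)
  (fun s b => pderiv 1 0 F s b 0 c) (fun s b => pderiv 0 1 F s b 0 c)
  (fun s b => pderiv 1 1 F s b 0 c) _ _ d) => //.
- by move=> s b sd bd; exact: (smooth_db (Fd sd bd) c).
- by move=> s b sd bd; exact: (smooth_ds (Fd sd bd) c).
- by move=> s b sd bd; exact: (smooth_dsb (Fd sd bd) c).
- exact: (smooth_cdsb (Fd (z0 _) (z0 _)) c).
Qed.

End SmoothNear.

(** A derivative is determined by the values along any set accumulating at the point, so agreement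
    on one side of a junction, or on the parameter interval up to an endpoint, suffices. *)
Lemma approx_eq_along (g1 g2 : R -> R) x l1 l2 (D : set R) :
  linear_approx g1 x l1 -> linear_approx g2 x l2 ->
  (forall d, 0 < d -> exists y, [/\ D y, y != x & `|y - x| < d]) ->
  (forall y, D y -> g1 y = g2 y) -> g1 x = g2 x -> l1 = l2.
Proof.
move=> g1l g2l acc g12 gx; apply/eqP; rewrite -subr_eq0 -normr_le0.
apply/ler_addgt0Pr => e e0; rewrite add0r.
have e20 : 0 < e / 2 by lra.
have [d1 d10 H1] := g1l (e / 2) e20; have [d2 d20 H2] := g2l (e / 2) e20.
have [|y [Dy yx]] := acc (Num.min d1 d2); first by rewrite lt_min d10.
rewrite lt_min => /andP[/H1 h1 /H2 h2].
have k0 : 0 < `|y - x| by rewrite normr_gt0 subr_eq0.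
rewrite -(ler_pM2r k0) -normrM.
have -> : (l1 - l2) * (y - x) = (g2 y - g2 x - l2 * (y - x))
    - (g1 y - g1 x - l1 * (y - x)) by rewrite (g12 y Dy) gx; ring.
by apply: le_trans (ler_normB _ _) _; lra.
Qed.

Lemma linear_approx_continuous (g : R -> R) x l : linear_approx g x l ->
  forall e, 0 < e -> exists2 d, 0 < d & forall y, `|y - x| < d -> `|g y - g x| <= e.
Proof.
move=> gl e e0.
have H : linear_approx2 setT (fun s b => g s) x 0 l 0.
  move=> e' e'0; have [d d0 Hd] := gl e' e'0; exists d => // s b sd bd _.
  rewrite mul0r subr0; apply: le_trans (Hd s sd) _.
  by rewrite ler_wpM2l ?(ltW e'0) // lerDl.
have [d d0 Hd] := linear_approx2_continuous H e0.
by exists d => // y yd; apply: (Hd y 0); rewrite ?subrr ?normr0.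
Qed.

Lemma approx_local (g1 g2 : R -> R) x l d : 0 < d ->
  (forall y, `|y - x| < d -> g1 y = g2 y) ->
  linear_approx g1 x l -> linear_approx g2 x l.
Proof.
move=> d0 E gl e e0; have [d1 d10 H] := gl e e0.
exists (Num.min d d1); first by rewrite lt_min d0.
move=> y; rewrite lt_min => /andP[yd yd1].
by rewrite -!E ?subrr ?normr0 //; exact: H.
Qed.

(* [G] plays the role of the periodic extension of [g] restricted to [0, L[;
   its differentiability across the junction forces [g] and its derivative to
   agree at [0] and [L]. *)
Lemma periodic_junction (G g : R -> R) L G0 GL g0 gL : 0 < L ->
  (forall x, G (x + L) = G x) -> (forall x, 0 <= x < L -> G x = g x) ->
  linear_approx G 0 G0 -> linear_approx G L GL ->
  linear_approx g 0 g0 -> linear_approx g L gL ->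
  [/\ g L = g 0, gL = g0, G0 = g0 & GL = g0].
Proof.
move=> L0 per Gg G0l GLl g0l gLl.
have e0 : G 0 = g 0 by apply: Gg; rewrite lexx.
have eL : G L = g L.
  apply/eqP; rewrite -subr_eq0 -normr_le0; apply/ler_addgt0Pr => e e_0.
  rewrite add0r; have e20 : 0 < e / 2 by lra.
  have [d1 d10 H1] := linear_approx_continuous GLl e20.
  have [d2 d20 H2] := linear_approx_continuous gLl e20.
  pose h := Num.min (L / 2) (Num.min (d1 / 2) (d2 / 2)).
  have h0 : 0 < h by rewrite !lt_min; apply/and3P; split; lra.
  have [hL h1 h2] : [/\ h <= L / 2, h <= d1 / 2 & h <= d2 / 2].
    by rewrite /h; split; rewrite !ge_min lexx ?orbT.
  have E : L - h - L = - h by ring.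
  have := H1 (L - h); rewrite E normrN gtr0_norm // => /(_ ltac:(lra)) k1.
  have := H2 (L - h); rewrite E normrN gtr0_norm // => /(_ ltac:(lra)) k2.
  have -> : G L - g L = (g (L - h) - g L) - (G (L - h) - G L).
    by rewrite (Gg (L - h)); [ring | lra].
  by apply: le_trans (ler_normB _ _) _; lra.
have E0 : G0 = g0.
  apply: (approx_eq_along (D := [set y | 0 <= y < L]) G0l g0l _ _ e0) => // d d0.
  exists (Num.min (L / 2) (d / 2)).
  have h0 : 0 < Num.min (L / 2) (d / 2) by rewrite !lt_min; apply/andP; split; lra.
  have [hL hd] : Num.min (L / 2) (d / 2) <= L / 2 /\ Num.min (L / 2) (d / 2) <= d / 2.
    by split; rewrite !ge_min lexx ?orbT.
  by split => /=; rewrite ?gt_eqF // ?subr0 ?gtr0_norm //; lra.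
have EL : GL = gL.
  apply: (approx_eq_along (D := [set y | 0 <= y < L]) GLl gLl _ _ eL) => // d d0.
  have h0 : 0 < Num.min (L / 2) (d / 2) by rewrite !lt_min; apply/andP; split; lra.
  have [hL hd] : Num.min (L / 2) (d / 2) <= L / 2 /\ Num.min (L / 2) (d / 2) <= d / 2.
    by split; rewrite !ge_min lexx ?orbT.
  exists (L - Num.min (L / 2) (d / 2)); split => /=.
  - by lra.
  - by rewrite lt_eqF //; lra.
  - by rewrite addrAC subrr add0r normrN gtr0_norm //; lra.
have GL0 : GL = G0.
  apply: (@approx_uniq _ G L) => // e e_0; have [d d0 Hd] := G0l e e_0.
  exists d => // y yd; have := Hd (y - L); rewrite subr0 => /(_ yd).
  by rewrite -per subrK -(per 0) add0r.
split=> //; last by rewrite GL0.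
- by rewrite -eL -e0 -(per 0) add0r.
- by rewrite -EL GL0.
Qed.

End Coordinates.

(** * The billiard table at a fixed parameter *)

Section Eparam.
Variables (R : realType) (m : nat) (K : obstacles R m) (alpha : R).
Hypothesis len_gt0 : forall i, 0 < len K i alpha.

Definition frac_param (i : 'I_m) (w : R) : R :=
  w - (Num.floor (w / len K i alpha))%:~R * len K i alpha.

Lemma eparamE i w : eparam K i w alpha = param K i (frac_param i w) alpha.
Proof. by []. Qed.

Lemma frac_param_itv i w : 0 <= frac_param i w < len K i alpha.
Proof.
have L0 := len_gt0 i; rewrite /frac_param; set L := len K i alpha in L0 *.
have /andP[h1 h2] := floor_itv (w / L).
rewrite intrD ltr_pdivrMr // in h2; rewrite ler_pdivlMr // in h1.
rewrite subr_ge0 h1 /= ltrBlDr; lra.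
Qed.

Lemma frac_param_id i w : 0 <= w < len K i alpha -> frac_param i w = w.
Proof.
move=> /andP[w0 wL]; have L0 := len_gt0 i.
rewrite /frac_param (_ : Num.floor _ = 0) ?mul0r ?subr0 //.
apply: floor_def; rewrite add0r /= divr_ge0 // ?(ltW L0) //.
by rewrite ltr_pdivrMr // mul1r.
Qed.

Lemma frac_param_period i w (k : int) :
  frac_param i (w + k%:~R * len K i alpha) = frac_param i w.
Proof.
have L0 := len_gt0 i; rewrite /frac_param mulrDl mulfK ?gt_eqF //.
rewrite floorDrz ?intr_int // intrKfloor intrD; ring.
Qed.

Lemma eparam_small i w : 0 <= w < len K i alpha ->
  eparam K i w alpha = param K i w alpha.
Proof. by move=> wL; rewrite eparamE frac_param_id. Qed.

Lemma eparam_shift i w (k : int) :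
  eparam K i (w + k%:~R * len K i alpha) alpha = eparam K i w alpha.
Proof. by rewrite !eparamE frac_param_period. Qed.

Lemma eparam_shift1 i w :
  eparam K i (w + len K i alpha) alpha = eparam K i w alpha.
Proof. by have := eparam_shift i w 1; rewrite mul1r. Qed.

End Eparam.

Section Table.
Variables (R : realType) (m : nat) (K : obstacles R m) (r : nat) (alpha : R).
Hypothesis r2 : (2 <= r)%N.
Hypothesis tb : is_billiard_table K r alpha.
Hypothesis sm : forall i s, 0 <= s <= len K i alpha -> smooth_at (param K i) s alpha.
Implicit Types (i j k : 'I_m) (s : R) (p q : 'rV[R]_2).

Local Notation L i := (len K i alpha).
Let L0 i : 0 < L i := bd_len tb i.
Local Notation A i := (body K i alpha).

(** Inside the period [eparam] and [param] coincide nearby. At [0] they coincide only to the right,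
    and the differentiability of the periodic extension supplies the other side. *)
Lemma eparam_approx_small i x c : 0 <= x < L i ->
  linear_approx (fun t => eparam K i t alpha 0 c) x (tangent K i x alpha 0 c).
Proof.
move=> /andP[x0 xL].
have sx : smooth_at (param K i) x alpha by apply: sm; rewrite x0 ltW.
have [Cd _] := bd_Cr tb i.
pose E u := eparam K i u alpha.
have dE : forall x, derivable E x 1 by move=> y; apply: (Cd 0%N); exact: leq_trans r2.
have aE y : linear_approx (fun t => E t 0 c) y (derive1 E y 0 c).
  exact: (is_derive_approx (coord_is_derive c (dE y))).
have [xz|xn0] := eqVneq x 0; last first.
  have x0' : 0 < x by rewrite lt_def xn0.
  apply: (@approx_local _ (fun t => param K i t alpha 0 c) _ _ _ (Num.min x (L i - x))).
  - by rewrite lt_min x0' subr_gt0.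
  - move=> y; rewrite lt_min !ltr_norml => /andP[/andP[y1 y2] /andP[y3 y4]].
    by rewrite (eparam_small L0) //; apply/andP; rewrite -/(L i); split; lra.
  - exact: (is_derive_approx (smooth_ds sx c)).
have zL : 0 <= L i <= L i by rewrite lexx ltW.
have z0 : 0 <= (0 : R) <= L i by rewrite lexx ltW.
have [_ _ E0 _] := periodic_junction (L0 i)
  (fun y => congr1 (fun v : 'rV[R]_2 => v 0 c) (eparam_shift1 L0 i y))
  (fun y yL => congr1 (fun v : 'rV[R]_2 => v 0 c) (eparam_small L0 yL))
  (aE 0) (aE (L i)) (is_derive_approx (smooth_ds (sm z0) c))
  (is_derive_approx (smooth_ds (sm zL) c)).
by rewrite xz /tangent -E0; exact: aE.
Qed.

(** [periodic_junction] is applied to the periodic extension and then to its derivative, which is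
    again periodic and equals the tangent on the half-open period. The second application is where
    two derivatives of the extension are required. *)
Lemma table_junction i : [/\ param K i (L i) alpha = param K i 0 alpha,
  tangent K i (L i) alpha = tangent K i 0 alpha &
  pderiv 2 0 (param K i) (L i) alpha = pderiv 2 0 (param K i) 0 alpha].
Proof.
have z0 : 0 <= (0 : R) <= L i by rewrite lexx ltW.
have zL : 0 <= L i <= L i by rewrite lexx ltW.
have [s0 sL] := (sm z0, sm zL).
have [Cd _] := bd_Cr tb i.
pose E u := eparam K i u alpha.
have dE : forall x, derivable E x 1 by move=> x; apply: (Cd 0%N); exact: leq_trans r2.
have ddE : forall x, derivable (derive1 E) x 1 by move=> x; apply: (Cd 1%N).
have aE c x : linear_approx (fun t => E t 0 c) x (derive1 E x 0 c).
  exact: (is_derive_approx (coord_is_derive c (dE x))).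
have addE c x : linear_approx (fun t => derive1 E t 0 c) x (derive1 (derive1 E) x 0 c).
  exact: (is_derive_approx (coord_is_derive c (ddE x))).
have perE x : E (x + L i) = E x by exact: (eparam_shift1 L0).
have J c := periodic_junction (L0 i) (fun x => congr1 (fun v : 'rV[R]_2 => v 0 c) (perE x))
  (fun x xL => congr1 (fun v : 'rV[R]_2 => v 0 c) (eparam_small L0 xL))
  (aE c 0) (aE c (L i)) (is_derive_approx (smooth_ds s0 c))
  (is_derive_approx (smooth_ds sL c)).
have perdE c x : derive1 E (x + L i) 0 c = derive1 E x 0 c.
  apply: (@approx_uniq _ (fun t => E t 0 c) x) => // e e0.
  have [d d0 Hd] := aE c (x + L i) e e0; exists d => // y yd.
  have := Hd (y + L i); rewrite !perE.
  by rewrite (_ : y + L i - (x + L i) = y - x); [exact | ring].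
have smallE c x : 0 <= x < L i -> derive1 E x 0 c = pderiv 1 0 (param K i) x alpha 0 c.
  by move=> xL; apply: (approx_uniq (aE c x)); exact: eparam_approx_small.
have J2 c := periodic_junction (L0 i) (perdE c) (smallE c)
  (addE c 0) (addE c (L i)) (is_derive_approx (smooth_dss s0 c))
  (is_derive_approx (smooth_dss sL c)).
by split; apply: plane_eq; rewrite /tangent;
  (have [h _ _ _] := J 0; have [h' _ _ _] := J 1;
   have [k k' _ _] := J2 0; have [l l' _ _] := J2 1).
Qed.

Lemma eparam_closed i s : 0 <= s <= L i -> eparam K i s alpha = param K i s alpha.
Proof.
move=> /andP[s0]; rewrite le_eqVlt => /orP[/eqP->|sL]; last first.
  by rewrite (eparam_small L0) // s0.
have [-> _ _] := table_junction i.
by rewrite -[L i]add0r (eparam_shift1 L0) (eparam_small L0) // lexx L0.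
Qed.

Lemma eparam_approx i w c : linear_approx (fun t => eparam K i t alpha 0 c) w
  (tangent K i (frac_param K alpha i w) alpha 0 c).
Proof.
move=> e e0; have [d d0 Hd] := eparam_approx_small c (frac_param_itv L0 i w) e0.
exists d => // y yd.
pose k := Num.floor (w / L i).
have fE : frac_param K alpha i w = w - k%:~R * L i by [].
have := Hd (y - k%:~R * L i); rewrite fE.
have -> : y - k%:~R * L i - (w - k%:~R * L i) = y - w by ring.
have sh t : eparam K i (t - k%:~R * L i) alpha = eparam K i t alpha.
  by rewrite -mulNr -intrN; exact: (eparam_shift L0).
by rewrite !sh; exact.
Qed.

Lemma body_closed i : closed (A i).
Proof. by apply: compact_closed; [exact: norm_hausdorff|exact: bd_compact tb i]. Qed.

Lemma boundaryE i p : boundary (A i) p <-> A i p /\ ~ (A i)° p.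
Proof. by rewrite /boundary -(closure_id _).1 //; exact: body_closed. Qed.

Lemma eparam_boundary i w : boundary (A i) (eparam K i w alpha).
Proof.
rewrite (bd_image tb) eparamE; exists (frac_param K alpha i w) => //=.
by have /andP[-> /ltW ->] := frac_param_itv L0 i w.
Qed.

Lemma boundary_eparam i p : boundary (A i) p ->
  exists2 w, 0 <= w <= L i & p = eparam K i w alpha.
Proof.
rewrite (bd_image tb) => -[w wL <-]; exists w => //.
by rewrite eparam_closed.
Qed.

Lemma eparam_body i w : A i (eparam K i w alpha).
Proof. by have /boundaryE[] := eparam_boundary i w. Qed.

Lemma param_body i s : 0 <= s <= L i -> A i (param K i s alpha).
Proof. by move=> /eparam_closed <-; exact: eparam_body. Qed.

Lemma interior_move i p (z : 'rV[R]_2) : (A i)° p ->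
  exists2 e, 0 < e & A i (p + e *: z).
Proof.
move=> Ap; have : (fun t : R => p + t *: z) @ (0 : R) --> p.
  have : {for (0 : R), continuous (fun t : R => p + t *: z)}.
    apply: continuousD; first exact: cst_continuous.
    by apply: continuousZl; exact: cvg_id.
  by rewrite /prop_for /continuous_at /= scale0r addr0.
move=> /(_ _ Ap) /nbhs_ballP [d /= d0 Hd].
exists (d / 2); first by lra.
by apply: Hd; rewrite /ball /= sub0r normrN gtr0_norm; lra.
Qed.

(** An interior point stays in the body when pushed a distance [e] along the outward normal;
    [bd_ccw] at the pushed point leaves a margin of [e]. *)
Lemma interior_cross i s p : 0 <= s <= L i -> (A i)° p ->
  0 < cross (tangent K i s alpha) (p - param K i s alpha).
Proof.
move=> sL Ap; have [e e0 Ae] := interior_move (clockwise_turn (tangent K i s alpha)) Ap.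
have := bd_ccw tb sL Ae; have /dotvv_unit := bd_arclength tb sL.
set T := tangent _ _ _ _; rewrite /dot => T1.
have -> : cross T (p + e *: clockwise_turn T - param K i s alpha) =
  cross T (p - param K i s alpha) - e * (T 0 0 * T 0 0 + T 0 1 * T 0 1).
  by rewrite /cross !mxE /=; ring.
by rewrite T1 mulr1 => ?; lra.
Qed.

Lemma body_convex i p q (t : R) : A i p -> A i q -> 0 <= t <= 1 ->
  A i (t *: p + (1 - t) *: q).
Proof.
move=> Ap Aq /andP[t0 t1]; have [->|t0'] := eqVneq t 0.
  by rewrite scale0r add0r subr0 scale1r.
have [->|t1'] := eqVneq t 1; first by rewrite subrr scale0r addr0 scale1r.
have [<-|/eqP pq] := eqVneq p q.
  by rewrite -scalerDl addrC subrK scale1r.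
apply: interior_subset; apply: (bd_convex tb) => //; first by rewrite lt_def t0'.
by rewrite lt_def eq_sym t1'.
Qed.

Lemma body_interior_ex i : exists q, (A i)° q.
Proof.
have h2 : 0 <= L i / 2 < L i by have := L0 i; lra.
have h0 : 0 <= (0 : R) < L i by rewrite lexx L0.
exists ((1 / 2) *: param K i 0 alpha + (1 - 1 / 2) *: param K i (L i / 2) alpha).
apply: (bd_convex tb).
- by apply: param_body; rewrite lexx ltW.
- by apply: param_body; have := L0 i; lra.
- by move=> /(bd_inj tb h0 h2); have := L0 i; lra.
- by lra.
- by lra.
Qed.

(** If the points differed, each would lie weakly to the left of the other's tangent line; as the
    directions agree, the chord would lie along both lines. Its midpoint is interior by strict
    convexity, hence strictly to the left. *)
Lemma parallel_tangents i s s' a : 0 <= s <= L i -> 0 <= s' <= L i -> 0 < a ->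
  tangent K i s' alpha = a *: tangent K i s alpha ->
  param K i s alpha = param K i s' alpha.
Proof.
move=> sL s'L a0 TT; apply: contrapT => ne.
have Ap := param_body sL; have Ap' := param_body s'L.
have c1 := bd_ccw tb sL Ap'; have c2 := bd_ccw tb s'L Ap.
have half : (A i)° ((1 / 2) *: param K i s alpha + (1 - 1 / 2) *: param K i s' alpha).
  by apply: (bd_convex tb) => //; lra.
have := interior_cross sL half; move: c1 c2; rewrite TT.
set T := tangent _ _ _ _; set x := param _ _ s _; set y := param _ _ s' _.
have -> : cross (a *: T) (x - y) = - (a * cross T (y - x)).
  by rewrite /cross !mxE; ring.
have -> : cross T ((1 / 2) *: x + (1 - 1 / 2) *: y - x) = cross T (y - x) / 2.
  by rewrite /cross !mxE; field.
move=> c1 c2 c3; have : 0 < a * cross T (y - x) by apply: mulr_gt0 => //; lra.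
lra.
Qed.

Lemma body_disjoint i j p : i <> j -> A i p -> A j p -> False.
Proof. by move=> ij Ai Aj; have : set0 p by rewrite -(bd_disjoint tb ij). Qed.

(** Otherwise the preimage of the body in $[0,1]$ would be open, closed and nonempty, hence
    everything, although the segment ends outside. *)
Lemma segment_boundary i p q : A i p -> ~ A i q ->
  exists2 t, 0 <= t <= 1 & boundary (A i) (p + t *: (q - p)).
Proof.
move=> Ap Aq; apply: contrapT => nb.
pose f (t : R) := p + t *: (q - p).
have cf : continuous f.
  move=> t; have : {for t, continuous (fun t : R => p + t *: (q - p))}.
    apply: continuousD; first exact: cst_continuous.
    by apply: continuousZl; exact: cvg_id.
  exact.
have inA t : 0 <= t <= 1 -> A i (f t) -> (A i)° (f t).
  by move=> t01 At; apply: contrapT => nAt; apply: nb; exists t => //; apply/boundaryE.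
have B1 : `[0, 1]%classic `&` f @^-1` A i = `[0, 1]%classic.
  apply: (@segment_connected R 0 1).
  - exists 0; split; first by rewrite /= in_itv /= lexx ler01.
    by rewrite /= /f scale0r addr0.
  - exists (f @^-1` (A i)°).
      by apply: open_comp; [move=> t _; exact: cf | exact: open_interior].
    apply/seteqP; split => t [t01 At]; split => //; last exact: (@interior_subset _ (A i)).
    by apply: inA => //; move: t01; rewrite /= in_itv.
  - exists (f @^-1` A i) => //; apply: closed_comp (@body_closed i) => t _; exact: cf.
have : (`[0, 1]%classic `&` f @^-1` A i) 1.
  by rewrite B1 /= in_itv /= lexx ler01.
by move=> [_]; rewrite /= /f scale1r addrC subrK.
Qed.

End Table.

(** * Minimal closed polygons *)

Section Cyclic.
Variables (R : realType) (n : nat).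
Implicit Types q : 'I_n -> 'rV[R]_2.

Lemma sum_ord_pred (F : 'I_n -> R) : \sum_(j < n) F (ord_pred j) = \sum_(j < n) F j.
Proof. by rewrite [RHS](reindex_inj (@ord_pred_inj n)). Qed.

Lemma sum_ordS (F : 'I_n -> R) : \sum_(j < n) F (ordS j) = \sum_(j < n) F j.
Proof. by rewrite [RHS](reindex_inj (@ordS_inj n)). Qed.

Definition plen q : R := \sum_(j < n) enorm (q j - q (ord_pred j)).

Definition fdir q (j : 'I_n) : 'rV[R]_2 :=
  (enorm (q (ordS j) - q j))^-1 *: (q (ordS j) - q j).

End Cyclic.

Section FirstOrder.
Variable R : realType.

Lemma ge0_of_quadratic (S C : R) :
  (forall t, 0 < t -> t <= 1 -> 0 <= t * S + t * t * C) -> 0 <= S.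
Proof.
move=> H; rewrite leNgt; apply/negP => S0.
pose t := Num.min 1 (- S / (2 * (`|C| + 1))).
have C0 := normr_ge0 C.
have t0 : 0 < t by rewrite lt_min ltr01 /= divr_gt0 //; lra.
have t1 : t <= 1 by rewrite ge_min lexx.
have tS : t * (`|C| + 1) <= - S / 2.
  have : t <= - S / (2 * (`|C| + 1)) by rewrite ge_min lexx orbT.
  by rewrite ler_pdivlMr; lra.
have := H t t0 t1; rewrite -mulrA -mulrDr pmulr_rge0 //.
have : t * C <= t * `|C| by rewrite ler_wpM2l ?(ltW t0) // ler_norm.
lra.
Qed.

Lemma approx_min_zero (f : R -> R) x l :
  linear_approx f x l -> (forall y, f x <= f y) -> l = 0.
Proof.
move=> fl fmin; apply/eqP; rewrite -normr_le0; apply/ler_addgt0Pr => e e0.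
rewrite add0r; have [d d0 Hd] := fl e e0.
have key h : `|h| < d -> 0 <= l * h + e * `|h|.
  move=> hd; have := Hd (x + h); rewrite (addrC x) addrK => /(_ hd).
  by rewrite ler_norml => /andP[_]; have := fmin (h + x); lra.
have h0 : 0 < d / 2 by lra.
have := key (d / 2); have := key (- (d / 2)); rewrite normrN gtr0_norm //.
move=> /(_ ltac:(lra)) k1 /(_ ltac:(lra)) k2.
rewrite ler_norml -(ler_pM2r h0) -[l <= e](ler_pM2r h0); apply/andP; split; lra.
Qed.

End FirstOrder.

(** * Variational inequality, uniqueness and reflection law for length minimizers *)

Section Configurations.
Variables (R : realType) (m : nat) (K : obstacles R m) (r : nat) (alpha : R).
Hypothesis r2 : (2 <= r)%N.
Hypothesis tb : is_billiard_table K r alpha.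
Hypothesis sm : forall i s, 0 <= s <= len K i alpha -> smooth_at (param K i) s alpha.
Variables (n : nat) (xi : 'I_n -> 'I_m).
Hypothesis hxi : is_itinerary xi.

Local Notation A j := (body K (xi j) alpha).
Implicit Types (q p z : 'I_n -> 'rV[R]_2) (w : 'rV[R]_n) (j : 'I_n).

Definition is_body_minimizer q := (forall j, A j (q j)) /\
  forall q', (forall j, A j (q' j)) -> plen q <= plen q'.

Lemma itinerary_pred j : xi j <> xi (ord_pred j).
Proof. by have := @hxi (ord_pred j); rewrite ord_predK => /nesym. Qed.

Lemma config_neq q j : (forall i, A i (q i)) -> q j - q (ord_pred j) <> 0.
Proof.
move=> Aq /subr0_eq E; apply: (body_disjoint tb (@itinerary_pred j) (Aq j)).
by rewrite E; exact: Aq.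
Qed.

Lemma config_neqS q j : (forall i, A i (q i)) -> q (ordS j) - q j <> 0.
Proof. by move=> Aq; have := config_neq (j := ordS j) Aq; rewrite ordSK. Qed.

(* Moving every point along the segment to the next one, up to the boundary
   of its obstacle, does not increase the length. *)
Lemma length_minimizer_bodies w : is_length_minimizer K xi w alpha ->
  is_body_minimizer (refl_point K xi w alpha).
Proof.
move=> wmin; split => [j|q Aq]; first exact: (eparam_body tb).
have /choice [t Ht] j : exists t, 0 <= t <= 1 /\
    boundary (A j) (q j + t *: (q (ordS j) - q j)).
  have [|t t01 bt] := @segment_boundary _ _ _ _ _ tb (xi j) (q j) (q (ordS j)) (Aq j).
    by move=> H; exact: (body_disjoint tb (@hxi j) H (Aq _)).
  by exists t.
have /choice [w' Hw'] j : exists s : R, q j + t j *: (q (ordS j) - q j)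
    = eparam K (xi j) s alpha.
  by have [_ /(boundary_eparam r2 tb sm) [w' _ ->]] := Ht j; exists w'.
apply: le_trans (wmin (\row_j w' j)) _.
rewrite /length_fun /plen.
pose D j := q (ordS j) - q j.
apply: (@le_trans _ _ (\sum_(j < n)
  (`|1 - t (ord_pred j)| * enorm (D (ord_pred j)) + `|t j| * enorm (D j)))).
  apply: ler_sum => j _; rewrite /refl_point !mxE -!Hw' ord_predK.
  rewrite -!enormZ -[X in enorm X <= _](_ : (1 - t (ord_pred j)) *: D (ord_pred j)
     + t j *: D j = _); first exact: ler_enormD.
  by rewrite /D ord_predK; apply: plane_eq; rewrite !mxE; ring.
rewrite big_split /= (sum_ord_pred (fun j => `|1 - t j| * enorm (D j))) -big_split /=.
rewrite -(sum_ordS (fun j => enorm (q j - q (ord_pred j)))).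
apply: ler_sum => j _; rewrite ordSK -mulrDl -/(D j).
have [/andP[t0 t1] _] := Ht j.
by rewrite !ger0_norm ?subr_ge0 // subrK mul1r.
Qed.

(** An itinerary may return at once to the obstacle it came from, so [i = k] is allowed: then
    convexity puts [x] in that body, against disjointness. For three distinct obstacles this is the
    no-eclipse condition. *)
Lemma no_straight (i j k : 'I_m) (a x b : 'rV[R]_2) (t : R) : i <> j -> j <> k ->
  body K i alpha a -> body K j alpha x -> body K k alpha b -> 0 <= t <= 1 ->
  x = t *: a + (1 - t) *: b -> False.
Proof.
move=> ij jk Aa Ax Ab t01 E.
have [ik|/eqP ik] := eqVneq i k.
  rewrite -ik in Ab; have := body_convex tb Aa Ab t01; rewrite -E => Aix.
  exact: (body_disjoint tb ij Aix Ax).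
have ne := bd_no_eclipse tb ik (nesym jk) ij.
have : set0 x; last by [].
rewrite -ne; split=> // C cC AC.
have /andP[t0 t1] := t01.
have Ca : a \in C by apply/mem_set/AC; left.
have Cb : b \in C by apply/mem_set/AC; right.
have := cC a b (Itv01 t0 t1) Ca Cb.
by move=> /set_mem; rewrite E.
Qed.

Lemma aligned_combination (a x b : 'rV[R]_2) : x - a <> 0 -> b - x <> 0 ->
  (enorm (x - a))^-1 *: (x - a) = (enorm (b - x))^-1 *: (b - x) ->
  exists2 t, 0 <= t <= 1 & x = t *: a + (1 - t) *: b.
Proof.
move=> /enorm_gt0 d1 /enorm_gt0 d2; set u := enorm _ in d1 *; set v := enorm _ in d2 *.
move=> E; exists (v / (u + v)).
  by rewrite divr_ge0 ?ler_pdivrMr ?mul1r /=; lra.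
have u0 : u != 0 by rewrite gt_eqF.
have v0 : v != 0 by rewrite gt_eqF.
have s0 : u + v != 0 by rewrite gt_eqF // addr_gt0.
have {}E : v *: (x - a) = u *: (b - x).
  have := congr1 (fun y : 'rV[R]_2 => (u * v) *: y) E; rewrite !scalerA.
  rewrite (_ : u * v * u^-1 = v); last by field.
  by rewrite (_ : u * v * v^-1 = u); last by field.
have {}E c : x 0 c = v / (u + v) * a 0 c + (1 - v / (u + v)) * b 0 c.
  have := congr1 (fun y : 'rV[R]_2 => y 0 c) E; rewrite !mxE => {}E.
  have -> : v / (u + v) * a 0 c + (1 - v / (u + v)) * b 0 c =
     ((u + v) * x 0 c - (v * (x 0 c - a 0 c) - u * (b 0 c - x 0 c))) / (u + v) by field.
  by rewrite E subrr subr0; field.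
by apply: plane_eq; rewrite !mxE; exact: E.
Qed.

Lemma config_not_aligned q j : (forall i, A i (q i)) ->
  fdir q (ord_pred j) <> fdir q j.
Proof.
move=> Aq; rewrite /fdir ord_predK.
move=> /(aligned_combination (config_neq (j := j) Aq) (config_neqS (j := j) Aq)).
move=> [t t01]; apply: (no_straight (i := xi (ord_pred j)) (j := xi j) (k := xi (ordS j))) => //.
exact/nesym/itinerary_pred.
Qed.

(** The incoming minus the outgoing direction is the gradient of the length with respect to one
    vertex. Moving that vertex towards [x] is admissible by convexity, but only for positive [t],
    hence an inequality. *)
Lemma body_minimizer_first_order q j x : is_body_minimizer q -> A j x ->
  0 <= dot (fdir q (ord_pred j) - fdir q j) (x - q j).
Proof.
move=> [Aq qmin] Ax.
(* The displacement is a whole configuration, so the two edges at [j] need no separate treatment and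
   [n = 2], where they join the same vertices, is included. *)
pose z i := if i == j then x - q j else 0.
pose u i := (enorm (q i - q (ord_pred i)))^-1 *: (q i - q (ord_pred i)).
pose C := \sum_(i < n) dot (z i - z (ord_pred i)) (z i - z (ord_pred i)) *
   ((enorm (q i - q (ord_pred i)))^-1 / 2).
have SE : \sum_(i < n) dot (u i) (z i - z (ord_pred i)) =
    dot (fdir q (ord_pred j) - fdir q j) (x - q j).
  transitivity (\sum_(i < n) dot (u i - u (ordS i)) (z i)).
    rewrite (eq_bigr (fun i => dot (u i) (z i) + - dot (u i) (z (ord_pred i)))); last first.
      by move=> i _; rewrite dotBr.
    rewrite big_split /= [RHS](eq_bigr (fun i => dot (u i) (z i) + - dot (u (ordS i)) (z i))).
      rewrite [RHS]big_split /=; congr (_ + _).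
      by rewrite -(sum_ordS (fun i => - dot (u i) (z (ord_pred i)))); apply: eq_bigr => i _; rewrite ordSK.
    by move=> i _; rewrite dotBl.
  rewrite (bigD1 j) //= big1 ?addr0; last by move=> i /negPf ij; rewrite /z ij dot0r.
  by rewrite /z eqxx /u /fdir !ordSK ord_predK.
rewrite -SE; apply: (@ge0_of_quadratic _ _ C) => t t0 t1.
have Aqt i : A i (q i + t *: z i).
  rewrite /z; have [->|_] := eqVneq i j; last by rewrite scaler0 addr0.
  have -> : q j + t *: (x - q j) = t *: x + (1 - t) *: q j.
    by apply: plane_eq; rewrite !mxE; ring.
  by apply: (body_convex tb) => //; rewrite (ltW t0).
have := qmin _ Aqt; rewrite -subr_ge0 /plen => H; apply: le_trans H _.
rewrite lerBlDl !mulr_sumr -!big_split /=; apply: ler_sum => i _.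
have -> : q i + t *: z i - (q (ord_pred i) + t *: z (ord_pred i)) =
  q i - q (ord_pred i) + t *: (z i - z (ord_pred i)).
  by apply: plane_eq; rewrite !mxE; ring.
apply: le_trans (enormD_quadratic _ (config_neq (j := i) Aq)) _.
by rewrite !dotZr /u !dotZl; lra.
Qed.

(** If two minimizers differed at [j], their midpoint configuration would be a minimizer whose
    vertex at [j] is interior. That vertex could be moved along [- g], which forces [g = 0]: the
    polygon would pass straight through, which [config_not_aligned] excludes. *)
Lemma body_minimizer_unique p q : is_body_minimizer p -> is_body_minimizer q -> p =1 q.
Proof.
move=> [Ap pmin] [Aq qmin] j; apply: contrapT => pq.
pose c i := (1 / 2) *: p i + (1 - 1 / 2) *: q i.
have Ac i : A i (c i) by apply: (body_convex tb) => //; lra.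
have cmin : is_body_minimizer c.
  split=> // q' Aq'; have h1 := pmin q' Aq'; have h2 := qmin q' Aq'.
  apply: (@le_trans _ _ ((1 / 2) * plen p + (1 / 2) * plen q)); last by lra.
  rewrite /plen !mulr_sumr -big_split /=; apply: ler_sum => i _.
  have half : `|1 / 2| = 1 / 2 :> R by rewrite ger0_norm //; lra.
  rewrite -{1 2}half -!enormZ.
  rewrite (_ : c i - c (ord_pred i) = (1 / 2) *: (p i - p (ord_pred i)) +
     (1 / 2) *: (q i - q (ord_pred i))); first exact: ler_enormD.
  by apply: plane_eq; rewrite !mxE; field.
have ci : (A j)° (c j) by apply: (bd_convex tb) => //; lra.
apply: (config_not_aligned (j := j) Ac).
set g := fdir c (ord_pred j) - fdir c j.
have [e e0 Ae] := interior_move (- g) ci.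
have := body_minimizer_first_order cmin Ae; rewrite -/g addrAC subrr add0r dotZr dotNr.
rewrite mulrN oppr_ge0 pmulr_rle0 // => g0.
apply/subr0_eq/enorm_eq0; rewrite -/g /enorm.
by rewrite (_ : dot g g = 0) ?sqrtr0 //; apply/eqP; rewrite eq_le g0 dotvv_ge0.
Qed.

Section AtMinimizer.
Variable w : 'rV[R]_n.
Hypothesis wmin : is_length_minimizer K xi w alpha.
Let p := refl_point K xi w alpha.
Let T j := tangent K (xi j) (frac_param K alpha (xi j) (w 0 j)) alpha.
Let N j := clockwise_turn (T j).

Let Ap j : A j (p j). Proof. exact: (eparam_body tb). Qed.
Let L0 i : 0 < len K i alpha := bd_len tb i.
Let frac01 i s : 0 <= frac_param K alpha i s <= len K i alpha.
Proof. by have /andP[-> /ltW ->] := frac_param_itv L0 i s. Qed.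

Lemma minimizer_tangent_unit j : enorm (T j) = 1.
Proof. exact: (bd_arclength tb (frac01 _ _)). Qed.

Lemma fdir_unit j : enorm (fdir p j) = 1.
Proof. exact: (enorm_unit (config_neqS Ap)). Qed.

(** By the variational inequality, the scalar product with [g] attains its minimum over the body at
    the vertex. Along the boundary, which the periodic extension parametrizes over the whole line,
    this is an unconstrained minimum, so the derivative vanishes. *)
Lemma minimizer_stationary j : dot (T j) (fdir p (ord_pred j) - fdir p j) = 0.
Proof.
have pmin := length_minimizer_bodies wmin.
set g := fdir p (ord_pred j) - _.
apply: (@approx_min_zero _ (fun t => dot (eparam K (xi j) t alpha) g) (w 0 j)); last first.
  move=> y; rewrite -subr_ge0 -dotBl dotC.
  exact: (body_minimizer_first_order pmin (eparam_body tb _ _)).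
have := approx_combination (g 0 0) (g 0 1) (eparam_approx r2 tb sm (xi j) (w 0 j) 0)
  (eparam_approx r2 tb sm (xi j) (w 0 j) 1).
by rewrite dotC /dot; under eq_fun do rewrite !(mulrC (g _ _)).
Qed.

(** Both directions are unit vectors with equal tangential parts, so their normal parts agree up to
    sign; equal ones would make the flights aligned. The variational inequality against an interior
    point then fixes the sign. *)
Lemma minimizer_reflection j :
  0 < dot (fdir p j) (N j) /\
  dot (fdir p (ord_pred j)) (N j) = - dot (fdir p j) (N j).
Proof.
have pmin := length_minimizer_bodies wmin.
have T1 := minimizer_tangent_unit j.
have st := minimizer_stationary j.
set e := fdir p j; set e' := fdir p (ord_pred j) in st *.
have tt : dot e' (T j) = dot e (T j) by rewrite dotBr in st; rewrite !(dotC _ (T j)); exact: subr0_eq.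
have n2 : dot e' (N j) ^+ 2 = dot e (N j) ^+ 2.
  have := dotvv_unit (fdir_unit j); have := dotvv_unit (fdir_unit (ord_pred j)).
  rewrite -/e -/e' (dot_frame e' e' T1) (dot_frame e e T1) tt -/(N j) !expr2; lra.
have ne : dot e' (N j) <> dot e (N j).
  by move=> nn; apply: (config_not_aligned (j := j) Ap); exact: (frame_eq T1 tt nn).
have opp : dot e' (N j) = - dot e (N j).
  have /eqP := n2; rewrite -subr_eq0 subr_sqr mulf_eq0 => /orP[/eqP/subr0_eq//|].
  by rewrite addr_eq0 => /eqP.
split=> //; have [x xA] := body_interior_ex r2 tb sm (xi j).
have Ax : A j x by exact: interior_subset xA.
have := body_minimizer_first_order pmin Ax.
have := interior_cross tb (frac01 (xi j) (w 0 j)) xA.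
rewrite -[cross _ _]opprK -dot_clockwise_turn -/(T j) -/(N j) -eparamE oppr_gt0 -/(p j).
rewrite -/e -/e' (dot_frame (e' - e) _ T1) -/(N j) !(dotBl _ e') tt opp subrr mul0r add0r.
rewrite (dotC (N j)) => xN.
have -> : - dot e (N j) - dot e (N j) = - (2 * dot e (N j)) by ring.
rewrite mulNr oppr_ge0 nmulr_lle0 // => h.
rewrite lt_def; apply/andP; split; last by lra.
by apply/eqP => h0; apply: ne; rewrite opp h0 oppr0.
Qed.

End AtMinimizer.

End Configurations.

(** * The boundary lengths as functions of the parameter *)

Section Filters.
Variable R : realType.

Lemma near_within_nbhsP (D : set R) (x : R) (P : R -> Prop) :
  (\forall y \near within D (nbhs x), P y) <->
  exists2 d, 0 < d & forall y, `|y - x| < d -> D y -> P y.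
Proof.
split=> [/nbhs_ballP [d /= d0 Hd]|[d d0 Hd]].
  by exists d => // y yd; apply: Hd; rewrite /ball /= distrC.
by apply/nbhs_ballP; exists d => //= y; rewrite /ball /= distrC; exact: Hd.
Qed.

Definition strip_nbhs (D : set R) (s b : R) : set_system (R * R) :=
  filter_prod (nbhs s) (within D (nbhs b)).

Global Instance strip_nbhs_filter D s b : Filter (strip_nbhs D s b).
Proof. exact: filter_prod_filter. Qed.

Lemma strip_nbhsP D s b (P : R * R -> Prop) :
  (\forall z \near strip_nbhs D s b, P z) <->
  exists2 d, 0 < d & forall s' b', `|s' - s| < d -> `|b' - b| < d -> D b' -> P (s', b').
Proof.
split=> [[[A B] /= [/nbhs_ballP [d1 /= d10 H1] /near_within_nbhsP [d2 d20 H2]] AB]|].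
  exists (Num.min d1 d2) => [|s' b']; first by rewrite lt_min d10.
  rewrite !lt_min => /andP[s1 _] /andP[_ b2] Db; apply: AB; split => /=.
    by apply: H1; rewrite /ball /= distrC.
  exact: H2.
move=> [d d0 Hd]; exists ([set s' | `|s' - s| < d], [set b' | `|b' - b| < d /\ D b']) => /=.
  split; first by apply/nbhs_ballP; exists d => //= y; rewrite /ball /= distrC.
  by apply/near_within_nbhsP; exists d.
by move=> [s' b'] /= [sd [bd Db]]; exact: Hd.
Qed.

Lemma continuous2_cvg D (f : R -> R -> R) s b : continuous2 D f s b ->
  (fun z => f z.1 z.2) @ strip_nbhs D s b --> f s b.
Proof.
move=> cf; apply/cvgrPdist_le => e e0; have [d d0 Hd] := cf e e0.
apply/strip_nbhsP; exists d => // s' b' sd bd Db /=.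
by rewrite distrC; exact: Hd.
Qed.

Lemma continuous2_cvg_snd (f : R -> R -> R) D s b : continuous2 setT f s b ->
  f s @ within D (nbhs b) --> f s b.
Proof.
move=> cf; apply/cvgrPdist_le => e e0; have [d d0 Hd] := cf e e0.
apply/near_within_nbhsP; exists d => // b' bd Db /=.
by rewrite distrC; apply: Hd => //; rewrite subrr normr0.
Qed.

Section PlaneLimits.
Variables (T : Type) (F : set_system T).
Hypothesis FF : Filter F.

Definition cvg_coord (f : T -> 'rV[R]_2) (v : 'rV[R]_2) :=
  forall c : 'I_2, (fun z => f z 0 c) @ F --> v 0 c.

Lemma cvg_coord_cst (v : 'rV[R]_2) : cvg_coord (fun=> v) v.
Proof. by move=> c; exact: cvg_cst. Qed.

Lemma cvg_coordB f g v w : cvg_coord f v -> cvg_coord g w ->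
  cvg_coord (fun z => f z - g z) (v - w).
Proof.
move=> fv gw c; rewrite !mxE; under eq_fun do rewrite !mxE.
exact: (cvgB (fv c) (gw c)).
Qed.

Lemma cvg_dot f g v w : cvg_coord f v -> cvg_coord g w ->
  (fun z => dot (f z) (g z)) @ F --> dot v w.
Proof.
by move=> fv gw; exact: (cvgD (cvgM (fv 0) (gw 0)) (cvgM (fv 1) (gw 1))).
Qed.

Lemma cvg_cross f g v w : cvg_coord f v -> cvg_coord g w ->
  (fun z => cross (f z) (g z)) @ F --> cross v w.
Proof.
by move=> fv gw; exact: (cvgB (cvgM (fv 0) (gw 1)) (cvgM (fv 1) (gw 0))).
Qed.

Lemma cvg_enorm f v : cvg_coord f v -> (fun z => enorm (f z)) @ F --> enorm v.
Proof.
move=> fv; have := cvg_dot fv fv => H.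
exact: (continuous_cvg _ (@sqrt_continuous R _) H).
Qed.

End PlaneLimits.

End Filters.

(** * Continuity and derivative of the period, from the closing condition *)

Section Deformation.
Variables (R : realType) (m r r' : nat) (K : obstacles R m) (I : set R).
Variable C : nat -> nat -> R -> R.
Hypotheses (hr : (2 <= r)%N) (hr' : (1 <= r')%N).
Hypothesis hK : is_billiard_deformation K r r' I C.
Implicit Types (i : 'I_m) (c : 'I_2) (s b alpha e : R).

Local Notation pt i c s b := (param K i s b 0 c).
Local Notation tg i c s b := (pderiv 1 0 (param K i) s b 0 c).

Lemma deformation_smooth_near i alpha s : I alpha -> 0 <= s <= len K i alpha ->
  exists2 d, 0 < d &
    forall s' b, `|s' - s| < d -> `|b - alpha| < d -> smooth_at (param K i) s' b.
Proof. by move=> Ia sL; exact: (CAB_smooth hr hr' (def_smooth hK i)). Qed.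

Lemma deformation_smooth alpha : I alpha ->
  forall i s, 0 <= s <= len K i alpha -> smooth_at (param K i) s alpha.
Proof.
move=> Ia i s sL; have [d d0 Hd] := deformation_smooth_near Ia sL.
by apply: Hd; rewrite subrr normr0.
Qed.

Lemma tangent_cvg D i s b : smooth_at (param K i) s b ->
  cvg_coord (strip_nbhs D s b) (fun z => tangent K i z.1 z.2) (tangent K i s b).
Proof.
move=> H c; apply: (@continuous2_cvg _ D (fun s b => tg i c s b)) => e e0.
by have [d d0 Hd] := smooth_cds H c e0; exists d => // s' b' sd bd _; exact: Hd.
Qed.

Lemma tangent_cvg_snd D i s b : smooth_at (param K i) s b ->
  cvg_coord (within D (nbhs b)) (fun b' => tangent K i s b') (tangent K i s b).
Proof.
move=> H c; exact: (@continuous2_cvg_snd _ (fun s b => tg i c s b) _ _ _ (smooth_cds H c)).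
Qed.

Lemma strip_cvg_snd D (f : R -> 'rV[R]_2) (v : 'rV[R]_2) s b :
  cvg_coord (within D (nbhs b)) f v ->
  cvg_coord (strip_nbhs D s b) (fun z => f z.2) v.
Proof.
move=> H c; rewrite /strip_nbhs.
exact: (@cvg_comp _ _ _ snd (fun b' => f b' 0 c) _ _ _ cvg_snd (H c)).
Qed.

Lemma param_continuous2 alpha i s c : I alpha -> 0 <= s <= len K i alpha ->
  continuous2 setT (fun s b => pt i c s b) s alpha.
Proof.
move=> Ia sL; have [d d0 Hd] := deformation_smooth_near Ia sL.
exact: (linear_approx2_continuous (smooth_approx2 d0 Hd c)).
Qed.

Section LengthAt.
Variables (alpha : R) (i : 'I_m).
Hypothesis Ia : I alpha.
Local Notation F := (within I (nbhs alpha)).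
Local Notation L := (len K i alpha).

Let tb : is_billiard_table K r alpha := def_table hK Ia.
Let L0 : 0 < L := bd_len tb i.
Let z0 : 0 <= (0 : R) <= L. Proof. by rewrite lexx ltW. Qed.
Let zL : 0 <= L <= L. Proof. by rewrite lexx ltW. Qed.
Let sm := deformation_smooth Ia.

(* If the period were longer, the tangent would return to its initial direction
   strictly before the end of the period. *)
Lemma len_lt_of_tangent_sign b x h : I b -> 0 < h -> h < x ->
  (forall s, x - h <= s <= x + h -> smooth_at (param K i) s b) ->
  cross (tangent K i 0 b) (tangent K i (x - h) b) < 0 ->
  0 < cross (tangent K i 0 b) (tangent K i (x + h) b) ->
  (forall s, x - h <= s <= x + h ->
     0 < dot (tangent K i 0 b) (tangent K i s b)) ->
  len K i b < x + h.
Proof.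
move=> Ib h0 hx sms mb pb phi; rewrite ltNge; apply/negP => Lb.
have xh : x - h <= x + h by clear mb pb phi sms; lra.
have [||s sh s0] := @IVT R (fun s => cross (tangent K i 0 b) (tangent K i s b))
  (x - h) (x + h) 0 xh.
- apply: derivable_within_continuous => s; rewrite in_itv /= => /sms sm_s.
  have := approx_combination (tg i 0 0 b) (- tg i 1 0 b)
    (is_derive_approx (smooth_dss sm_s 1)) (is_derive_approx (smooth_dss sm_s 0)).
  move=> /approx_is_derive [+ _].
  by rewrite /cross /tangent; under [X in derivable X _ _ -> _]eq_fun do rewrite mulNr.
- apply/andP; split; first by rewrite ge_min; apply/orP; left; exact: (ltW mb).
  by rewrite le_max; apply/orP; right; exact: (ltW pb).
move: sh; rewrite in_itv /= => sh; have [s1 s2] := andP sh.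
have tbb := def_table hK Ib.
have [a a0 Ta] := cross0_parallel s0 (phi s sh).
have zb : 0 <= (0 : R) <= len K i b by rewrite lexx ltW // (bd_len tbb).
have sb : 0 <= s <= len K i b by clear mb pb phi s0 Ta; apply/andP; split; lra.
have E := parallel_tangents hr tbb (deformation_smooth Ib) zb sb a0 Ta.
have s2' : s < x + h.
  by rewrite lt_neqAle s2 andbT; apply/eqP => sE; move: pb; rewrite -sE s0 ltxx.
have : 0 = s.
  by apply: (bd_inj tbb _ _ E); clear mb pb phi s0 Ta E; apply/andP; split; lra.
by move=> s00; clear mb pb phi s0 Ta E; lra.
Qed.

(** At [alpha] the cross product of the initial tangent with the tangent at [s] vanishes at the
    junction, with slope equal to the curvature there, which is positive. The resulting signs at
    [L - h] and [L + h] persist for nearby parameters. *)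
Lemma len_usc e : 0 < e -> \forall b \near F, len K i b < L + e.
Proof.
move=> e0; have [_ TL _] := table_junction hr tb sm i.
have [d d0 Hd] := deformation_smooth_near Ia zL.
pose psi s b := cross (tangent K i 0 b) (tangent K i s b).
pose kap := curvature K i L alpha.
have kap0 : 0 < kap := bd_curvature tb zL.
have psiL : linear_approx (psi ^~ alpha) L kap.
  have := approx_combination (tg i 0 0 alpha) (- tg i 1 0 alpha)
    (is_derive_approx (smooth_dss (sm zL) 1)) (is_derive_approx (smooth_dss (sm zL) 0)).
  rewrite /kap /curvature TL /cross /tangent mulNr => H.
  by rewrite /psi /cross /tangent; under eq_fun do rewrite -mulNr.
have psi0 : psi L alpha = 0 by rewrite /psi TL /cross mulrC subrr.
have [d1 d10 H1] := approx_increasing psiL kap0.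
have phiL : (fun z : R * R => dot (tangent K i 0 z.2) (tangent K i z.1 z.2)) @
    strip_nbhs I L alpha --> (1 : R).
  rewrite -(dotvv_unit (bd_arclength tb z0)) -{2}TL.
  apply: cvg_dot; last exact: tangent_cvg (sm zL).
  exact: (@strip_cvg_snd I (fun b => tangent K i 0 b) _ L alpha
    (@tangent_cvg_snd I i 0 alpha (sm z0))).
have [d2 d20 H2] := (strip_nbhsP _ _ _ _).1 (cvgr_gt _ phiL _ ltr01).
have [|h h0 /= /and5P[hd hd1 hd2 he /andP[hL _]]] :=
  @pos_lower_bound R [:: d; d1; d2; e; L]; first by rewrite /= d0 d10 d20 e0 L0.
have nh : `|h| = h by rewrite gtr0_norm.
have /andP[psim psip] := H1 h h0 hd1.
rewrite psi0 in psim psip.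
have cpsi s : `|s - L| < d -> psi s @ F --> psi s alpha.
  move=> sd; apply: cvg_cross; apply: tangent_cvg_snd; first exact: sm.
  by apply: Hd => //; rewrite subrr normr0.
have np : \forall b \near F, 0 < psi (L + h) b.
  by apply: (cvgr_gt _ (cpsi _ _)) => //; rewrite (addrC L) addrK nh.
have nm : \forall b \near F, psi (L - h) b < 0.
  by apply: (cvgr_lt _ (cpsi _ _)) => //; rewrite (addrC L) addrK normrN nh.
have nd : \forall b \near F, `|b - alpha| < Num.min d d2.
  by apply/near_within_nbhsP; exists (Num.min d d2) => //; rewrite lt_min d0.
have nI : \forall b \near F, I b by apply/near_within_nbhsP; exists 1.
near=> b.
have Ib : I b by near: b.
have : `|b - alpha| < Num.min d d2 by near: b.
rewrite lt_min => /andP[bd bd2].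
have inh s : L - h <= s <= L + h -> `|s - L| <= h.
  by rewrite ler_distl.
apply: (@lt_trans _ _ (L + h)); last by rewrite ltrD2l.
apply: (len_lt_of_tangent_sign Ib h0 hL).
- by move=> s /inh sh; apply: Hd => //; exact: le_lt_trans hd.
- by near: b.
- by near: b.
- by move=> s /inh sh; apply: (H2 s b) => //; exact: le_lt_trans hd2.
Unshelve. all: by end_near. Qed.

Lemma param_junction b : I b -> param K i (len K i b) b = param K i 0 b.
Proof.
by move=> Ib; have [] := table_junction hr (def_table hK Ib) (deformation_smooth Ib) i.
Qed.

Lemma param_cvg D b s : I b -> 0 <= s <= len K i b ->
  cvg_coord (strip_nbhs D s b) (fun z => param K i z.1 z.2) (param K i s b).
Proof.
move=> Ib sL c; apply: (@continuous2_cvg _ D (fun s b => pt i c s b)) => e e0.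
have [d d0 Hd] := param_continuous2 c Ib sL e0.
by exists d => // s' b' sd bd _; exact: Hd.
Qed.

Lemma param_cvg_snd D b s : I b -> 0 <= s <= len K i b ->
  cvg_coord (within D (nbhs b)) (fun b' => param K i s b') (param K i s b).
Proof.
move=> Ib sL c.
exact: (@continuous2_cvg_snd _ (fun s b => pt i c s b) _ _ _ (param_continuous2 c Ib sL)).
Qed.

(* Near the start of the parametrization the curve moves along its initial
   tangent, hence cannot close up. *)
Lemma len_away_from0 : \forall z \near strip_nbhs I 0 alpha, z.1 <> len K i z.2.
Proof.
have half : ~ (0 <= 1 / 2 - 1 :> R) by lra.
have [d d0 Hd] := deformation_smooth_near Ia z0.
have T1 := dotvv_unit (bd_arclength tb z0).
set T0 := tangent K i 0 alpha in T1.
have phi0 : (fun z : R * R => dot T0 (tangent K i z.1 z.2)) @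
    strip_nbhs setT 0 alpha --> (1 : R).
  rewrite -T1; apply: cvg_dot; first exact: cvg_coord_cst.
  exact: tangent_cvg (sm z0).
have h2 : 0 < (1 / 2 : R) by rewrite divr_gt0.
have [d1 d10 H1] := (strip_nbhsP _ _ _ _).1 (cvgr_dist_le _ _ phi0 _ h2).
apply/strip_nbhsP; exists (Num.min d d1); first by rewrite lt_min d0.
move=> s b; rewrite !lt_min => /andP[sd sd1] /andP[bd bd1] Ib /= sL.
have Lb0 : 0 < s by rewrite sL; exact: (bd_len (def_table hK Ib)).
pose g s := T0 0 0 * pt i 0 s b + T0 0 1 * pt i 1 s b.
have gE : g s = g 0 by rewrite /g sL (param_junction Ib).
have z_min : `|(0 : R) - 0| < Num.min d d1 by rewrite subrr normr0 lt_min d0.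
have s_min : `|s - 0| < Num.min d d1 by rewrite lt_min sd.
have dg (x : R) : `|x - 0| < Num.min d d1 -> is_derive x 1 g (dot T0 (tangent K i x b)).
  rewrite lt_min => /andP[xd _]; have sx := Hd x b xd bd.
  exact: (approx_is_derive (approx_combination (T0 0 0) (T0 0 1)
    (is_derive_approx (smooth_ds sx 0)) (is_derive_approx (smooth_ds sx 1)))).
have dg1 (x : R) : `|x - 0| < Num.min d d1 -> `|dot T0 (tangent K i x b) - 1| <= 1 / 2.
  by rewrite lt_min => /andP[_ xd]; rewrite distrC; exact: (H1 x b xd bd1 Logic.I).
have := mean_value_bound dg dg1 z_min s_min.
rewrite gE subrr sub0r subr0 normrN mul1r gtr0_norm // -subr_ge0.
by rewrite -{2}[s]mul1r -mulrBl pmulr_lge0.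
Qed.

(** The boundary closes up at its period, so the point there is the point at [0]. Near any nonzero
    [x] up to [L - e] the two points stay apart, near [0] [len_away_from0] applies, and compactness
    of the segment excludes all these values of the period at once. *)
Lemma len_lsc e : 0 < e -> \forall b \near F, L - e < len K i b.
Proof.
move=> e0; have nI : \forall b \near F, I b by apply/near_within_nbhsP; exists 1.
suff H : \forall b \near F, `[0, L - e]%classic `<=` (fun s => s <> len K i b).
  near=> b; rewrite ltNge; apply/negP => Lb.
  have Ib : I b by near: b.
  have : `[0, L - e]%classic `<=` (fun s => s <> len K i b) by near: b.
  move=> /(_ (len K i b)) /=; rewrite in_itv /= Lb (ltW (bd_len (def_table hK Ib) i)).
  by move=> /(_ isT); apply.
have /compact_near_coveringP cov := @segment_compact R 0 (L - e).
apply: cov => x; rewrite /= in_itv /= => /andP[x0 xL].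
have [->|xn0] := eqVneq x 0; first exact: len_away_from0.
have xL' : x < L by rewrite (le_lt_trans xL) // gtrBl.
have x_in : 0 <= x <= L by rewrite x0 ltW.
have ne : param K i x alpha - param K i 0 alpha <> 0.
  move=> /subr0_eq E; move/eqP: xn0; apply.
  by apply: (bd_inj tb _ _ E); rewrite ?x0 ?lexx.
have cv : (fun z : R * R => enorm (param K i z.1 z.2 - param K i 0 z.2)) @
    strip_nbhs I x alpha --> enorm (param K i x alpha - param K i 0 alpha).
  apply: cvg_enorm; apply: cvg_coordB; first exact: param_cvg.
  exact: (@strip_cvg_snd I (fun b => param K i 0 b) _ x alpha (@param_cvg_snd I _ _ Ia z0)).
have [d d0 Hd] := (strip_nbhsP _ _ _ _).1 (cvgr_gt _ cv _ (enorm_gt0 ne)).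
apply/strip_nbhsP; exists d => // s b sd bd Ib /= sL.
have := Hd s b sd bd Ib; rewrite /= sL (param_junction Ib) subrr.
by rewrite enorm0 ltxx.
Unshelve. all: by end_near. Qed.

Lemma len_cvg : len K i @ F --> L.
Proof.
apply/cvgrPdist_lt => e e0.
have u := len_usc e0; have l := len_lsc e0; near=> b.
rewrite ltr_distlC; apply/andP; split; by near: b.
Unshelve. all: by end_near. Qed.

Definition len_slope (dL : R) :=
  negligible F (fun b => `|b - alpha|) (fun b => len K i b - L - dL * (b - alpha)).

Lemma near_param : \forall b \near F, I b.
Proof. by apply/near_within_nbhsP; exists 1. Qed.

(** The one-term sum gives the scale the shape that [negligible_absorb] takes for a single unknown,
    here the increment of the period. *)
Local Notation rho := (fun b => `|b - alpha| + \sum_(l < 1) `|len K i b - L|).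

Lemma rho_ge0 b : 0 <= rho b.
Proof. by rewrite /= big_ord1 addr_ge0. Qed.

Lemma rho_cvg : rho @ F --> (0 : R).
Proof.
have -> : rho = (fun b => `|b - alpha| + `|len K i b - L|).
  by apply/funext => b; rewrite big_ord1.
have H : (fun b => `|b - alpha| + `|len K i b - L|) @ F --> `|alpha - alpha| + `|L - L|.
  apply: cvgD; apply: cvg_norm; apply: cvgB; try exact: cvg_cst; last exact: len_cvg.
  exact: cvg_within.
by rewrite !subrr normr0 addr0 in H.
Qed.

(** The closing identity is expanded at both ends. Since the derivative in [s] is the same [A] at
    [0] and at [L], only the increment of the period and the difference of the derivatives in [b]
    survive. *)
Lemma junction_expansion (f : R -> R -> R) A B0 BL :
  (forall b, I b -> f (len K i b) b = f 0 b) ->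
  linear_approx2 setT f 0 alpha A B0 -> linear_approx2 setT f L alpha A BL ->
  negligible F rho (fun b => A * (len K i b - L) - (B0 - BL) * (b - alpha)).
Proof.
move=> fE f0 fL.
have e0 : expands F rho (fun b => f 0 b) (f 0 alpha)
    (fun b => A * (0 - 0) + B0 * (b - alpha)).
  apply: (expands_approx2 rho_ge0 rho_cvg f0); first exact: filterE.
  by move=> b /=; rewrite subrr normr0 add0r lerDl big_ord1.
have eL : expands F rho (fun b => f (len K i b) b) (f L alpha)
    (fun b => A * (len K i b - L) + BL * (b - alpha)).
  apply: (expands_approx2 rho_ge0 rho_cvg fL); first exact: filterE.
  by move=> b /=; rewrite addrC big_ord1.
rewrite -fE // in e0.
have E : \forall b \near F, f (len K i b) b = f 0 b.
  by apply: filterS near_param => b; exact: fE.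
apply: negligible_ext (expands_eq_near eL e0 E) => b.
by rewrite subrr mulr0 add0r; ring.
Qed.

(** The linearized closing condition is a vector equation for the increment of the period, with the
    unit tangent as coefficient. Its scalar product with that tangent solves it, up to an error that
    [negligible_absorb] removes. *)
Lemma len_derivable : exists dL, len_slope dL.
Proof.
have [d d0 Hd] := deformation_smooth_near Ia zL.
have [d' d'0 Hd'] := deformation_smooth_near Ia z0.
set T := tangent K i L alpha.
have T1 : T 0 0 * T 0 0 + T 0 1 * T 0 1 = 1.
  exact: (dotvv_unit (bd_arclength tb zL)).
have [_ TL _] := table_junction hr tb sm i.
pose B0 c := pderiv 0 1 (param K i) 0 alpha 0 c.
pose BL c := pderiv 0 1 (param K i) L alpha 0 c.
have J c : negligible F rho
    (fun b => T 0 c * (len K i b - L) - (B0 c - BL c) * (b - alpha)).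
  apply: (@junction_expansion (fun s b => pt i c s b)).
  - by move=> b Ib; rewrite (param_junction Ib).
  - by rewrite /T TL; exact: (smooth_approx2 d'0 Hd' c).
  - exact: (smooth_approx2 d0 Hd c).
exists (T 0 0 * (B0 0 - BL 0) + T 0 1 * (B0 1 - BL 1)).
apply: (@negligible_absorb _ _ _ _ 1 (fun=> fun b => len K i b - L)
  (fun=> T 0 0 * (B0 0 - BL 0) + T 0 1 * (B0 1 - BL 1))
  (fun b => b - alpha) _ ord0) => _.
have H := negligibleD (negligibleZ (T 0 0) (J 0))
  (negligibleZ (T 0 1) (J 1)).
apply: negligible_ext (H _ _ _) => b.
rewrite -[X in _ = X - _]mul1r -T1; ring.
Qed.

(** * First-order expansions across the moving junction *)

Section Glue.
Variable dL : R.
Hypothesis dLP : len_slope dL.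
Hypothesis accum : forall d, 0 < d -> exists b, [/\ I b, b != alpha & `|b - alpha| < d].

Lemma len_slope_bound : \forall b \near F,
  `|len K i b - L| <= (`|dL| + 1) * `|b - alpha|.
Proof.
apply: filterS (dLP ltr01) => b Hb.
rewrite -[X in `|X| <= _](subrK (dL * (b - alpha))) mulrDl addrC.
by apply: le_trans (ler_normD _ _) _; rewrite normrM lerD2l.
Qed.

(** Chain rule for the closing identity: the derivative in [b] jumps at the junction by exactly what
    the moving period contributes. Dividing the expansion by $|b-\alpha|$ along parameters
    accumulating at [alpha] extracts the relation. *)
Lemma junction_slope (f : R -> R -> R) A B0 BL :
  (forall b, I b -> f (len K i b) b = f 0 b) ->
  linear_approx2 setT f 0 alpha A B0 -> linear_approx2 setT f L alpha A BL ->
  B0 = BL + A * dL.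
Proof.
move=> fE f0 fL; have J := junction_expansion fE f0 fL.
apply/eqP; rewrite -subr_eq0 -normr_le0; apply/ler_addgt0Pr => e e0; rewrite add0r.
have M0 : 0 < `|dL| + 2 + `|A|.
  by have := normr_ge0 dL; have := normr_ge0 A; lra.
pose k := e / (`|dL| + 2 + `|A|).
have k0 : 0 < k by exact: divr_gt0.
have kE : k * (`|dL| + 2 + `|A|) = e by rewrite mulfVK // gt_eqF.
have [d d_gt0 Hd] := (near_within_nbhsP _ _ _).1
  (filterI (J k k0) (filterI len_slope_bound (dLP k0))).
have [b [Ib ba bd]] := accum d_gt0.
have [h1 [h2 h3]] := Hd b bd Ib.
have D0 : 0 < `|b - alpha| by rewrite normr_gt0 subr_eq0.
rewrite -(ler_pM2r D0) -normrM.
rewrite [X in `|X|](_ : _ = A * (len K i b - L - dL * (b - alpha))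
  - (A * (len K i b - L) - (B0 - BL) * (b - alpha))); last by ring.
apply: le_trans (ler_normB _ _) _; rewrite normrM.
rewrite /= big_ord1 in h1; set D := `|b - alpha| in h1 h2 h3 D0 *.
have h4 := ler_wpM2l (normr_ge0 A) h3.
have h5 : k * (D + `|len K i b - L|) <= k * (D + (`|dL| + 1) * D).
  by rewrite ler_wpM2l ?(ltW k0) // lerD2l.
rewrite -kE; lra.
Qed.

Lemma approx2_shift (f : R -> R -> R) s0 x A B (sigma : R) : `|sigma| <= 1 ->
  x = s0 + sigma * L -> linear_approx2 setT f x alpha A B ->
  linear_approx2 I (fun s b => f (s + sigma * len K i b) b) s0 alpha A
    (B + sigma * A * dL).
Proof.
move=> sg -> fx e e0.
have [ndL nA] := (normr_ge0 dL, normr_ge0 A).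
pose k := e / (`|dL| + 2 + `|A|).
have k0 : 0 < k by apply: divr_gt0 => //; lra.
have kE : k * (`|dL| + 2 + `|A|) = e by rewrite mulfVK // gt_eqF //; lra.
have [d d0 Hd] := fx k k0.
have [d1 d10 H1] := (near_within_nbhsP _ _ _).1 (filterI len_slope_bound (dLP k0)).
pose q := Num.min (Num.min d d1) (d / (2 * (`|dL| + 2))).
have q0 : 0 < q by rewrite !lt_min d0 d10 divr_gt0 //; lra.
exists q => // s b; rewrite /q !lt_min => /andP[/andP[sd sd1] sq] /andP[/andP[bd bd1] bq] Ib.
have [h2 h3] := H1 b bd1 Ib.
set D := `|b - alpha| in bd bd1 bq h2 h3 *.
set S := `|s - s0| in sd sd1 sq *.
have D0 : 0 <= D by exact: normr_ge0.
set X := s + sigma * len K i b - (s0 + sigma * L).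
have XE : X = (s - s0) + sigma * (len K i b - L) by rewrite /X; ring.
have Xb : `|X| <= S + (`|dL| + 1) * D.
  rewrite XE; apply: le_trans (ler_normD _ _) _; rewrite lerD2l normrM.
  apply: le_trans h2; rewrite -[leRHS]mul1r; exact: ler_wpM2r.
have Xd : `|X| < d.
  apply: le_lt_trans Xb _; move: sq bq; rewrite !ltr_pdivlMr; try lra.
  move=> sq bq; have : 0 <= `|dL| * S by rewrite mulr_ge0 // normr_ge0.
  by have := mulr_ge0 ndL D0; lra.
have := Hd _ b Xd bd Logic.I; rewrite -/X => h1.
rewrite [X in `|X| <= _](_ : _ = (f (s + sigma * len K i b) b - f (s0 + sigma * L) alpha
  - A * X - B * (b - alpha)) + sigma * A * (len K i b - L - dL * (b - alpha))); last first.
  by rewrite XE; ring.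
apply: le_trans (ler_normD _ _) _; rewrite -/D in h1; rewrite !normrM.
have h4 : `|sigma| * `|A| * `|len K i b - L - dL * (b - alpha)| <= `|A| * (k * D).
  by rewrite -mulrA -[leRHS]mul1r; apply: ler_pM; rewrite ?mulr_ge0 ?ler_wpM2l.
have h5 : k * (`|X| + D) <= k * (S + (`|dL| + 1) * D + D).
  by rewrite ler_wpM2l ?(ltW k0) // lerD2r.
apply: le_trans (lerD (le_trans h1 h5) h4) _; rewrite -kE.
have S0 : 0 <= k * S by rewrite mulr_ge0 ?(ltW k0) // normr_ge0.
have := mulr_ge0 S0 ndL; have := mulr_ge0 S0 nA.
by rewrite !mulrDr !mulrDl; lra.
Qed.

(** The two candidates need only share the value and the first-order part; which of them represents
    [g] may vary from point to point. *)
Lemma approx2_cases (D : set R) (f1 f2 g : R -> R -> R) s0 A B d : 0 < d ->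
  linear_approx2 D f1 s0 alpha A B -> linear_approx2 D f2 s0 alpha A B ->
  f1 s0 alpha = g s0 alpha -> f2 s0 alpha = g s0 alpha ->
  (forall s b, `|s - s0| < d -> `|b - alpha| < d -> D b ->
     g s b = f1 s b \/ g s b = f2 s b) ->
  linear_approx2 D g s0 alpha A B.
Proof.
move=> d0 H1 H2 E1 E2 Hg e e0; have [d1 d10 h1] := H1 e e0; have [d2 d20 h2] := H2 e e0.
exists (Num.min d (Num.min d1 d2)); first by rewrite !lt_min d0 d10.
move=> s b; rewrite !lt_min => /and3P[sd sd1 sd2] /and3P[bd bd1 bd2] Db.
by case: (Hg s b sd bd Db) => ->; [rewrite -E1; exact: h1 | rewrite -E2; exact: h2].
Qed.

Let pos_len b : I b -> forall j, 0 < len K j b.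
Proof. by move=> Ib; exact: (bd_len (def_table hK Ib)). Qed.

Lemma frac_param_small b s : I b -> 0 <= s < len K i b -> frac_param K b i s = s.
Proof. by move=> Ib; exact: (frac_param_id (pos_len Ib)). Qed.

Lemma frac_param_shift b s (k : int) : I b ->
  frac_param K b i (s + k%:~R * len K i b) = frac_param K b i s.
Proof. by move=> Ib; exact: (frac_param_period (pos_len Ib)). Qed.

(** Near the junction the reduced function is either [f] or [f] shifted by one moving period;
    [junction_slope] is what makes the two first-order parts agree. *)
Lemma approx2_periodic (f : R -> R -> R) (A B : R -> R) s0 :
  (forall b, I b -> f (len K i b) b = f 0 b) -> A L = A 0 ->
  (forall s, 0 <= s <= L -> linear_approx2 setT f s alpha (A s) (B s)) ->
  0 <= s0 <= L ->
  linear_approx2 I (fun s b => f (frac_param K b i s) b) s0 alpha (A s0) (B s0).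
Proof.
move=> fE AL fs s0L.
have f0 := fs 0 z0; have fL := fs L zL; rewrite AL in fL.
have slope := junction_slope fE f0 fL.
(* With the period above [3 / 4 * L] and [s] within [L / 4] of the junction, at most one shift leads
   back into the half-open period. *)
have L34 : 3 / 4 * L < L by move: L0; lra.
have [d1 d10 H1] := (near_within_nbhsP _ _ _).1
  (cvgr_gt _ len_cvg _ L34).
have d20 : 0 < Num.min d1 (L / 4) by rewrite lt_min d10 divr_gt0.
have fr0 : frac_param K alpha i 0 = 0 by apply: frac_param_small; rewrite ?lexx.
have [s0E|s00] := eqVneq s0 0.
  rewrite s0E; apply: (@approx2_cases _ f (fun s b => f (s + 1 * len K i b) b) _ _ _ _
    (Num.min d1 (L / 4)) d20).
  - exact: linear_approx2_sub f0.
  - rewrite slope -[A 0 * dL]mul1r mulrA.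
    by apply: (approx2_shift (x := L)); rewrite ?normr1 // mul1r add0r.
  - by rewrite fr0.
  - by rewrite fr0 mul1r add0r fE.
  move=> s b; rewrite subr0 !lt_min => /andP[_ sL] /andP[bd _] Ib.
  have Lb := H1 b bd Ib; move: sL; rewrite ltr_norml => /andP[s1 s2].
  have [s_ge0|s_lt0] := leP 0 s; [left | right]; congr (f _ b).
    by apply: frac_param_small => //; apply/andP; split; move: L0; lra.
  rewrite -(frac_param_shift s 1 Ib) frac_param_small //.
  by rewrite mul1r; apply/andP; split; move: L0; lra.
have frL : frac_param K alpha i L = 0.
  by rewrite -fr0 -(frac_param_shift 0 1 Ia) mul1r add0r.
have [s0E|s0nL] := eqVneq s0 L.
  rewrite s0E AL; apply: (@approx2_cases _ f (fun s b => f (s + (-1) * len K i b) b) _ _ _ _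
    (Num.min d1 (L / 4)) d20).
  - exact: linear_approx2_sub fL.
  - rewrite (_ : B L = B 0 + (-1) * A 0 * dL); last by rewrite slope; ring.
    by apply: (approx2_shift (x := 0)); rewrite ?normrN ?normr1 // mulN1r subrr.
  - by rewrite frL fE.
  - by rewrite frL mulN1r subrr.
  move=> s b; rewrite !lt_min => /andP[_ sL] /andP[bd _] Ib.
  have Lb := H1 b bd Ib; move: sL; rewrite ltr_norml => /andP[s1 s2].
  have [s_ltL|s_geL] := ltP s (len K i b); [left | right]; congr (f _ b).
    by apply: frac_param_small => //; apply/andP; split; move: L0; lra.
  rewrite -(frac_param_shift s (-1) Ib) frac_param_small ?mulrN1z //.
  by rewrite mulN1r; apply/andP; split; move: L0; lra.
have /andP[s0_ge0 s0_leL] := s0L.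
have s0_gt0 : 0 < s0 by rewrite lt_def s00.
have s0_ltL : s0 < L by rewrite lt_neqAle s0nL.
have [d3 d30 H3] := (near_within_nbhsP _ _ _).1
  (cvgr_gt _ len_cvg ((s0 + L) / 2) ltac:(lra)).
have [|h h0 /= /and3P[h1 h2 /andP[h3 _]]] :=
  @pos_lower_bound R [:: d3; s0; (L - s0) / 2].
  by rewrite /= d30 s0_gt0 divr_gt0 // subr_gt0.
have frs : frac_param K alpha i s0 = s0 by apply: frac_param_small; rewrite ?s0_ge0.
apply: (@approx2_cases _ f f _ _ _ _ h) => //; try exact: linear_approx2_sub (fs s0 s0L).
- by rewrite frs.
- by rewrite frs.
move=> s b sd bd Ib; left; congr (f _ b); apply: frac_param_small => //.
have Lb := H3 b (lt_trans bd h1) Ib; move: sd; rewrite ltr_norml => /andP[k1 k2].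
by apply/andP; split; lra.
Qed.

End Glue.

End LengthAt.

End Deformation.

(** * Continuous branches of minimizers *)

Section PeriodicParametrization.
Variables (R : realType) (m r r' : nat) (K : obstacles R m) (I : set R).
Variable C : nat -> nat -> R -> R.
Hypotheses (hr : (2 <= r)%N) (hr' : (1 <= r')%N).
Hypothesis hK : is_billiard_deformation K r r' I C.
Hypothesis accum : forall alpha, I alpha -> forall d, 0 < d ->
  exists b, [/\ I b, b != alpha & `|b - alpha| < d].
Implicit Types (i : 'I_m) (c : 'I_2) (s b alpha e : R).

Let len_gt0 b : I b -> forall i, 0 < len K i b.
Proof. by move=> Ib; exact: (bd_len (def_table hK Ib)). Qed.

Lemma eparam_approx2 alpha i s c : I alpha -> 0 <= s <= len K i alpha ->
  linear_approx2 I (fun s b => eparam K i s b 0 c) s alpha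
    (tangent K i s alpha 0 c) (pderiv 0 1 (param K i) s alpha 0 c).
Proof.
move=> Ia sL; have [dL dLP] := len_derivable hr hr' hK i Ia.
pose f s b := param K i s b 0 c; pose A s := tangent K i s alpha 0 c.
pose B s := pderiv 0 1 (param K i) s alpha 0 c.
have fE b : I b -> f (len K i b) b = f 0 b.
  by move=> Ib; rewrite /f (param_junction hr hr' hK i Ib).
have AE : A (len K i alpha) = A 0.
  rewrite /A.
  by have [_ -> _] := table_junction hr (def_table hK Ia) (deformation_smooth hr hr' hK Ia) i.
have fA s' : 0 <= s' <= len K i alpha -> linear_approx2 setT f s' alpha (A s') (B s').
  move=> s'L; have [d d0 Hd] := deformation_smooth_near hr hr' hK Ia s'L.
  exact: (smooth_approx2 d0 Hd c).
exact: (approx2_periodic hr hr' hK Ia dLP (accum Ia) fE AE fA sL).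
Qed.

Definition etangent i s b := tangent K i (frac_param K b i s) b.

Lemma etangent_approx2 alpha i s c : I alpha -> 0 <= s <= len K i alpha ->
  linear_approx2 I (fun s b => etangent i s b 0 c) s alpha
    (pderiv 2 0 (param K i) s alpha 0 c) (pderiv 1 1 (param K i) s alpha 0 c).
Proof.
move=> Ia sL; have [dL dLP] := len_derivable hr hr' hK i Ia.
pose f s b := tangent K i s b 0 c; pose A s := pderiv 2 0 (param K i) s alpha 0 c.
pose B s := pderiv 1 1 (param K i) s alpha 0 c.
have fE b : I b -> f (len K i b) b = f 0 b.
  rewrite /f => Ib.
  by have [_ -> _] := table_junction hr (def_table hK Ib) (deformation_smooth hr hr' hK Ib) i.
have AE : A (len K i alpha) = A 0.
  rewrite /A.
  by have [_ _ ->] := table_junction hr (def_table hK Ia) (deformation_smooth hr hr' hK Ia) i.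
have fA s' : 0 <= s' <= len K i alpha -> linear_approx2 setT f s' alpha (A s') (B s').
  move=> s'L; have [d d0 Hd] := deformation_smooth_near hr hr' hK Ia s'L.
  exact: (smooth_tangent_approx2 d0 Hd c).
exact: (approx2_periodic hr hr' hK Ia dLP (accum Ia) fE AE fA sL).
Qed.

(** The number [k] of periods to remove is fixed at [(s, alpha)]. Removing [k] periods of varying
    length is continuous and leads to a parameter in the range of [eparam_approx2]. *)
Lemma eparam_cvg alpha i s : I alpha ->
  cvg_coord (strip_nbhs I s alpha) (fun z => eparam K i z.1 z.2) (eparam K i s alpha).
Proof.
move=> Ia c; pose k := Num.floor (s / len K i alpha).
pose s' := frac_param K alpha i s.
have s'L : 0 <= s' <= len K i alpha.
  by have /andP[-> /ltW ->] := frac_param_itv (len_gt0 Ia) i s.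
have sh b t : I b -> eparam K i (t - k%:~R * len K i b) b = eparam K i t b.
  by move=> Ib; rewrite -mulNr -intrN; exact: (eparam_shift (len_gt0 Ib)).
have cs' := continuous2_cvg (linear_approx2_continuous (eparam_approx2 c Ia s'L)).
have cL : (fun z : R * R => len K i z.2) @ strip_nbhs I s alpha --> len K i alpha.
  rewrite /strip_nbhs.
  apply: (@cvg_comp _ _ _ snd (len K i) _ _ _ _ (len_cvg hr hr' hK Ia)).
  exact: cvg_snd.
have cst : (fun z : R * R => z.1 - k%:~R * len K i z.2) @ strip_nbhs I s alpha --> s'.
  apply: cvgB; first exact: cvg_fst.
  by apply: cvgM; [exact: cvg_cst | exact: cL].
have csnd : (fun z : R * R => z.2) @ strip_nbhs I s alpha --> within I (nbhs alpha).
  exact: cvg_snd.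
have H := cvg_comp _ _ (cvg_pair cst csnd) cs'.
rewrite [X in _ --> X](_ : _ = eparam K i s' alpha 0 c); last by rewrite /s' /frac_param sh.
have E : {near strip_nbhs I s alpha,
    (fun z : R * R => eparam K i (z.1 - k%:~R * len K i z.2) z.2 0 c) =1
    (fun z => eparam K i z.1 z.2 0 c)}.
  by apply/strip_nbhsP; exists 1 => // s1 b1 _ _ Ib1 /=; rewrite sh.
exact: (cvg_trans (near_eq_cvg E) (H _ _ _)).
Qed.

Section Minimizers.
Variables (n : nat) (xi : 'I_n -> 'I_m).
Hypothesis hxi : is_itinerary xi.
Implicit Types (w : 'rV[R]_n) (j : 'I_n).

Lemma length_fun_cvg alpha w : I alpha ->
  (fun z : 'rV[R]_n * R => length_fun K xi z.1 z.2)
    @ filter_prod (nbhs w) (within I (nbhs alpha)) --> length_fun K xi w alpha.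
Proof.
move=> Ia; have FF : Filter (filter_prod (nbhs w) (within I (nbhs alpha))).
  exact: filter_prod_filter.
have ref j : cvg_coord (filter_prod (nbhs w) (within I (nbhs alpha)))
    (fun z => refl_point K xi z.1 z.2 j) (refl_point K xi w alpha j).
  move=> c; have H1 : (fun z : 'rV[R]_n * R => z.1 0 j) @
      filter_prod (nbhs w) (within I (nbhs alpha)) --> w 0 j.
    apply: (@cvg_comp _ _ _ fst (fun M : 'rV[R]_n => M 0 j) _ _ _ _
      (@coord_continuous R 1 n 0 j w)).
    exact: cvg_fst.
  have H2 : (fun z : 'rV[R]_n * R => z.2) @
      filter_prod (nbhs w) (within I (nbhs alpha)) --> within I (nbhs alpha).
    exact: cvg_snd.
  have H := cvg_comp _ _ (cvg_pair H1 H2) (@eparam_cvg alpha (xi j) (w 0 j) Ia c).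
  exact: (H _ _ _).
rewrite /length_fun; apply: cvg_big; first exact: add_continuous.
by move=> j _; apply: cvg_enorm; apply: cvg_coordB.
Qed.

Lemma minimizer_unique alpha w w' : I alpha ->
  is_length_minimizer K xi w alpha -> is_length_minimizer K xi w' alpha ->
  forall j, refl_point K xi w alpha j = refl_point K xi w' alpha j.
Proof.
move=> Ia wm w'm; have tb := def_table hK Ia.
have sm := deformation_smooth hr hr' hK Ia.
exact: (body_minimizer_unique tb hxi
  (length_minimizer_bodies hr tb sm hxi wm) (length_minimizer_bodies hr tb sm hxi w'm)).
Qed.

Lemma length_fun_ext alpha w w' :
  (forall j, eparam K (xi j) (w 0 j) alpha = eparam K (xi j) (w' 0 j) alpha) ->
  length_fun K xi w alpha = length_fun K xi w' alpha.
Proof. by move=> E; apply: eq_bigr => j _; rewrite /refl_point !E. Qed.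

Lemma eparam_inj_window alpha i s s' : I alpha ->
  eparam K i s alpha = eparam K i s' alpha -> `|s - s'| < len K i alpha -> s = s'.
Proof.
move=> Ia E sd; have L0 := len_gt0 Ia.
have F := bd_inj (def_table hK Ia) (frac_param_itv L0 i s) (frac_param_itv L0 i s') E.
pose k := Num.floor (s / len K i alpha); pose k' := Num.floor (s' / len K i alpha).
have D : s - s' = (k - k')%:~R * len K i alpha.
  have e1 : s = frac_param K alpha i s + k%:~R * len K i alpha by rewrite /frac_param subrK.
  have e2 : s' = frac_param K alpha i s' + k'%:~R * len K i alpha by rewrite /frac_param subrK.
  by rewrite {1}e1 {1}e2 F intrB; ring.
move: sd; rewrite D normrM (gtr0_norm (L0 i)) gtr_pMl // -intr_norm ltrz1 => k0.
move: k0; rewrite -[ltRHS]add0r ltzD1 normr_le0 => /eqP.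
by move=> kk; apply/subr0_eq; rewrite D kk mul0r.
Qed.

Section Branch.
Variable u : R -> 'rV[R]_n.
Hypothesis hu : forall b, I b -> is_length_minimizer K xi (u b) b.
Variable alpha : R.
Hypothesis Ia : I alpha.
Local Notation s0 j := (u alpha 0 j).
Local Notation L j b := (len K (xi j) b).

Definition window b w := forall j, `|w 0 j - s0 j| <= L j b / 2.

(** The given minimizers may jump by whole periods as [b] varies; this takes the representative in a
    window of one period centred at [u alpha]. *)
Definition branch b : 'rV[R]_n := \row_j
  (s0 j - L j b / 2 + frac_param K b (xi j) (u b 0 j - s0 j + L j b / 2)).

Lemma branch_itv b j : I b -> - (L j b / 2) <= branch b 0 j - s0 j < L j b / 2.
Proof.
move=> Ib; have := frac_param_itv (len_gt0 Ib) (xi j) (u b 0 j - s0 j + L j b / 2).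
rewrite mxE; set x := frac_param _ _ _ _; move=> /andP[x0 xL].
by apply/andP; split; lra.
Qed.

Lemma branch_window b : I b -> window b (branch b).
Proof.
by move=> Ib j; have /andP[h1 /ltW h2] := branch_itv j Ib; rewrite ler_norml h1.
Qed.

Lemma branch_eparam b j : I b ->
  eparam K (xi j) (branch b 0 j) b = eparam K (xi j) (u b 0 j) b.
Proof.
move=> Ib; rewrite mxE /frac_param; set k := Num.floor _.
rewrite -[RHS](eparam_shift (len_gt0 Ib) (xi j) _ (- k)) intrN; congr (eparam K _ _ b); ring.
Qed.

Lemma branch_minimizer b : I b -> is_length_minimizer K xi (branch b) b.
Proof.
move=> Ib w'; apply: le_trans (hu Ib w'); rewrite le_eqVlt; apply/orP; left; apply/eqP.
by apply: length_fun_ext => j; exact: branch_eparam.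
Qed.

Lemma branch_start : branch alpha = u alpha.
Proof.
apply/rowP => j; rewrite mxE subrr add0r (frac_param_small hK Ia) ?subrK //.
have := len_gt0 Ia (xi j) => h; apply/andP; split; lra.
Qed.

Lemma len_coord_cvg b w j : I b ->
  (fun z : 'rV[R]_n * R => L j z.2) @ filter_prod (nbhs w) (within I (nbhs b)) --> L j b.
Proof.
move=> Ib; apply: (@cvg_comp _ _ _ snd (len K (xi j)) _ _ _ _ (len_cvg hr hr' hK Ib)).
exact: cvg_snd.
Qed.

Lemma coord_cvg b w j :
  (fun z : 'rV[R]_n * R => z.1 0 j) @ filter_prod (nbhs w) (within I (nbhs b)) --> w 0 j.
Proof.
apply: (@cvg_comp _ _ _ fst (fun M : 'rV[R]_n => M 0 j) _ _ _ _ (@coord_continuous R 1 n 0 j w)).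
exact: cvg_fst.
Qed.

(* A minimizer in the closed window is unique as soon as one lies in its interior;
   away from it, non-minimality persists nearby, and the window is compact. *)
Lemma branch_cvg b : I b -> (forall j, `|branch b 0 j - s0 j| < L j b / 2) ->
  branch @ within I (nbhs b) --> branch b.
Proof.
move=> Ib inner W; rewrite nbhsE => -[W' [oW' W'b] W'W].
have FF w : Filter (filter_prod (nbhs w) (within I (nbhs b))).
  exact: filter_prod_filter.
(* The half-width is a full period at [b], so the box contains the half-period windows of all nearby
   parameters. *)
pose A := [set w : 'rV[R]_n | forall j, `[s0 j - L j b, s0 j + L j b]%classic (w 0 j)].
have cA : compact A by apply: (@rV_compact R n (fun j => `[s0 j - L j b, s0 j + L j b]%classic)) => j; exact: segment_compact.
have cov : \forall b' \near within I (nbhs b), A `<=`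
    (fun w => is_length_minimizer K xi w b' -> window b' w -> W' w).
  move/compact_near_coveringP: cA; apply => w _.
  have [Ww|nWw] := pselect (W' w).
    apply: filterS (_ : filter_prod (nbhs w) (within I (nbhs b)) (fun z => W' z.1)).
      by move=> z.
    exists (W', setT) => /=; last by move=> z [].
    by split; [exact: open_nbhs_nbhs | exact: filterT].
  have [win|nwin] := pselect (window b w); last first.
    have /existsNP [j /negP] := nwin; rewrite -ltNge => jw.
    have H : (fun z : 'rV[R]_n * R => `|z.1 0 j - s0 j| - L j z.2 / 2) @
        filter_prod (nbhs w) (within I (nbhs b)) --> `|w 0 j - s0 j| - L j b / 2.
      apply: cvgB; last by apply: cvgM; [exact: len_coord_cvg | exact: cvg_cst].
      by apply: cvg_norm; apply: cvgB; [exact: coord_cvg | exact: cvg_cst].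
    have := cvgr_gt _ H 0; rewrite subr_gt0 => /(_ (FF w) jw).
    apply: filterS => z /= z0 _ /(_ j); rewrite leNgt -subr_gt0 z0.
    by [].
  have : ~ is_length_minimizer K xi w b.
    move=> wm; apply: nWw; suff -> : w = branch b by [].
    apply/rowP => j; apply: (eparam_inj_window Ib (i := xi j)).
      exact: (minimizer_unique Ib wm (branch_minimizer Ib) j).
    apply: le_lt_trans (ler_distD (s0 j) _ _) _; rewrite (distrC (s0 j)).
    by have := inner j; have := win j; lra.
  move=> /existsNP [w1 /negP]; rewrite -ltNge -subr_gt0 => w1w.
  have H : (fun z : 'rV[R]_n * R => length_fun K xi z.1 z.2 - length_fun K xi w1 z.2) @
      filter_prod (nbhs w) (within I (nbhs b)) -->
      length_fun K xi w b - length_fun K xi w1 b.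
    apply: cvgB; first exact: length_fun_cvg.
    have H1 : (fun _ : 'rV[R]_n * R => w1) @
        filter_prod (nbhs w) (within I (nbhs b)) --> w1 by exact: cvg_cst.
    have H2 : (fun z : 'rV[R]_n * R => z.2) @
        filter_prod (nbhs w) (within I (nbhs b)) --> within I (nbhs b) by exact: cvg_snd.
    have H3 := cvg_comp _ _ (cvg_pair H1 H2) (@length_fun_cvg b w1 Ib).
    exact: (H3 _ _ _).
  have := @cvgr_gt _ _ _ (FF w) _ _ H 0 w1w; apply: (@filterS _ _ (FF w)) => z /= z0 zm.
  by have := zm w1; rewrite leNgt -subr_gt0 z0.
have nL : \forall b' \near within I (nbhs b), forall j, L j b' < 2 * L j b.
  apply: filter_forall => j; apply: (cvgr_lt _ (len_cvg hr hr' hK Ib)).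
  by have := len_gt0 Ib (xi j); lra.
have nI : \forall b' \near within I (nbhs b), I b'.
  by apply/near_within_nbhsP; exists 1.
apply: filterS3 cov nL nI => b' covb' Lb' Ib'; apply: W'W; apply: covb'.
- move=> j; rewrite /= in_itv /=; have := branch_itv j Ib'; have := Lb' j.
  by move=> h /andP[h1 h2]; apply/andP; split; lra.
- exact: branch_minimizer.
- exact: branch_window.
Qed.

(** At [alpha] every coordinate is the centre of its window. Continuity there keeps nearby values
    inside the open windows, and [branch_cvg] then applies at each nearby parameter. *)
Lemma local_branch_exists : is_local_branch K xi I alpha (u alpha) branch.
Proof.
split; first exact: branch_start.
have inner : forall j, `|branch alpha 0 j - s0 j| < L j alpha / 2.
  by move=> j; rewrite branch_start subrr normr0 divr_gt0 // len_gt0.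
have cb := branch_cvg Ia inner; rewrite branch_start in cb.
have near_inner : \forall b \near within I (nbhs alpha),
    forall j, `|branch b 0 j - s0 j| < L j b / 2.
  apply: filter_forall => j.
  have H : (fun b => L j b / 2 - `|branch b 0 j - s0 j|) @ within I (nbhs alpha) -->
      L j alpha / 2 - `|s0 j - s0 j|.
    apply: cvgB.
      by apply: cvgM; [exact: (len_cvg hr hr' hK Ia) | exact: cvg_cst].
    apply: cvg_norm; apply: cvgB; last exact: cvg_cst.
    exact: (@cvg_comp _ _ _ branch (fun M : 'rV[R]_n => M 0 j) _ _ _ cb (@coord_continuous R 1 n 0 j _)).
  have := cvgr_gt _ H 0; rewrite subrr normr0 subr0 divr_gt0 ?len_gt0 // => /(_ _ isT).
  by apply: filterS => b; rewrite subr_gt0.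
have nI : \forall b \near within I (nbhs alpha), I b.
  by apply/near_within_nbhsP; exists 1.
apply: filterS2 near_inner nI => b nb Ib; split; first exact: branch_minimizer.
exact: branch_cvg.
Qed.

End Branch.
End Minimizers.
End PeriodicParametrization.

(** * The periodic orbit in the billiard dynamics *)

Section NonTangency.
Variables (R : realType) (m : nat) (K : obstacles R m) (r : nat) (alpha : R).
Hypothesis r2 : (2 <= r)%N.
Hypothesis tb : is_billiard_table K r alpha.
Hypothesis sm : forall i s, 0 <= s <= len K i alpha -> smooth_at (param K i) s alpha.
Implicit Types x y z : state R m.

Lemma state_body x : is_state K alpha x -> body K (obs x) alpha (pos K alpha x).
Proof.
move=> [/andP[p0 pL] _ _].
by apply: (param_body r2 tb sm); rewrite p0 ltW.
Qed.

Lemma nrm_unit x : is_state K alpha x -> enorm (nrm K alpha x) = 1.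
Proof.
move=> [/andP[p0 pL] _ _]; apply: clockwise_turn_unit.
by apply: (bd_arclength tb); rewrite p0 ltW.
Qed.

Lemma next_reflection_obs x y : is_state K alpha x -> is_state K alpha y ->
  next_reflection K alpha x y -> obs x <> obs y.
Proof.
move=> sx sy [t [t0 py free _]] E; have Ax := state_body sx; have Ay := state_body sy.
have [_ v1 _] := sx.
have h2 : 0 < t / 2 < t by apply/andP; split; lra.
apply: (free (t / 2) h2); exists (obs x) => //.
rewrite (_ : _ + _ = (1 / 2) *: pos K alpha x + (1 - 1 / 2) *: pos K alpha y).
  by apply: (body_convex tb) => //; [rewrite E | apply/andP; split; lra].
by rewrite py; apply: plane_eq; rewrite !mxE; field.
Qed.

(* A grazing reflection would put three consecutive reflection points on a line,
   which the no-eclipse condition forbids. *)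
Lemma M0_not_tangent x : M0 K alpha x -> 0 < dot (vel x) (nrm K alpha x).
Proof.
move=> [z [z0 Hz]]; have [sx _] := Hz 0; rewrite z0 in sx.
have [sp np] := Hz (-1); have [sn _] := Hz 1; have [_ nn] := Hz 0.
rewrite addNr z0 in np; rewrite add0r z0 in nn.
have [_ _ dx0] := sx; rewrite lt_def dx0 andbT; apply/eqP => d0.
have neq1 := next_reflection_obs sp sx np; have neq2 := next_reflection_obs sx sn nn.
have [t [t0 px _ vx]] := np; have [t' [t0' pn _ _]] := nn.
have n1 := dotvv_unit (nrm_unit sx).
have vv : vel x = vel (z (-1)).
  have := congr1 (fun v => dot v (nrm K alpha x)) vx; rewrite d0 dotBl dotZl n1 => H.
  have vn0 : dot (vel (z (-1))) (nrm K alpha x) = 0 by lra.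
  by rewrite vx vn0 mulr0 scale0r subr0.
have tt0 : t + t' != 0 by rewrite gt_eqF // addr_gt0.
apply: (no_straight tb neq1 neq2 (state_body sp) (state_body sx) (state_body sn)
  (t := t' / (t + t'))).
  by rewrite divr_ge0 ?ler_pdivrMr ?mul1r /=; lra.
by rewrite pn px vv; apply: plane_eq; rewrite !mxE; field.
Qed.

End NonTangency.

(** * The minimizer as a billiard trajectory in [M0] *)

Section PeriodicOrbit.
Variables (R : realType) (m : nat) (K : obstacles R m) (r : nat) (alpha : R).
Hypothesis r2 : (2 <= r)%N.
Hypothesis tb : is_billiard_table K r alpha.
Hypothesis sm : forall i s, 0 <= s <= len K i alpha -> smooth_at (param K i) s alpha.
Variables (n : nat) (xi : 'I_n -> 'I_m).
Hypothesis hxi : is_itinerary xi.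
Variable w : 'rV[R]_n.
Hypothesis wmin : is_length_minimizer K xi w alpha.
Implicit Types j : 'I_n.

Local Notation p := (refl_point K xi w alpha).
Let L0 i : 0 < len K i alpha := bd_len tb i.

Definition orbit_state j : state R m :=
  State (xi j) (frac_param K alpha (xi j) (w 0 j)) (fdir p j).

Let Ap j : body K (xi j) alpha (p j). Proof. exact: (eparam_body tb). Qed.
Let T1 j := minimizer_tangent_unit tb xi w j.

Lemma orbit_state_nrm j : nrm K alpha (orbit_state j) =
  clockwise_turn (tangent K (xi j) (frac_param K alpha (xi j) (w 0 j)) alpha).
Proof. by []. Qed.

Lemma orbit_is_state j : is_state K alpha (orbit_state j).
Proof.
split; first exact: (frac_param_itv L0).
  exact: (fdir_unit tb hxi).
by have [/ltW] := minimizer_reflection r2 tb sm hxi wmin j.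
Qed.

Lemma flight_gt0 j : 0 < enorm (p (ordS j) - p j).
Proof. by apply/enorm_gt0; exact: (config_neqS tb hxi). Qed.

Lemma flightE j : p (ordS j) - p j = enorm (p (ordS j) - p j) *: fdir p j.
Proof. by rewrite /fdir scalerA mulfV ?scale1r // gt_eqF // flight_gt0. Qed.

(** The open flight lies strictly outside the tangent half-planes that contain the bodies at its two
    ends; any other obstacle would be met on a segment between two bodies, which the no-eclipse
    condition forbids. *)
Lemma orbit_free_flight j (s : R) : 0 < s < enorm (p (ordS j) - p j) ->
  ~ (\bigcup_i body K i alpha) (p j + s *: fdir p j).
Proof.
have comb (x v : 'rV[R]_2) (a b : R) : b != 0 ->
    x + a *: v = (1 - a / b) *: x + (1 - (1 - a / b)) *: (x + b *: v).
  by move=> b0; apply: plane_eq; rewrite !mxE; field.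
set t := enorm _ => /andP[s0 st] [i _ Ai].
have [c0 _] := minimizer_reflection r2 tb sm hxi wmin j.
have [c0' cS] := minimizer_reflection r2 tb sm hxi wmin (ordS j).
rewrite ordSK in cS; have pS : p (ordS j) = p j + t *: fdir p j.
  by rewrite -flightE addrC subrK.
have fr k : 0 <= frac_param K alpha (xi k) (w 0 k) <= len K (xi k) alpha.
  by have /andP[-> /ltW ->] := frac_param_itv L0 (xi k) (w 0 k).
have [ij|/eqP ij] := eqVneq i (xi j).
  rewrite ij in Ai; have := bd_ccw tb (fr j) Ai.
  rewrite -[cross _ _]opprK -dot_clockwise_turn -eparamE addrAC subrr add0r dotZr.
  by rewrite oppr_ge0 pmulr_rle0 // dotC leNgt c0.
have [iS|/eqP iS] := eqVneq i (xi (ordS j)).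
  rewrite iS in Ai; have := bd_ccw tb (fr (ordS j)) Ai.
  rewrite -[cross _ _]opprK -dot_clockwise_turn -eparamE.
  rewrite -[eparam _ _ _ _]/(p (ordS j)) pS.
  rewrite (_ : _ - _ = - (t - s) *: fdir p j); last first.
    by apply: plane_eq; rewrite !mxE; ring.
  rewrite dotZr oppr_ge0 mulNr oppr_le0 pmulr_rge0 ?subr_gt0 //.
  by rewrite dotC cS oppr_ge0 leNgt c0'.
have t0 := flight_gt0 j; rewrite -/t in t0.
apply: (no_straight tb (nesym ij) iS (Ap j) Ai (Ap (ordS j)) (t := 1 - s / t)).
  have h1 : s / t <= 1 by rewrite ler_pdivrMr // mul1r ltW.
  have h2 : 0 <= s / t by rewrite divr_ge0 // ltW.
  by rewrite subr_ge0 h1 lerBlDr lerDl.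
by rewrite pS; apply: comb; rewrite gt_eqF.
Qed.

Lemma orbit_next j : next_reflection K alpha (orbit_state j) (orbit_state (ordS j)).
Proof.
exists (enorm (p (ordS j) - p j)); split.
- exact: flight_gt0.
- have : p (ordS j) = p j + enorm (p (ordS j) - p j) *: fdir p j.
    by rewrite -flightE addrC subrK.
  exact.
- by move=> s /orbit_free_flight.
have [_ cS] := minimizer_reflection r2 tb sm hxi wmin (ordS j).
have st := minimizer_stationary r2 tb sm hxi wmin (ordS j).
rewrite ordSK in cS st; rewrite orbit_state_nrm /=.
have T1S := T1 (ordS j); set T := tangent _ _ _ _ in cS st T1S *.
have N1 := dotvv_unit (clockwise_turn_unit T1S).
apply: (frame_eq T1S).
  rewrite dotBl dotZl (dot_clockwise_turn T T) /cross (mulrC (T 0 1)) subrr oppr0 mulr0 subr0.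
  by rewrite !(dotC _ T); apply/esym/subr0_eq; rewrite -dotBr.
by rewrite dotBl dotZl N1 cS; ring.
Qed.

Lemma orbit_state_M0 j : M0 K alpha (orbit_state j).
Proof.
(* [Negz a] stands for $-(a+1)$, hence the extra predecessor. *)
pose o (k : int) := match k with Posz a => iter a (@ordS n) j
  | Negz a => iter a.+1 (@ord_pred n) j end.
have oS k : o (k + 1) = ordS (o k).
  case: k => [a|[|a]].
  - by rewrite -PoszD addn1.
  - by rewrite /= ord_predK.
  have -> : Negz a.+1 + 1 = Negz a by rewrite !NegzE -[a.+2]addn1 PoszD opprD subrK.
  by rewrite /= ord_predK.
exists (fun k => orbit_state (o k)); split=> // k; split; first exact: orbit_is_state.
by rewrite oS; exact: orbit_next.
Qed.

Lemma flight_distance_mem j :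
  flight_distances K alpha (enorm (p (ordS j) - p j)).
Proof.
exists (orbit_state j), (orbit_state (ordS j)); split => //.
- exact: orbit_state_M0.
- exact: orbit_is_state.
- exact: orbit_next.
Qed.

End PeriodicOrbit.

(** * The cyclic linear system *)

Section CyclicSystem.
Variables (R : realType) (n : nat) (kap c d : 'I_n -> R).
Hypotheses (c0 : forall j, 0 < c j) (c1 : forall j, c j <= 1) (d0 : forall j, 0 < d j).
Implicit Types (x : 'I_n -> R) (j : 'I_n).

Definition cyclic_op x j : R := 2 * kap j * x j
  + (c j * x j + c (ord_pred j) * x (ord_pred j)) / d (ord_pred j)
  + (c (ordS j) * x (ordS j) + c j * x j) / d j.

Lemma cyclic_op_lin x y (t : R) j :
  cyclic_op (fun i => x i - y i * t) j = cyclic_op x j - cyclic_op y j * t.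
Proof. by rewrite /cyclic_op; ring. Qed.

(* At an index maximizing [c j * |x j|] the neighbours cannot compensate. *)
Lemma cyclic_op_bound k M x : 0 < k -> (forall j, k <= kap j) ->
  (forall j, `|cyclic_op x j| <= M) -> forall j, c j * `|x j| <= M / (2 * k).
Proof.
move=> k0 kk HM j.
have [i _ Hi] := @arg_maxP _ _ 'I_n j predT (fun i => c i * `|x i|) isT.
have {}Hi l : c l * `|x l| <= c i * `|x i| by exact: (Hi l isT).
apply: le_trans (Hi j) _.
have cx l : `|c l * x l| = c l * `|x l| by rewrite normrM gtr0_norm.
suff H : k * 2 * `|x i| <= M.
  rewrite ler_pdivlMr; last by rewrite mulr_gt0.
  apply: le_trans H; rewrite mulrC (mulrC k) ler_wpM2l //.
    by rewrite mulr_ge0 // ltW.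
  by rewrite -[leRHS]mul1r ler_wpM2r.
set p := ord_pred i; set s := ordS i.
have ip : 0 < (d p)^-1 by rewrite invr_gt0.
have iq : 0 < (d i)^-1 by rewrite invr_gt0.
have E : (2 * kap i + c i / d p + c i / d i) * x i =
   cyclic_op x i - (c p * x p) / d p - (c s * x s) / d i.
  by rewrite /cyclic_op -/p -/s !mulrDl; ring.
have coef0 : 0 < 2 * kap i + c i / d p + c i / d i.
  rewrite !addr_gt0 ?divr_gt0 // mulr_gt0 //; exact: lt_le_trans (kk i).
have := congr1 Num.norm E; rewrite normrM gtr0_norm // => {}E.
have : (2 * kap i + c i / d p + c i / d i) * `|x i| <=
    M + (c i * `|x i|) / d p + (c i * `|x i|) / d i.
  rewrite E; apply: le_trans (ler_normB _ _) _; apply: lerD.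
    apply: le_trans (ler_normB _ _) _; apply: lerD => //.
    by rewrite normrM cx gtr0_norm // ler_wpM2r // ltW.
  by rewrite normrM cx gtr0_norm // ler_wpM2r // ltW.
rewrite !mulrDl.
rewrite (_ : c i / d p * `|x i| = c i * `|x i| / d p); last by ring.
rewrite (_ : c i / d i * `|x i| = c i * `|x i| / d i); last by ring.
rewrite lerD2r lerD2r => H; apply: le_trans H.
by have := ler_wpM2r (normr_ge0 (x i)) (kk i); lra.
Qed.

(** Sums of indicator terms let coinciding neighbours add up, as happens for [n = 2]; column [j]
    holds the coefficients of equation [j], since vectors are rows. *)
Let A : 'M[R]_n := \matrix_(i, j)
  ((2 * kap j + c j / d (ord_pred j) + c j / d j) * (i == j)%:R
   + c i / d (ord_pred j) * (i == ord_pred j)%:R + c i / d j * (i == ordS j)%:R).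

Let sum_delta (y : 'I_n -> R) a : \sum_i y i * (i == a)%:R = y a.
Proof.
rewrite (bigD1 a) //= eqxx mulr1 big1 ?addr0 // => i /negPf ->.
by rewrite mulr0.
Qed.

Let mul_A (x : 'rV[R]_n) j : (x *m A) 0 j = cyclic_op (x 0) j.
Proof.
rewrite mxE (eq_bigr (fun i =>
  (x 0 i * (2 * kap j + c j / d (ord_pred j) + c j / d j)) * (i == j)%:R
  + (x 0 i * (c i / d (ord_pred j))) * (i == ord_pred j)%:R
  + (x 0 i * (c i / d j)) * (i == ordS j)%:R)); last first.
  by move=> i _; rewrite mxE; ring.
rewrite 2!big_split /= !sum_delta /cyclic_op; ring.
Qed.

Lemma cyclic_op_solve k b : 0 < k -> (forall j, k <= kap j) ->
  exists x, forall j, cyclic_op x j = b j.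
Proof.
move=> k0 kk; have Au : A \in unitmx.
  rewrite -row_free_unit; apply: inj_row_free => x xA; apply/rowP => j.
  have bnd : forall j, `|cyclic_op (x 0) j| <= 0.
    by move=> i; rewrite -mul_A xA mxE normr0.
  have := cyclic_op_bound k0 kk bnd j.
  by rewrite mul0r pmulr_rle0 // normr_le0 mxE => /eqP.
exists ((\row_j b j *m invmx A) 0) => j.
by rewrite -mul_A -mulmxA mulVmx // mulmx1 mxE.
Qed.

End CyclicSystem.

(** * Expansions of plane vectors and of unit directions *)

Section VectorExpansions.
Variables (R : realType) (T : Type) (F : set_system T).
Context {FF : Filter F}.
Variable rho : T -> R.
Hypothesis rho0 : forall z, 0 <= rho z.
Hypothesis rho_cvg : rho @ F --> (0 : R).
Implicit Types (f g df dg : T -> 'rV[R]_2).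

Definition vexpands f (v : 'rV[R]_2) df :=
  forall c : 'I_2, expands F rho (fun z => f z 0 c) (v 0 c) (fun z => df z 0 c).

Lemma vexpandsB f (v : 'rV[R]_2) df g (w : 'rV[R]_2) dg :
  vexpands f v df -> vexpands g w dg ->
  vexpands (fun z => f z - g z) (v - w) (fun z => df z - dg z).
Proof.
move=> Hf Hg c; have := expandsB (FF := FF) (Hf c) (Hg c).
by apply: expands_ext => [z||z]; rewrite !mxE.
Qed.

Lemma expands_dot f (v : 'rV[R]_2) df g (w : 'rV[R]_2) dg :
  vexpands f v df -> vexpands g w dg ->
  expands F rho (fun z => dot (f z) (g z)) (dot v w)
    (fun z => dot v (dg z) + dot (df z) w).
Proof.
move=> Hf Hg.
have := expandsD (FF := FF) (expandsM (FF := FF) rho0 rho_cvg (Hf 0) (Hg 0))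
  (expandsM (FF := FF) rho0 rho_cvg (Hf 1) (Hg 1)).
by apply: expands_ext => [z||z] //; rewrite /dot; ring.
Qed.

Lemma inv_approx (x : R) : x != 0 -> linear_approx (fun y => y^-1) x (- x ^- 2).
Proof.
move=> x0; have did : derivable (fun y : R => y) x 1 by exact: (@derivable_id R R x 1).
apply: is_derive_approx; split; first exact: (@derivableV R R (fun y => y) x 1 x0 did).
by rewrite (@deriveV R R (fun y => y) x 1 x0 did) (@derive_id R R x 1) [_ *: _]mulr1.
Qed.

(** A unit direction varies only orthogonally to itself, by the orthogonal part of the displacement
    divided by the distance. The clockwise turn occurs twice, so its orientation does not affect the
    result. *)
Lemma expands_direction Q (q : 'rV[R]_2) dQ : q <> 0 -> vexpands Q q dQ ->
  vexpands (fun z => (enorm (Q z))^-1 *: Q z) ((enorm q)^-1 *: q)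
    (fun z => ((enorm q)^-1 * dot (clockwise_turn ((enorm q)^-1 *: q)) (dQ z))
       *: clockwise_turn ((enorm q)^-1 *: q)).
Proof.
move=> q0 HQ; have s0 := enorm_gt0 q0.
have qq : 0 < dot q q by rewrite -sqr_enorm exprn_gt0.
have eN := expands_comp (FF := FF) rho0 rho_cvg (is_derive_approx (is_derive1_sqrt qq)) (expands_dot HQ HQ).
have sn0 : enorm q != 0 by rewrite gt_eqF.
have eI := expands_comp (FF := FF) rho0 rho_cvg (inv_approx sn0) eN.
have sE : enorm q * enorm q = q 0 0 * q 0 0 + q 0 1 * q 0 1 by rewrite -expr2 sqr_enorm.
have main z : forall c : 'I_2, (enorm q)^-1 * dQ z 0 c + q 0 c * (- (enorm q) ^- 2 *
     ((2 * enorm q)^-1 * (dot q (dQ z) + dot (dQ z) q))) =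
   (((enorm q)^-1 * dot (clockwise_turn ((enorm q)^-1 *: q)) (dQ z))
       *: clockwise_turn ((enorm q)^-1 *: q)) 0 c.
  have a (y : R) : (enorm q)^-1 * y =
      (q 0 0 * q 0 0 + q 0 1 * q 0 1) * y / (enorm q * enorm q * enorm q).
    by rewrite -sE; field.
  case=> [[|[|//]] i].
    have -> : Ordinal i = 0 by exact: val_inj.
    rewrite a dot_clockwise_turn /cross /dot !mxE /=; field; exact: sn0.
  have -> : Ordinal i = 1 by exact: val_inj.
  rewrite a dot_clockwise_turn /cross /dot !mxE /=; field; exact: sn0.
move=> c; have := expandsM (FF := FF) rho0 rho_cvg eI (HQ c).
apply: expands_ext => [z||z]; try by rewrite mxE.
exact: main.
Qed.

End VectorExpansions.

(** * Linearized reflection law *)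

Section DerivativeWithin.
Variables (R : realType) (I : set R) (alpha : R).

Lemma within_dnbhs_le (V : normedModType R) (g : R -> V) (l : V) :
  (forall e, 0 < e -> \forall b \near within I (nbhs alpha),
     `|g b - g alpha - (b - alpha) *: l| <= e * `|b - alpha|) ->
  is_deriv_within I g alpha l.
Proof.
move=> H; apply/cvgrPdist_le => e e0.
have /near_within_nbhsP [d d0 Hd] := H e e0.
exists d => //= b; rewrite /ball_ /= distrC => bd ba Ib.
have := Hd b bd Ib; have ba0 : b - alpha != 0 by rewrite subr_eq0.
have -> : l - (b - alpha)^-1 *: (g b - g alpha) =
    - ((b - alpha)^-1 *: (g b - g alpha - (b - alpha) *: l)).
  by rewrite [in RHS]scalerBr scalerA mulVf // scale1r opprB.
by rewrite normrN normrZ normfV ler_pdivrMl ?normr_gt0 // mulrC.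
Qed.

Lemma negligible_deriv_within (g : R -> R) (l : R) :
  negligible (within I (nbhs alpha)) (fun b => `|b - alpha|)
    (fun b => g b - g alpha - l * (b - alpha)) ->
  is_deriv_within I g alpha l.
Proof.
move=> H; apply: within_dnbhs_le => e e0; apply: filterS (H e e0) => b.
by rewrite -[(b - alpha) *: l]/((b - alpha) * l) (mulrC (b - alpha)).
Qed.

Lemma negligible_deriv_within_plane (g : R -> 'rV[R]_2) (l : 'rV[R]_2) :
  (forall c : 'I_2, negligible (within I (nbhs alpha)) (fun b => `|b - alpha|)
    (fun b => g b 0 c - g alpha 0 c - l 0 c * (b - alpha))) ->
  is_deriv_within I g alpha l.
Proof.
move=> H; apply: within_dnbhs_le => e e0.
have H2 : \forall b \near within I (nbhs alpha), forall c : 'I_2,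
    `|g b 0 c - g alpha 0 c - l 0 c * (b - alpha)| <= e * `|b - alpha|.
  by apply: filter_forall => c; exact: H.
apply: filterS H2 => b Hb.
rewrite [leLHS]/Num.Def.normr /= mx_normrE bigmax_le //.
  by rewrite mulr_ge0 // ltW.
move=> [i c] _ /=; rewrite !mxE (ord1 i) (mulrC (b - alpha)); exact: Hb.
Qed.

End DerivativeWithin.

Lemma combination_coord (R : realType) (x y : R) (v w : 'rV[R]_2) (c : 'I_2) :
  v 0 c * x + w 0 c * y = (x *: v + y *: w) 0 c.
Proof. by rewrite !mxE; ring. Qed.

Lemma combination_change (R : realType) (q q0 x y t : R) (v w : 'rV[R]_2) (c : 'I_2) :
  q - q0 - (x *: v + t *: w) 0 c + v 0 c * (x - y * t) =
  q - q0 - (y *: v + w) 0 c * t.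
Proof. by rewrite !mxE; ring. Qed.

(* The linearized reflection law in terms of the normal components
   [c j = dot (e j) (N j)]; [E j] is [e j] turned clockwise. *)
Lemma linearized_reflection (R : realType) (n : nat)
    (T N e E k D D' : 'I_n -> 'rV[R]_2) (kap c d x : 'I_n -> R) (t : R) (j : 'I_n) :
  e (ord_pred j) - e j = (- 2 * c j) *: N j ->
  (forall i, dot (E i) (T i) = - c i) ->
  (forall i, dot (E i) (T (ordS i)) = c (ordS i)) ->
  dot (k j) (N j) = - kap j ->
  let dQ i := (x (ordS i) *: T (ordS i) + t *: D (ordS i)) - (x i *: T i + t *: D i) in
  let de i := ((d i)^-1 * dot (E i) (dQ i)) *: E i in
  dot (T j) (de (ord_pred j) - de j) + dot (x j *: k j + t *: D' j) (e (ord_pred j) - e j)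
  = c j * (cyclic_op kap c d x j
     + (dot (E (ord_pred j)) (D j - D (ord_pred j)) / d (ord_pred j)
        + dot (E j) (D (ordS j) - D j) / d j - 2 * dot (N j) (D' j)) * t).
Proof.
move=> F1 F2 F3 F4 dQ de.
have EQ i : dot (E i) (dQ i) = x (ordS i) * c (ordS i) + x i * c i
    + t * (dot (E i) (D (ordS i)) - dot (E i) (D i)).
  by rewrite /dQ /= !(dotBr, dotDr, dotZr) F2 F3; ring.
have EP : dot (T j) (E (ord_pred j)) = c j.
  by have := F3 (ord_pred j); rewrite ord_predK dotC.
have ET : dot (T j) (E j) = - c j by rewrite dotC F2.
have kN : dot (D' j) (N j) = dot (N j) (D' j) by rewrite dotC.
rewrite F1 /de; clearbody dQ; rewrite /= !(dotBr, dotZr) !(dotDl, dotZl) F4 EP ET kN !EQ.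
by rewrite ord_predK /cyclic_op; ring.
Qed.

(** * Arithmetic of the stated constants *)

Section FinalBounds.
Variable R : realType.
Implicit Types (c y k d B q x : R).

Lemma rate_of_scaled_bound c y k d q1 q2 : 0 < c -> 0 < k -> 0 < d ->
  c * y <= 2 * (q2 + q1 / d) / (2 * k) -> y <= c^-1 * ((q1 + q2 * d) / (k * d)).
Proof.
move=> c0 k0 d0; rewrite mulrC -ler_pdivlMr // mulrC.
rewrite (_ : 2 * (q2 + q1 / d) / (2 * k) = (q1 + q2 * d) / (k * d)) //.
by field; rewrite !gt_eqF.
Qed.

Lemma velocity_bound (v w : 'rV[R]_2) x B q c y : y = c -> `|x| <= c^-1 * B ->
  enorm v = 1 -> enorm w <= q -> enorm (x *: v + w) <= y^-1 * B + q.
Proof.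
move=> -> xB v1 wq; apply: le_trans (ler_enormD _ _) _; apply: lerD => //.
by rewrite enormZ v1 mulr1.
Qed.

Lemma angle_bound c y B q (t c' y' : R) : c' = c -> y' = y -> 0 < y -> y <= c ->
  0 <= B -> 0 <= q -> t <= 1 -> c'^-1 * B + t * q <= y'^-1 * B + q.
Proof.
move=> -> -> y0 yc B0 q0 t1; apply: lerD; last by rewrite -[leRHS]mul1r ler_wpM2r.
by rewrite ler_wpM2r // lef_pV2 ?posrE // (lt_le_trans y0).
Qed.

End FinalBounds.

(** * Variation of a continuous branch of minimizers *)

Section Variation.
Variables (R : realType) (m r r' : nat) (K : obstacles R m) (I : set R).
Variable C : nat -> nat -> R -> R.
Hypotheses (hr : (2 <= r)%N) (hr' : (1 <= r')%N).
Hypothesis hK : is_billiard_deformation K r r' I C.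
Hypothesis accum : forall alpha, I alpha -> forall d, 0 < d ->
  exists b, [/\ I b, b != alpha & `|b - alpha| < d].
Variables (n : nat) (xi : 'I_n -> 'I_m).
Hypothesis hxi : is_itinerary xi.
Variables (alpha : R) (w : 'rV[R]_n) (v : R -> 'rV[R]_n).
Hypothesis Ia : I alpha.
Hypothesis wL : forall j, 0 <= w 0 j <= len K (xi j) alpha.
Hypothesis wmin : is_length_minimizer K xi w alpha.
Local Notation F := (within I (nbhs alpha)).
Hypothesis vmin : \forall b \near F, is_length_minimizer K xi (v b) b.
Hypothesis vcvg : v @ F --> w.
Implicit Types i j : 'I_n.

Let tb := def_table hK Ia.
Let sm := deformation_smooth hr hr' hK Ia.
Let FF : Filter F. Proof. exact: within_filter. Qed.

Let p := refl_point K xi w alpha.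
Let T j := tangent K (xi j) (w 0 j) alpha.
Let N j := clockwise_turn (T j).
Let e j := fdir p j.
Let E j := clockwise_turn (e j).
Let k j := pderiv 2 0 (param K (xi j)) (w 0 j) alpha.
Let D j := pderiv 0 1 (param K (xi j)) (w 0 j) alpha.
Let D' j := pderiv 1 1 (param K (xi j)) (w 0 j) alpha.

Definition orbit_cos j := dot (e j) (N j).
Definition orbit_flight j := enorm (p (ordS j) - p j).
Definition orbit_curvature j := curvature K (xi j) (w 0 j) alpha.
(** This is $b_j$, with the common factor $c_j$ divided out: the explicit displacements turn the
    incoming and outgoing directions, and the tangent itself rotates. *)
Definition orbit_drift j : R :=
  dot (E (ord_pred j)) (D j - D (ord_pred j)) / orbit_flight (ord_pred j)
  + dot (E j) (D (ordS j) - D j) / orbit_flight j - 2 * dot (N j) (D' j).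

Local Notation dlt i b := (v b 0 i - w 0 i).
Local Notation rho := (fun b => `|b - alpha| + \sum_(i < n) `|dlt i b|).

(** [w 0 j] may be the full length, whose reduction is [0]; there the matching of first and second
    derivatives at the junction is used. *)
Lemma frac_tangent j : etangent K (xi j) (w 0 j) alpha = T j /\
  pderiv 2 0 (param K (xi j)) (frac_param K alpha (xi j) (w 0 j)) alpha = k j.
Proof.
have /andP[w0] := wL j; rewrite /etangent /T /k le_eqVlt => /orP[/eqP->|w1]; last first.
  by rewrite (frac_param_small hK Ia) // w0.
have L0 := bd_len tb (xi j).
have -> : frac_param K alpha (xi j) (len K (xi j) alpha) = 0.
  have := frac_param_shift hK (xi j) 0 1 Ia; rewrite mul1r add0r => ->.
  by rewrite (frac_param_small hK Ia) // lexx.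
by have [_ -> ->] := table_junction hr tb sm (xi j).
Qed.

Lemma frac_curvature j :
  curvature K (xi j) (frac_param K alpha (xi j) (w 0 j)) alpha = orbit_curvature j.
Proof.
have [TE kE] := frac_tangent j.
rewrite /orbit_curvature /curvature -/(T j) -/(k j) -TE -kE; by [].
Qed.

Lemma orbit_state_cos j : dot (vel (orbit_state K alpha xi w j))
  (nrm K alpha (orbit_state K alpha xi w j)) = orbit_cos j.
Proof. by have [TE _] := frac_tangent j; rewrite /orbit_cos /N -TE. Qed.

Lemma variation_rho_ge0 b : 0 <= rho b.
Proof. by rewrite /= addr_ge0 // sumr_ge0. Qed.

Lemma variation_rho_cvg : rho @ F --> (0 : R).
Proof.
have H : rho @ F --> `|alpha - alpha| + \sum_(i < n) `|w 0 i - w 0 i|.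
  apply: cvgD.
    apply: cvg_norm; apply: cvgB; last exact: cvg_cst.
    exact: cvg_within.
  apply: cvg_big; first exact: add_continuous.
  move=> i _; apply: cvg_norm; apply: cvgB; last exact: cvg_cst.
  apply: (@cvg_comp _ _ _ v (fun M : 'rV[R]_n => M 0 i) _ _ _ _
    (@coord_continuous R 1 n 0 i w)).
  exact: vcvg.
rewrite subrr normr0 add0r big1 // in H.
by move=> i _; rewrite subrr normr0.
Qed.

Let Fp : \forall b \near F, I b.
Proof. by apply/near_within_nbhsP; exists 1. Qed.

Let rho_bound j b : `|dlt j b| + `|b - alpha| <= rho b.
Proof.
rewrite addrC /= lerD2l (bigD1 j) //= lerDl.
by apply: sumr_ge0.
Qed.

Lemma expands_point j : vexpands F rho (fun b => refl_point K xi (v b) b j) (p j)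
  (fun b => dlt j b *: T j + (b - alpha) *: D j).
Proof.
move=> c; have := expands_approx2 (FF := FF) variation_rho_ge0 variation_rho_cvg
  (eparam_approx2 hr hr' hK accum c Ia (wL j)) Fp (rho_bound j).
apply: expands_ext => [b||b]; [by [] | by [] | exact: combination_coord].
Qed.

Lemma expands_tangent j :
  vexpands F rho (fun b => etangent K (xi j) (v b 0 j) b) (T j)
    (fun b => dlt j b *: k j + (b - alpha) *: D' j).
Proof.
move=> c; have := expands_approx2 (FF := FF) variation_rho_ge0 variation_rho_cvg
  (etangent_approx2 hr hr' hK accum c Ia (wL j)) Fp (rho_bound j).
apply: expands_ext => [b||b]; [by [] | | exact: combination_coord].
by have [-> _] := frac_tangent j.
Qed.

Lemma orbit_tangent_unit j : enorm (T j) = 1.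
Proof. exact: (bd_arclength tb (wL j)). Qed.

Lemma orbit_dir_unit j : enorm (e j) = 1.
Proof. by apply: (fdir_unit tb hxi). Qed.

Lemma orbit_reflection j : 0 < orbit_cos j /\
  dot (e (ord_pred j)) (N j) = - orbit_cos j.
Proof.
have := minimizer_reflection hr tb sm hxi wmin j; have [TE _] := frac_tangent j.
by rewrite -[tangent _ _ _ _]/(etangent K (xi j) (w 0 j) alpha) TE.
Qed.

Lemma orbit_stationary j : dot (T j) (e (ord_pred j) - e j) = 0.
Proof.
have := minimizer_stationary hr tb sm hxi wmin j; have [TE _] := frac_tangent j.
by rewrite -[tangent _ _ _ _]/(etangent K (xi j) (w 0 j) alpha) TE.
Qed.

Lemma orbit_bisector j : e (ord_pred j) - e j = (- 2 * orbit_cos j) *: N j.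
Proof.
have T1 := orbit_tangent_unit j.
have N1 : dot (N j) (N j) = 1 := dotvv_unit (clockwise_turn_unit T1).
have [_ rf] := orbit_reflection j.
apply: (frame_eq T1).
  rewrite dotC orbit_stationary dotZl dot_clockwise_turn /cross.
  by rewrite (mulrC (T j 0 1)) subrr oppr0 mulr0.
by rewrite -/(N j) dotBl rf (dotZl (- 2 * orbit_cos j) (N j) (N j)) N1 -/(orbit_cos j); ring.
Qed.

Lemma orbit_dir_tangent j : dot (E j) (T j) = - orbit_cos j.
Proof.
by rewrite /orbit_cos /E /N dotC [in RHS]dotC !dot_clockwise_turn dotC dot_clockwise_turn /cross; ring.
Qed.

Lemma orbit_dir_tangentS j : dot (E j) (T (ordS j)) = orbit_cos (ordS j).
Proof.
have [_ ] := orbit_reflection (ordS j); rewrite ordSK => H.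
rewrite -[RHS]opprK -H /E /N dot_clockwise_turn dotC dot_clockwise_turn /cross; ring.
Qed.

Lemma orbit_curvature_normal j : dot (k j) (N j) = - orbit_curvature j.
Proof. by rewrite dotC dot_clockwise_turn. Qed.

Lemma orbit_flight_gt0 j : 0 < orbit_flight j.
Proof. exact: (flight_gt0 tb hxi). Qed.

(** Stationarity holds at every [b] of the interval near [alpha], so it can be linearized at
    [alpha]. The expansion carries the factor [orbit_cos j], which is positive and is divided
    out. *)
Lemma variation_equation j : negligible F rho (fun b =>
  cyclic_op orbit_curvature orbit_cos orbit_flight (fun i => dlt i b) j
  + orbit_drift j * (b - alpha)).
Proof.
have r0 := variation_rho_ge0; have rc := variation_rho_cvg.
have VQ i := vexpandsB (FF := FF) (expands_point (ordS i)) (expands_point i).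
have qn i : p (ordS i) - p i <> 0.
  by apply: (config_neqS tb hxi) => l; exact: (eparam_body tb).
have VE i := @expands_direction _ _ _ FF _ r0 rc _ _ _ (qn i) (VQ i).
have VF := @expands_dot _ _ _ FF _ r0 rc _ _ _ _ _ _ (expands_tangent j)
  (@vexpandsB _ _ _ FF _ _ _ _ _ _ _ (VE (ord_pred j)) (VE j)).
have V0 : expands F rho (fun=> 0) (dot (T j) (e (ord_pred j) - e j)) (fun=> 0).
  by rewrite orbit_stationary; exact: (expands_cst (FF := FF) r0 0).
have crit : \forall b \near F, dot (etangent K (xi j) (v b 0 j) b)
    (fdir (refl_point K xi (v b) b) (ord_pred j) - fdir (refl_point K xi (v b) b) j) = 0.
  apply: filterS2 Fp vmin => b Ib vb.
  exact: (minimizer_stationary hr (def_table hK Ib) (deformation_smooth hr hr' hK Ib) hxi vb j).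
have NF := expands_eq_near (FF := FF) VF V0 crit.
have := negligibleZ (FF := FF) (orbit_cos j)^-1 NF; apply: negligible_ext => b.
rewrite subr0.
have L := @linearized_reflection R n T N e E k D D' orbit_curvature orbit_cos orbit_flight
  (fun i => dlt i b) (b - alpha) j (orbit_bisector j) orbit_dir_tangent orbit_dir_tangentS
  (orbit_curvature_normal j).
apply: (etrans (congr1 (fun y => (orbit_cos j)^-1 * y) L)).
by rewrite mulKf // gt_eqF //; case: (orbit_reflection j).
Qed.

Lemma orbit_cos_le1 j : orbit_cos j <= 1.
Proof.
apply: le_trans (ler_norm _) _; rewrite -(clockwise_turn_unit (orbit_tangent_unit j)).
exact: dot_unit_le (orbit_dir_unit j).
Qed.

Let c0 j : 0 < orbit_cos j. Proof. by case: (orbit_reflection j). Qed.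

Section Rates.
Variable kmin : R.
Hypotheses (kmin0 : 0 < kmin) (kminP : forall j, kmin <= orbit_curvature j).

(** The operator maps the error [dlt j b - x j * (b - alpha)] to $o(\rho)$; its bound returns the
    same for the error itself, and [negligible_absorb] replaces $\rho$ by $|b-\alpha|$. *)
Lemma variation_rates : exists x : 'I_n -> R,
  (forall j, cyclic_op orbit_curvature orbit_cos orbit_flight x j = - orbit_drift j) /\
  forall j, negligible F (fun b => `|b - alpha|) (fun b => dlt j b - x j * (b - alpha)).
Proof.
have [x Hx] := cyclic_op_solve c0 orbit_cos_le1 orbit_flight_gt0
  (fun j => - orbit_drift j) kmin0 kminP.
exists x; split=> //; apply: negligible_absorb => j eps eps0.
(* Scaled so that [cyclic_op_bound], which divides by [2 * kmin] and keeps the weight [orbit_cos j],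
   returns exactly [eps]. *)
have e0 : 0 < eps * orbit_cos j * (2 * kmin) by rewrite !mulr_gt0.
have H : \forall b \near F, forall i,
    `|cyclic_op orbit_curvature orbit_cos orbit_flight (fun l => dlt l b) i
      + orbit_drift i * (b - alpha)| <= eps * orbit_cos j * (2 * kmin) * rho b.
  by apply: filter_forall => i; exact: (variation_equation i e0).
apply: filterS H => b Hb.
have lin i : cyclic_op orbit_curvature orbit_cos orbit_flight
    (fun l => dlt l b - x l * (b - alpha)) i =
  cyclic_op orbit_curvature orbit_cos orbit_flight (fun l => dlt l b) i
    + orbit_drift i * (b - alpha).
  by rewrite cyclic_op_lin Hx mulNr opprK.
have bnd i : `|cyclic_op orbit_curvature orbit_cos orbit_flight
    (fun l => dlt l b - x l * (b - alpha)) i| <= eps * orbit_cos j * (2 * kmin) * rho b.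
  by rewrite lin; exact: Hb.
have := cyclic_op_bound c0 orbit_cos_le1 orbit_flight_gt0 kmin0 kminP bnd j.
have k2 : 2 * kmin != 0 by rewrite mulf_neq0 // gt_eqF.
rewrite (_ : eps * orbit_cos j * (2 * kmin) * rho b / (2 * kmin) =
  orbit_cos j * (eps * rho b)); last by rewrite mulrAC mulfK // -mulrA mulrCA.
by rewrite ler_pM2l.
Qed.

(** Once the rates exist, the scale containing the increments is at most a multiple of $|b-\alpha|$,
    so the expansion of the point becomes a derivative. *)
Lemma point_rate (x : 'I_n -> R) :
  (forall j, negligible F (fun b => `|b - alpha|) (fun b => dlt j b - x j * (b - alpha))) ->
  forall j (c : 'I_2), negligible F (fun b => `|b - alpha|)
    (fun b => refl_point K xi (v b) b j 0 c - p j 0 c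
              - (x j *: T j + D j) 0 c * (b - alpha)).
Proof.
move=> Hx j c; have [_ NP] := expands_point j c.
have nM : 0 <= \sum_(i < n) (`|x i| + 1) by apply: sumr_ge0 => i _; rewrite addr_ge0.
set M := \sum_(i < n) (`|x i| + 1) in nM.
have rhoM : \forall b \near F, rho b <= (M + 1) * `|b - alpha|.
  have H : \forall b \near F, forall i, `|dlt i b - x i * (b - alpha)| <= 1 * `|b - alpha|.
    by apply: filter_forall => i; exact: (Hx i 1 ltr01).
  apply: filterS H => b Hb; rewrite mulrDl mul1r addrC lerD2r /M mulr_suml.
  apply: ler_sum => i _; rewrite -[X in `|X| <= _](subrK (x i * (b - alpha))) mulrDl addrC.
  by apply: le_trans (ler_normD _ _) _; rewrite normrM lerD2l; exact: Hb.
have NP' : negligible F (fun b => `|b - alpha|) (fun b => refl_point K xi (v b) b j 0 c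
    - p j 0 c - (dlt j b *: T j + (b - alpha) *: D j) 0 c).
  move=> eps eps0; have M0 : 0 < M + 1 by rewrite ltr_wpDl.
  apply: filterS2 (NP _ (divr_gt0 eps0 M0)) rhoM => b h1 h2.
  apply: le_trans h1 _; apply: (@le_trans _ _ (eps / (M + 1) * ((M + 1) * `|b - alpha|))).
    by rewrite ler_wpM2l // divr_ge0 // ltW.
  by rewrite mulrA mulfVK // gt_eqF.
have := negligibleD (FF := FF) NP' (negligibleZ (FF := FF) (T j 0 c) (Hx j)).
by apply: negligible_ext => b; exact: combination_change.
Qed.

End Rates.

(** The parametrization is constant only along parameters of [I], whereas [pderiv] is a two-sided
    derivative; as [alpha] is an accumulation point of [I], the values there already determine
    it. *)
Lemma unaffected_slope j : ~ affected K I (xi j) -> D j = 0.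
Proof.
move=> na; have Dc c : D j 0 c = 0.
  have /is_derive_approx A1 := smooth_db (sm (wL j)) c.
  have A2 : linear_approx (fun=> param K (xi j) (w 0 j) alpha 0 c) alpha 0.
    by move=> eps eps0; exists 1 => // y _; rewrite subrr mul0r subrr normr0 mulr_ge0 // ltW.
  apply: (approx_eq_along A1 A2 (accum Ia)) => // y Iy.
  have [_ H] := def_unaffected hK na Ia Iy.
  by rewrite (H _ (wL j)).
by apply: plane_eq; rewrite Dc mxE.
Qed.

Lemma slope_bound j : enorm (D j) <= delta K I (xi j) * C 0%N 1%N alpha.
Proof.
rewrite /delta; case: asboolP => [_|na]; last by rewrite unaffected_slope // enorm0 mul0r.
rewrite mul1r; apply: (def_bounds hK) => //; exact: wL.
Qed.

Lemma slope_const_ge0 j : 0 <= C 0%N 1%N alpha.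
Proof.
apply: le_trans (enorm_ge0 (D j)) _.
apply: (def_bounds hK) => //; exact: wL.
Qed.

Lemma turn_const_ge0 j : 0 <= C 1%N 1%N alpha.
Proof.
apply: le_trans (enorm_ge0 (D' j)) _.
apply: (def_bounds hK) => //; first [exact: wL | exact: ltnW hr].
Qed.

(* Only one obstacle moves, so at most one of two consecutive reflection points
   has a nonzero explicit derivative. *)
Lemma slope_difference_bound j : enorm (D (ordS j) - D j) <= C 0%N 1%N alpha.
Proof.
have [aj|na] := pselect (affected K I (xi j)).
  rewrite (unaffected_slope (j := ordS j)).
    by rewrite sub0r enormN; apply: (def_bounds hK) => //; exact: wL.
  by move=> aS; exact: (@hxi j (def_one hK aj aS)).
by rewrite (unaffected_slope na) subr0; apply: (def_bounds hK) => //; exact: wL.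
Qed.

Lemma drift_bound dmin : 0 < dmin -> (forall j, dmin <= orbit_flight j) ->
  forall j, `|orbit_drift j| <= 2 * (C 1%N 1%N alpha + C 0%N 1%N alpha / dmin).
Proof.
move=> dm0 dmP j; have E1 i : enorm (E i) = 1.
  exact: (clockwise_turn_unit (orbit_dir_unit i)).
have N1 : enorm (N j) = 1 := clockwise_turn_unit (orbit_tangent_unit j).
have term i : `|dot (E i) (D (ordS i) - D i) / orbit_flight i| <= C 0%N 1%N alpha / dmin.
  rewrite normrM normfV (gtr0_norm (orbit_flight_gt0 i)).
  apply: ler_pM => //; first by rewrite invr_ge0 ltW // orbit_flight_gt0.
    by apply: le_trans (dot_unit_le _ (E1 i)) _; exact: slope_difference_bound.
  by rewrite lef_pV2 ?posrE ?orbit_flight_gt0.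
have t1 := term (ord_pred j); rewrite ord_predK in t1; have t2 := term j.
have t3 : `|2 * dot (N j) (D' j)| <= 2 * C 1%N 1%N alpha.
  rewrite normrM (ger0_norm (_ : 0 <= 2)) // ler_wpM2l //.
  apply: le_trans (dot_unit_le _ N1) _.
  apply: (def_bounds hK) => //; first [exact: wL | exact: ltnW hr].
rewrite /orbit_drift; apply: le_trans (ler_normB _ _) _.
have t4 := ler_normD (dot (E (ord_pred j)) (D j - D (ord_pred j)) / orbit_flight (ord_pred j))
  (dot (E j) (D (ordS j) - D j) / orbit_flight j).
move: t1 t2 t3 t4; set a1 := `|_|; set a2 := `|_ / _|; set a3 := `|2 * _|; set a4 := `|_ + _|.
move: (C 0%N 1%N alpha / dmin) (C 1%N 1%N alpha) a1 a2 a3 a4 => q1 q2 a1 a2 a3 a4.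
lra.
Qed.

Lemma rate_bound kmin dmin (x : 'I_n -> R) : 0 < kmin -> 0 < dmin ->
  (forall j, kmin <= orbit_curvature j) -> (forall j, dmin <= orbit_flight j) ->
  (forall j, cyclic_op orbit_curvature orbit_cos orbit_flight x j = - orbit_drift j) ->
  forall j, `|x j| <= (orbit_cos j)^-1 *
    ((C 0%N 1%N alpha + C 1%N 1%N alpha * dmin) / (kmin * dmin)).
Proof.
move=> kmin0 dmin0 kminP dminP Hx j; apply: rate_of_scaled_bound => //.
apply: (cyclic_op_bound c0 orbit_cos_le1 orbit_flight_gt0 kmin0 kminP) => i.
by rewrite Hx normrN; exact: drift_bound.
Qed.

End Variation.

(** * The derivative of the periodic points *)

(** Since [a < b], there is room on at least one side: to the left when [alpha] is the right
    endpoint, to the right otherwise. The step is at most [d / 2] and at most the distance to a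
    finite endpoint on that side. *)
Lemma param_interval_accum (R : realType) (a b : \bar R) : (a < b)%E ->
  forall alpha, param_interval a b alpha -> forall d, 0 < d ->
  exists beta, [/\ param_interval a b beta, beta != alpha & `|beta - alpha| < d].
Proof.
move=> ab alpha /andP[aa ba] d d0.
have step h : 0 < h -> h < d -> [/\ alpha + h != alpha, `|alpha + h - alpha| < d,
    alpha - h != alpha & `|alpha - h - alpha| < d].
  move=> h0 hd.
  have E1 : alpha + h - alpha = h by rewrite addrAC subrr add0r.
  have E2 : alpha - h - alpha = - h by rewrite addrAC subrr add0r.
  rewrite -(subr_eq0 (alpha + h)) -(subr_eq0 (alpha - h)) E1 E2 normrN oppr_eq0.
  by rewrite gtr0_norm // gt_eqF.
have right h : 0 < h -> h < d -> ((alpha + h)%:E <= b)%E ->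
    exists beta, [/\ param_interval a b beta, beta != alpha & `|beta - alpha| < d].
  move=> h0 hd hb; have [s1 s2 _ _] := step h h0 hd; exists (alpha + h); split=> //.
  by apply/andP; split => //; apply: le_trans aa _; rewrite lee_fin lerDl ltW.
have left h : 0 < h -> h < d -> (a <= (alpha - h)%:E)%E ->
    exists beta, [/\ param_interval a b beta, beta != alpha & `|beta - alpha| < d].
  move=> h0 hd ha; have [_ _ s1 s2] := step h h0 hd; exists (alpha - h); split=> //.
  by apply/andP; split => //; apply: le_trans _ ba; rewrite lee_fin gerBl ltW.
have d20 : 0 < d / 2 by rewrite divr_gt0.
have d2d : d / 2 < d by rewrite ltr_pdivrMr // ltr_pMr // ltr1n.
have [bE|ab'] := eqVneq b alpha%:E.
  rewrite bE in ab; clear aa right step; case: a ab left => [a0||] //= ab left.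
    rewrite lte_fin in ab; apply: (left (Num.min (d / 2) (alpha - a0))).
    - by rewrite lt_min d20 subr_gt0.
    - by rewrite gt_min d2d.
    - by rewrite lee_fin lerBrDr -lerBrDl ge_min lexx orbT.
  by apply: (left (d / 2)) => //; rewrite leNye.
clear left step; case: b ab ba ab' right => [b0||] //= ab ba ab' right.
  rewrite lee_fin in ba; have lt : alpha < b0.
    by rewrite lt_neqAle ba andbT; apply: contraNneq ab' => ->.
  apply: (right (Num.min (d / 2) (b0 - alpha))).
  - by rewrite lt_min d20 subr_gt0.
  - by rewrite gt_min d2d.
  - by rewrite lee_fin -lerBrDl ge_min lexx orbT.
by apply: (right (d / 2)) => //; rewrite leey.
Qed.

Lemma acos_le_inv (R : realType) (x y : R) : -1 <= x <= 1 -> -1 <= y <= 1 ->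
  acos x <= acos y -> y <= x.
Proof.
move=> x1 y1; have [x0 xpi] := (acos_ge0 x1, acos_lepi x1).
have [y0 ypi] := (acos_ge0 y1, acos_lepi y1).
rewrite leNgt -ltr_cos ?in_itv /= ?x0 ?y0 // !acosK ?in_itv /= ?x1 ?y1 //.
by rewrite -leNgt.
Qed.

Theorem corollary4p2 (R : realType) (m : nat) (hm : (3 <= m)%N)
  (a b : \bar R) (hab : (a < b)%E) (r r' : nat) (hr : (2 <= r)%N)
  (hr' : (1 <= r')%N) (K : obstacles R m) (C : nat -> nat -> R -> R)
  (hK : is_billiard_deformation K r r' (param_interval a b) C)
  (n : nat) (xi : 'I_n -> 'I_m) (hxi : is_itinerary xi)
  (u : R -> 'rV[R]_n)
  (hu : forall alpha, param_interval a b alpha ->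
          is_periodic_param K xi (u alpha) alpha)
  (alpha : R) (halpha : param_interval a b alpha)
  (dmin kmin phimax : R)
  (hdmin : is_minimum (flight_distances K alpha) dmin)
  (hkmin : is_minimum (reflection_curvatures K alpha) kmin)
  (hphimax : is_maximum (reflection_angles K alpha) phimax) :
  let I := param_interval a b in
  let p j beta := refl_point K xi (u beta) beta j in
  let phi j := refl_angle K xi (u alpha) alpha j in
  let B := (C 0%N 1%N alpha + C 1%N 1%N alpha * dmin) / (kmin * dmin) in
  (exists v, is_local_branch K xi I alpha (u alpha) v) /\
  forall v, is_local_branch K xi I alpha (u alpha) v ->
  forall j : 'I_n,
  exists (dp : 'rV[R]_2) (du : R),
    [/\ is_deriv_within I (p j) alpha dp,
        is_deriv_within I (fun beta => v beta 0 j) alpha du,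
        dp = du *: pderiv 1 0 (param K (xi j)) (u alpha 0 j) alpha
             + pderiv 0 1 (param K (xi j)) (u alpha 0 j) alpha,
        enorm dp <= (cos (phi j))^-1 * B + delta K I (xi j) * C 0%N 1%N alpha &
        (cos (phi j))^-1 * B + delta K I (xi j) * C 0%N 1%N alpha
          <= (cos phimax)^-1 * B + C 0%N 1%N alpha].
Proof.
move=> I p phi B.
have accum := param_interval_accum hab.
have tb := def_table hK halpha.
have sm := deformation_smooth hr hr' hK halpha.
have umin beta (Ib : I beta) : is_length_minimizer K xi (u beta) beta.
  by have [] := hu beta Ib.
have [_ uL] := hu alpha halpha; have wmin := umin alpha halpha.
split; first by eexists; exact: (local_branch_exists hr hr' hK accum hxi umin halpha).
move=> v [v_alpha Hv] j.
have vmin : \forall beta \near within I (nbhs alpha),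
    is_length_minimizer K xi (v beta) beta.
  by apply: filterS Hv => beta [].
have vcvg : v @ within I (nbhs alpha) --> u alpha.
  have /near_within_nbhsP [d d0 Hd] := Hv.
  have [|_ vv] := Hd alpha _ halpha; first by rewrite subrr normr0.
  by rewrite v_alpha in vv.
pose S i := orbit_state K alpha xi (u alpha) i.
have M0S i : M0 K alpha (S i) := orbit_state_M0 hr tb sm hxi wmin i.
have state_of x : M0 K alpha x -> is_state K alpha x.
  by move=> [z [<- Hz]]; case: (Hz 0).
have kmin0 : 0 < kmin.
  have [[x /state_of [/andP[x0 xL] _ _] <-] _] := hkmin.
  by apply: (bd_curvature tb); rewrite x0 ltW.
have kminP i : kmin <= orbit_curvature K xi alpha (u alpha) i.
  have [_ lb] := hkmin.
  rewrite -(frac_curvature hr hr' hK halpha uL).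
  by apply: lb; exists (S i).
have dmin0 : 0 < dmin.
  have [[x [y [/state_of [_ v1 _] _ [t [t0 py _ _]] ->]]] _] := hdmin.
  by rewrite py addrAC subrr add0r enormZ v1 mulr1 normr_gt0 gt_eqF.
have dminP i : dmin <= orbit_flight K xi alpha (u alpha) i.
  by have [_ lb] := hdmin; apply: lb; exact: (flight_distance_mem hr tb sm hxi wmin i).
have [x [Hx xrate]] := variation_rates hr hr' hK accum hxi halpha uL wmin vmin vcvg kmin0 kminP.
have C01 := slope_const_ge0 hr' hK halpha uL j.
have C11 := turn_const_ge0 hr hr' hK halpha uL j.
have B0 : 0 <= B.
  by rewrite divr_ge0 ?addr_ge0 ?mulr_ge0 // ltW.
have [c0 _] := orbit_reflection hr hr' hK hxi halpha uL wmin j.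
have c1 := orbit_cos_le1 hK hxi halpha uL j.
set c := orbit_cos K xi alpha (u alpha) j in c0 c1.
have acos_dom (y : R) : 0 < y -> y <= 1 -> -1 <= y <= 1.
  by move=> y0 y1; rewrite y1 andbT (le_trans _ (ltW y0)) // oppr_le0.
have cos_phi : cos (phi j) = c.
  have -> : phi j = acos c by [].
  by apply: acosK; rewrite in_itv /= acos_dom.
have [[x1 M1 phiE] ub] := hphimax.
have s1 := state_of x1 M1.
pose y := dot (vel x1) (nrm K alpha x1).
(* [phimax] is attained at a state of [M0], where reflections are not tangent, so its cosine is
   positive and inverting it reverses the inequality with [c]. *)
have y0 : 0 < y := M0_not_tangent hr tb sm M1.
have y1 : y <= 1.
  have [_ v1 _] := s1; apply: le_trans (ler_norm _) _; rewrite -(nrm_unit tb s1).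
  exact: dot_unit_le v1.
have cos_max : cos phimax = y by rewrite -phiE; apply: acosK; rewrite in_itv /= acos_dom.
have phi_le : acos c <= phimax.
  apply: ub; exists (S j); first exact: M0S.
  by rewrite (orbit_state_cos hr hr' hK halpha uL).
have yc : y <= c.
  by rewrite -phiE in phi_le; apply: acos_le_inv phi_le; exact: acos_dom.
have xB := rate_bound hr hr' hK accum hxi halpha uL wmin kmin0 dmin0 kminP dminP Hx j.
have T1 := orbit_tangent_unit hK halpha uL j.
have Db := slope_bound hr hr' hK accum halpha uL j.
exists (x j *: pderiv 1 0 (param K (xi j)) (u alpha 0 j) alpha
        + pderiv 0 1 (param K (xi j)) (u alpha 0 j) alpha), (x j); split.
- apply: negligible_deriv_within_plane => k e e0.
  have PR := point_rate hr hr' hK accum halpha uL vcvg xrate j k e0.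
  have Fp : \forall beta \near within I (nbhs alpha), I beta.
    by apply/near_within_nbhsP; exists 1.
  apply: filterS3 PR vmin Fp => beta h vb Ib.
  (* [u] may jump between representatives, but by uniqueness its reflection points are those of [v],
     to which the rate applies. *)
  rewrite /p (minimizer_unique hr hr' hK hxi Ib (umin beta Ib) vb); exact: h.
- by apply: negligible_deriv_within; rewrite v_alpha; exact: xrate.
- by [].
- exact: (velocity_bound cos_phi xB T1 Db).
apply: (angle_bound cos_phi cos_max y0 yc B0 C01).
by rewrite /delta; case: asboolP.
Qed.
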